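(* Let $\rho\vdash q$ be a nonempty partition and let $m$ be an integer with $$m\ge\rho_1,\qquad m\ge q+C(\rho)-1 .$$ Then for every complex Hermitian positive-semidefinite matrix $A$ of order $m+q$ one has $\overline d_{(m,\rho)}(A)\le\operatorname{per}(A)$. More precisely, for each partition $\tau\subset\rho$ such that $\rho/\tau$ is a nonempty horizontal strip, with $j=|\rho/\tau|\ge1$ boxes, put $$R_{m,\rho}(\tau)=jm+\binom j2-\sum_{b\in\rho/\tau}c(b)-q+j .$$ Then $R_{m,\rho}(\tau)\ge0$ for every such $\tau$, and for every complex Hermitian positive-semidefinite $A$ of order $m+q$, $$\overline d_{(m,\rho)}(A)\le\sum_{\tau}\frac{R_{m,\rho}(\tau)\,f^{(m+j,\tau)}}{q\,f^{(m,\rho)}}\;\overline d_{(m+j,\tau)}(A),$$ where the sum runs over all such $\tau$ and $j=|\rho|-|\tau|$ depends on $\tau$. The coefficients on the right-hand side sum to one. Each right-hand tail $\tau$ satisfies $|\tau|<|\rho|$, and each nonempty right-hand tail satisfies the same criterion, i.e. $m+j\ge\tau_1$ and $m+j\ge|\tau|+C(\tau)-1$.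
   Context: For a partition $\lambda\vdash n$ let $\chi^\lambda$ be the corresponding irreducible character of $S_n$ and $f^\lambda=\chi^\lambda(1)$. For an $n\times n$ complex matrix $A=(a_{ij})$ define $d_\lambda(A)=\sum_{\sigma\in S_n}\chi^\lambda(\sigma)\prod_{i=1}^n a_{i,\sigma(i)}$, $\overline d_\lambda(A)=d_\lambda(A)/f^\lambda$, and $\operatorname{per}(A)=d_{(n)}(A)$. The box $b=(i,j)$ (row $i$, column $j$) has content $c(b)=j-i$; contents of boxes in $\rho/\tau$ are computed in the Young diagram of $\rho$. A skew shape is a horizontal strip if it has at most one box in each column. For a nonempty partition $\rho$, $C(\rho)=\max\{\rho_i-i:\rho_i>\rho_{i+1}\}$ (with $\rho_{\ell+1}=0$ past the last part) is the largest content of a removable box of $\rho$. For a partition $\tau$ and an integer $r\ge\tau_1$, $(r,\tau)$ denotes the partition $(r,\tau_1,\tau_2,\dots)$, and $(r,\emptyset)=(r)$. *)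

(* Defs.v *)
From HB Require Import structures.
From mathcomp Require Import all_boot all_order all_algebra all_fingroup.
From mathcomp Require Import mxrepresentation sesquilinear spectral.
From mathcomp Require Import complex reals.

Set Implicit Arguments.
Unset Strict Implicit.
Unset Printing Implicit Defensive.

Import Order.TTheory GRing.Theory Num.Theory.
Local Open Scope ring_scope.

Section Partitions.
Local Open Scope nat_scope.
Implicit Types s t : seq nat.

(* The sequence of parts carries no trailing zeros; [::] is the empty
   partition. *)
Definition is_part s := sorted geq s && (0 \notin s).

Definition is_part_of n s := is_part s && (sumn s == n).

(* Boxes are (row, column) pairs, both numbered from 0, listed in reading
   order. *)
Definition diagram s : seq (nat * nat) :=
  [seq (i, j) | i <- iota 0 (size s), j <- iota 0 (nth 0 s i)].

Definition sub_part t s := all [in diagram s] (diagram t).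

Definition skew_boxes s t : seq (nat * nat) :=
  [seq b <- diagram s | b \notin diagram t].

Definition horizontal_strip (D : seq (nat * nat)) := uniq [seq b.2 | b <- D].

Definition content (b : nat * nat) : int := (b.2%:Z - b.1%:Z)%R.

(* The last box of row i (numbered from 0) is in column nth 0 s i - 1. *)
Definition corner_contents s : seq int :=
  [seq ((nth 0 s i)%:Z - i.+1%:Z)%R | i <- iota 0 (size s)
                                    & nth 0 s i.+1 < nth 0 s i].

(* Meaningful for a nonempty partition, where corner_contents is nonempty. *)
Definition max_corner s : int :=
  (\big[Num.max / head 0 (corner_contents s)]_(c <- corner_contents s) c)%R.

Definition is_tail s t :=
  [&& is_part t, sub_part t s, 0 < size (skew_boxes s t)
    & horizontal_strip (skew_boxes s t)].

Definition tails s : seq (seq nat) :=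
  [seq t <- [seq map val (bseqval u)
            | u <- enum {: (size s).-bseq 'I_(sumn s).+1}] | is_tail s t].

Lemma mem_diagram s i j :
  ((i, j) \in diagram s) = (i < size s) && (j < nth 0 s i).
Proof.
apply/allpairsPdep/andP => [[x [y [+ + [-> ->]]]]|[lti ltj]].
  by rewrite !mem_iota.
by exists i, j; rewrite !mem_iota.
Qed.

Lemma mem_tails s t : (t \in tails s) = is_tail s t.
Proof.
rewrite mem_filter; case tl: (is_tail s t) => //=.
have /and4P[/andP[_ t0] /allP sub _ _] := tl.
have nth_gt0 i : i < size t -> 0 < nth 0 t i.
  by move=> lti; rewrite lt0n; apply: contraNneq t0 => <-; exact: mem_nth.
have tx i : i < size t -> (i < size s) && (nth 0 t i <= nth 0 s i).
  move=> lti; have := sub (i, (nth 0 t i).-1); rewrite /= !mem_diagram lti /=.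
  by rewrite !prednK ?nth_gt0 // leqnn; apply.
have les : size t <= size s.
  by case: (size t) tx => // n /(_ n (ltnSn n)) /andP[].
have lts x : x \in t -> x < (sumn s).+1.
  move=> /(nthP 0)[i /tx/andP[lti lei] <-]; rewrite ltnS.
  apply: leq_trans lei _; rewrite sumnE (big_nth 0) big_mkord.
  by rewrite (bigD1 (Ordinal lti)) //= leq_addr.
have sz : size (map (@inord (sumn s)) t) <= size s by rewrite size_map.
apply/mapP; exists (Bseq sz); first by rewrite mem_enum.
rewrite /= -map_comp -[LHS]map_id.
by apply/eq_in_map => x /lts xs /=; rewrite inordK.
Qed.

Lemma uniq_tails s : uniq (tails s).
Proof.
rewrite filter_uniq // map_inj_uniq ?enum_uniq // => u v.
by move=> /(inj_map val_inj)/val_inj.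
Qed.

Definition tail_weight (m : nat) s t : int :=
  let j := size (skew_boxes s t) in
  (j%:Z * m%:Z + 'C(j, 2)%:Z - \sum_(b <- skew_boxes s t) content b
   - (sumn s)%:Z + j%:Z)%R.

End Partitions.

Section SpechtCharacter.
Variables (F : fieldType) (n : nat) (s : seq nat).

Definition box (k : 'I_n) : nat * nat := nth (0, 0)%N (diagram s) k.

Definition row_group : {set 'S_n} :=
  [set p : 'S_n | [forall k, (box (p k)).1 == (box k).1]].

Definition col_group : {set 'S_n} :=
  [set p : 'S_n | [forall k, (box (p k)).2 == (box k).2]].

Let aG := regular_repr F [set: 'S_n]%G.

(* The Young symmetrizer a_s b_s of the tableau box.  In MathComp, q * p means
   "q first, then p", and group elements act on row vectors from the right;
   read with functional composition, the module below is therefore the left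
   ideal F[S_n] a_s b_s, with S_n acting by left multiplication. *)
Definition young_symmetrizer : 'rV[F]_(gcard [set: 'S_n]%G) :=
  gring_row (\sum_(p in row_group) \sum_(q in col_group)
               (-1) ^+ odd_perm q *: aG (q * p)%g).

Definition specht_repr := submod_repr (cyclic_mx_module aG young_symmetrizer).

Definition specht_char (g : 'S_n) : F := \tr (specht_repr g).

Definition specht_dim : F := specht_char 1%g.

Definition immanant (A : 'M[F]_n) : F :=
  \sum_(g : 'S_n) specht_char g * \prod_i A i (g i).

Definition normalized_immanant (A : 'M[F]_n) : F := immanant A / specht_dim.

End SpechtCharacter.

Definition permanent (F : fieldType) (n : nat) (A : 'M[F]_n) : F :=
  immanant [:: n] A.

Definition psdmx (C : numClosedFieldType) (n : nat) (A : 'M[C]_n) : Prop :=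
  A \is hermsymmx /\
  forall u : 'rV[C]_n, 0 <= (u *m A *m (map_mx Num.conj u^T)) 0 0.

Definition tail_coef (F : fieldType) (m : nat) (s t : seq nat) : F :=
  let n := (m + sumn s)%N in
  let j := size (skew_boxes s t) in
  (tail_weight m s t)%:~R * specht_dim F n ((m + j)%N :: t)
  / ((sumn s)%:R * specht_dim F n (m :: s)).

(* Main.v *)
(* In the character of S_(m+q) induced from 1 x chi^rho on S_m x S_q, Pieri's rule gives
   each (m + j, tau) exactly once, tau running over rho and the tails of rho.  The sum of
   all transpositions acts on chi^lambda as the sum of the contents of lambda, and the
   weight R(tau) is the content sum of (m + j, tau) minus those of (m) and rho; for
   tau = rho this difference is -q.  Hence the sum of the R(tau) chi^(m + j, tau), minus
   q chi^(m, rho), is the contribution of the transpositions (a b) with a in the first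
   block and b in the second.  On a decomposable tensor such a transposition has
   nonnegative expectation <f (x) g, (a b) f (x) g>, a squared norm, which is the
   inequality; and it lies outside S_m x S_q, so the value at 1 is 0, which makes the
   coefficients sum to one.

   Pieri's rule is proved with Schur class functions, alternating sums of permutation
   characters (Jacobi-Trudi).  They are cancelled down by antisymmetry, and are identified
   with the characters of the Young symmetrizers because the two have norm one and inner
   product one. *)

Require Import Defs.
From HB Require Import structures.
From mathcomp Require Import all_boot all_order all_algebra all_fingroup.
From mathcomp Require Import mxrepresentation sesquilinear spectral.
From mathcomp Require Import complex reals.
From mathcomp Require Import zify ring lra.

Set Implicit Arguments.
Unset Strict Implicit.
Unset Printing Implicit Defensive.

Import Order.TTheory GRing.Theory Num.Theory.
Local Open Scope ring_scope.

(** * Words and permutation characters *)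

(** The criterion comes from bounding [R]. A strip box lies in a row of [rho] that loses boxes; such
    a row ends in a removable box, so the content is at most [C = C(rho)]. Hence
    [R >= (j-1)(m-C+1) + (m-C+1-q)], and both terms are nonnegative once [m >= q+C-1]. Passing to
    [tau] raises the largest corner content by at most one, while the tail loses [j >= 1] boxes and
    the first row gains [j]; so the criterion survives, and induction on [|rho|] ends at the empty
    tail, the permanent.

    Reducing to decomposable tensors needs a factorisation of [chi^rho]: the symmetrizer writes it
    as an average of convolutions of a real function with its reflection, and each term becomes an
    expectation in a vector [f (x) g].

    Specht characters are traces on ideals, out of reach of double counting. The bridge is von
    Neumann's lemma: a function on [S_n] that is row-invariant on one side and column-alternating on
    the other is a multiple of the coefficient function of the symmetrizer. Its scaling factor, the
    norm of its character and the action of the transposition class sum are all obtained from it. *)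

Definition wact (n : nat) (I : finType) (f : {ffun 'I_n -> I}) (g : 'S_n) :
  {ffun 'I_n -> I} := [ffun x => f (g x)].

Lemma wactM n (I : finType) (f : {ffun 'I_n -> I}) g h :
  wact f (g * h)%g = wact (wact f h) g.
Proof. by apply/ffunP => x; rewrite !ffunE permM. Qed.

Lemma wact_inj n (I : finType) (g : 'S_n) :
  injective (fun f : {ffun 'I_n -> I} => wact f g).
Proof.
move=> f f' /ffunP eqf; apply/ffunP => x.
by have := eqf (g^-1 x)%g; rewrite !ffunE permKV.
Qed.

Lemma wactK n (I : finType) (f : {ffun 'I_n -> I}) g : wact (wact f g) g^-1 = f.
Proof. by apply/ffunP => x; rewrite !ffunE permKV. Qed.

Lemma wactKV n (I : finType) (f : {ffun 'I_n -> I}) g : wact (wact f g^-1) g = f.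
Proof. by apply/ffunP => x; rewrite !ffunE permK. Qed.

Definition has_content (n k : nat) (a : 'I_k -> nat) (f : {ffun 'I_n -> 'I_k}) :=
  [forall i, #|[pred x | f x == i]| == a i].

Lemma has_contentP n k (a : 'I_k -> nat) (f : {ffun 'I_n -> 'I_k}) :
  reflect (forall i, #|[pred x | f x == i]| = a i) (has_content a f).
Proof. by apply: (iffP forallP) => H i; apply/eqP. Qed.

Lemma has_content_wact n k (a : 'I_k -> nat) (f : {ffun 'I_n -> 'I_k}) g :
  has_content a (wact f g) = has_content a f.
Proof.
apply: eq_forallb => i; congr (_ == _).
rewrite -!sum1_card [RHS](reindex_inj (@perm_inj _ g)) /=.
by apply: eq_bigl => x; rewrite !inE ffunE.
Qed.

Lemma has_content_sum n k (a : 'I_k -> nat) (f : {ffun 'I_n -> 'I_k}) :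
  has_content a f -> (\sum_i a i = n)%N.
Proof.
move=> /has_contentP cf; rewrite -[RHS]card_ord -sum1_card.
rewrite (partition_big f predT) //=; apply: eq_bigr => i _.
by rewrite sum1_card -cf.
Qed.

Lemma has_content_trans n k (a : 'I_k -> nat) (f f' : {ffun 'I_n -> 'I_k}) :
  has_content a f -> has_content a f' -> exists g, f = wact f' g.
Proof.
move=> /has_contentP cf /has_contentP cf'.
have : perm_eq [tuple f i | i < n] [tuple f' i | i < n].
  apply/allP => i _ /=; apply/eqP; rewrite -!sum1_count !big_map -!enumT !big_enum_cond /=.
  by have := etrans (cf i) (esym (cf' i)); rewrite -!sum1_card.
case/tuple_permP => p /val_inj ef; exists p; apply/ffunP => x; rewrite ffunE.
by have := congr1 (fun t => tnth t x) ef; rewrite !tnth_mktuple.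
Qed.

Lemma has_content_ex n k (a : 'I_k -> nat) :
  (\sum_i a i = n)%N -> exists f : {ffun 'I_n -> 'I_k}, has_content a f.
Proof.
move=> sa; pose s := flatten [seq nseq (a i) i | i <- enum 'I_k].
have ss : size s = n.
  rewrite size_flatten /shape -map_comp sumnE big_map big_enum /= -[RHS]sa.
  by apply: eq_bigr => i _; rewrite /= size_nseq.
have ssn : size s == n by apply/eqP.
exists [ffun x => tnth (Tuple ssn) x]; apply/has_contentP => i.
have -> : #|[pred x | [ffun x => tnth (Tuple ssn) x] x == i]| = count_mem i s.
  transitivity (count_mem i [seq tnth (Tuple ssn) x | x <- enum 'I_n]).
    rewrite -!sum1_count big_map big_enum_cond -sum1_card /=.
    by apply: eq_bigl => x; rewrite !inE ffunE.
  by rewrite map_tnth_enum.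
rewrite count_flatten -map_comp sumnE big_map big_enum /= (bigD1 i) //=.
rewrite count_nseq /= eqxx mul1n big1 ?addn0 // => j ji.
by rewrite count_nseq /= (negPf ji).
Qed.

Section PermChar.
Variable F : numFieldType.

(** The permutation character on the cosets of the Young subgroup of type [a], counted as fixed
    words. *)
Definition perm_char (n k : nat) (a : 'I_k -> nat) (g : 'S_n) : F :=
  \sum_(f : {ffun 'I_n -> 'I_k} | has_content a f) (wact f g == f)%:R.

Lemma eq_perm_char n k (a b : 'I_k -> nat) : a =1 b -> @perm_char n k a =1 perm_char b.
Proof.
by move=> ab g; apply: eq_bigl => f; apply: eq_forallb => i; rewrite ab.
Qed.

Lemma perm_char0 n k (a : 'I_k -> nat) (g : 'S_n) :
  (\sum_i a i != n)%N -> perm_char a g = 0.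
Proof. by move=> sa; rewrite /perm_char big1 // => f /has_content_sum/eqP; rewrite (negPf sa). Qed.

Lemma perm_charJ n k (a : 'I_k -> nat) (g h : 'S_n) :
  perm_char a (g ^ h)%g = perm_char a g.
Proof.
rewrite /perm_char (reindex_inj (@wact_inj _ _ h^-1)) /=.
apply: eq_big => [f|f _]; first by rewrite has_content_wact.
congr (_%:R : F); rewrite -wactM conjgE mulgA mulgK wactM; congr nat_of_bool.
by rewrite (inj_eq (@wact_inj _ _ _)).
Qed.

Lemma perm_char_perm n k (a : 'I_k -> nat) (v : 'S_k) (g : 'S_n) :
  perm_char (fun i => a (v i)) g = perm_char a g.
Proof.
pose r (v : 'S_k) (f : {ffun 'I_n -> 'I_k}) : {ffun 'I_n -> 'I_k} := [ffun x => v (f x)].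
have rK u : cancel (r u) (r u^-1%g).
  by move=> f; apply/ffunP => x; rewrite !ffunE permK.
rewrite /perm_char (reindex_inj (can_inj (rK (v^-1)%g))) /=.
apply: eq_big => [f|f _]; last first.
  congr (_%:R : F); congr nat_of_bool; rewrite -[RHS](inj_eq (can_inj (rK v^-1%g))).
  by congr (_ == _); apply/ffunP => x; rewrite !ffunE.
apply/has_contentP/has_contentP => cf i.
  have := cf (v^-1 i)%g; rewrite permKV => <-; apply: eq_card => x.
  by rewrite !inE !ffunE (inj_eq perm_inj).
rewrite -(cf (v i)); apply: eq_card => x.
by rewrite !inE !ffunE (canF_eq (permKV v)).
Qed.

(* Burnside's lemma: the words of given content form one orbit. *)
Lemma sum_perm_char n k (a : 'I_k -> nat) :
  \sum_(g : 'S_n) perm_char a g = if (\sum_i a i == n)%N then n`!%:R else 0 :> F.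
Proof.
case: eqVneq => [sa|sa]; last by apply: big1 => g _; rewrite perm_char0.
have [f0 cf0] := has_content_ex sa.
rewrite /perm_char exchange_big /=.
transitivity (\sum_(f : {ffun 'I_n -> 'I_k} | has_content a f)
    \sum_(g : 'S_n) (wact f0 g == f)%:R : F).
  apply: eq_bigr => f cf; have [r ->] := has_content_trans cf cf0.
  rewrite [RHS](reindex_inj (mulIg r)) /=.
  by apply: eq_bigr => g _; rewrite wactM.
rewrite exchange_big /=; transitivity (\sum_(g : 'S_n) 1 : F).
  apply: eq_bigr => g _; rewrite (bigD1 (wact f0 g)) ?has_content_wact //= eqxx.
  by rewrite big1 ?addr0 // => f /andP[_ /negPf fg]; rewrite eq_sym fg.
by rewrite sumr_const card_Sn.
Qed.
End PermChar.

(** * Induction from a Young subgroup of two blocks *)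

Section BlockPerm.
Variables m q : nat.
Implicit Types (p : 'S_m) (s : 'S_q).

Definition block_fun p s (x : 'I_(m + q)) : 'I_(m + q) :=
  match split x with inl i => lshift q (p i) | inr j => rshift m (s j) end.

Lemma block_fun_l p s i : block_fun p s (lshift q i) = lshift q (p i).
Proof. by rewrite /block_fun; case: split_ordP => j /eqP; rewrite eq_shift => // /eqP->. Qed.

Lemma block_fun_r p s i : block_fun p s (rshift m i) = rshift m (s i).
Proof. by rewrite /block_fun; case: split_ordP => j /eqP; rewrite eq_shift => // /eqP->. Qed.

Lemma block_fun_inj p s : injective (block_fun p s).
Proof.
move=> x y; case: (split_ordP x) => i ->; case: (split_ordP y) => j ->;
  rewrite ?(block_fun_l, block_fun_r) => /eqP; rewrite eq_shift => // /eqP/perm_inj ->//.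
Qed.

Definition bperm p s : 'S_(m + q) := perm (@block_fun_inj p s).

Lemma bperml p s i : bperm p s (lshift q i) = lshift q (p i).
Proof. by rewrite permE block_fun_l. Qed.

Lemma bpermr p s i : bperm p s (rshift m i) = rshift m (s i).
Proof. by rewrite permE block_fun_r. Qed.

Lemma bpermM p s p' s' : (bperm p s * bperm p' s')%g = bperm (p * p')%g (s * s')%g.
Proof.
apply/permP => x; rewrite permM; case: (split_ordP x) => i ->;
  by rewrite ?(bperml, bpermr) permM.
Qed.

Lemma bperm1 : bperm 1 1 = 1%g.
Proof.
by apply/permP => x; case: (split_ordP x) => i ->; rewrite ?(bperml, bpermr) !perm1.
Qed.

Lemma bpermV p s : ((bperm p s)^-1 = bperm p^-1 s^-1)%g.
Proof. by apply/eqP; rewrite eq_invg_mul bpermM !mulgV bperm1. Qed.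

Lemma bperm_eq p s p' s' : (bperm p s == bperm p' s') = (p == p') && (s == s').
Proof.
apply/eqP/andP => [/permP e|[/eqP -> /eqP ->] //]; split; apply/eqP/permP => i.
  by have := e (lshift q i); rewrite !bperml => /lshift_inj.
by have := e (rshift m i); rewrite !bpermr => /rshift_inj.
Qed.

Lemma bperm_ex (g : 'S_(m + q)) :
  (forall x, (g x < m)%N = (x < m)%N) -> exists p s, g = bperm p s.
Proof.
move=> gm.
have gl i : exists j, g (lshift q i) == lshift q j.
  have := gm (lshift q i); rewrite /= ltn_ord => lti.
  by exists (Ordinal lti); apply/eqP/val_inj.
have gr i : exists j, g (rshift m i) == rshift m j.
  case: (split_ordP (g (rshift m i))) => j ej; last by exists j; apply/eqP.
  by have := gm (rshift m i); rewrite ej /= ltn_ord ltnNge leq_addr.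
pose fl i := xchoose (gl i); pose fr i := xchoose (gr i).
have flE i : g (lshift q i) = lshift q (fl i) by apply/eqP; apply: (xchooseP (gl i)).
have frE i : g (rshift m i) = rshift m (fr i) by apply/eqP; apply: (xchooseP (gr i)).
have fl_inj : injective fl.
  by move=> i j e; apply/(@lshift_inj m q)/(@perm_inj _ g); rewrite !flE e.
have fr_inj : injective fr.
  by move=> i j e; apply/(@rshift_inj m q)/(@perm_inj _ g); rewrite !frE e.
exists (perm fl_inj), (perm fr_inj); apply/permP => x.
by case: (split_ordP x) => i ->; rewrite ?(bperml, bpermr) permE ?flE ?frE.
Qed.
End BlockPerm.

Section Words.
Variables m q : nat.

Definition cat_word k (f1 : {ffun 'I_m -> 'I_k}) (f2 : {ffun 'I_q -> 'I_k}) :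
  {ffun 'I_(m + q) -> 'I_k} :=
  [ffun x => match split x with inl i => f1 i | inr j => f2 j end].

Lemma cat_wordl k (f1 : {ffun 'I_m -> 'I_k}) f2 i : cat_word f1 f2 (lshift q i) = f1 i.
Proof. by rewrite ffunE; case: split_ordP => j /eqP; rewrite eq_shift => // /eqP->. Qed.

Lemma cat_wordr k (f1 : {ffun 'I_m -> 'I_k}) f2 i : cat_word f1 f2 (rshift m i) = f2 i.
Proof. by rewrite ffunE; case: split_ordP => j /eqP; rewrite eq_shift => // /eqP->. Qed.

Lemma cat_word_eq k (f1 f1' : {ffun 'I_m -> 'I_k}) f2 f2' :
  (cat_word f1 f2 == cat_word f1' f2') = (f1 == f1') && (f2 == f2').
Proof.
apply/eqP/andP => [/ffunP e|[/eqP -> /eqP ->] //]; split; apply/eqP/ffunP => i.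
  by have := e (lshift q i); rewrite !cat_wordl.
by have := e (rshift m i); rewrite !cat_wordr.
Qed.

Lemma cat_word_bij k : bijective (fun f : {ffun 'I_m -> 'I_k} * {ffun 'I_q -> 'I_k} =>
  cat_word f.1 f.2).
Proof.
exists (fun f : {ffun 'I_(m + q) -> 'I_k} =>
  ([ffun i => f (lshift q i)], [ffun i => f (rshift m i)])) => [[f1 f2]|f] /=.
  by congr (_, _); apply/ffunP => i; rewrite ffunE ?(cat_wordl, cat_wordr).
apply/ffunP => x.
by case: (split_ordP x) => i ->; rewrite ?(cat_wordl, cat_wordr) ffunE.
Qed.

Lemma wact_cat k (f1 : {ffun 'I_m -> 'I_k}) f2 p s :
  wact (cat_word f1 f2) (bperm p s) = cat_word (wact f1 p) (wact f2 s).
Proof.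
apply/ffunP => x; rewrite ffunE.
by case: (split_ordP x) => i ->; rewrite ?(cat_wordl, cat_wordr, bperml, bpermr) ffunE.
Qed.

Lemma card_cat_word k (f1 : {ffun 'I_m -> 'I_k}) f2 i :
  #|[pred x | cat_word f1 f2 x == i]| =
  (#|[pred x | f1 x == i]| + #|[pred x | f2 x == i]|)%N.
Proof.
rewrite -!sum1_card big_mkcond big_split_ord /=.
by congr addn; rewrite [RHS]big_mkcond; apply: eq_bigr => x _; rewrite !inE ?(cat_wordl, cat_wordr).
Qed.

Definition shift_word k (f : {ffun 'I_q -> 'I_k}) : {ffun 'I_(m + q) -> 'I_k.+1} :=
  cat_word [ffun=> ord0] [ffun x => lift ord0 (f x)].

Lemma shift_word_lt k (f : {ffun 'I_q -> 'I_k}) x :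
  (shift_word f x == ord0) = (x < m)%N.
Proof.
case: (split_ordP x) => i ->; rewrite /= ?(cat_wordl, cat_wordr) ffunE ?eqxx ?ltn_ord //.
Qed.

Lemma has_content_shift k (a : 'I_k.+1 -> nat) (f : {ffun 'I_q -> 'I_k}) :
  a ord0 = m -> has_content a (shift_word f) = has_content (fun i => a (lift ord0 i)) f.
Proof.
move=> a0.
have c0 : #|[pred x | shift_word f x == ord0]| = m.
  rewrite card_cat_word (@eq_card _ _ 'I_m) ?card_ord => [|x]; last by rewrite !inE ffunE eqxx.
  rewrite eq_card0 ?addn0 // => x.
  by rewrite !inE ffunE eq_sym (negPf (neq_lift _ _)).
have cS i : #|[pred x | shift_word f x == lift ord0 i]| = #|[pred x | f x == i]|.
  rewrite card_cat_word eq_card0 ?add0n => [|x].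
    by apply: eq_card => x; rewrite !inE ffunE (inj_eq lift_inj).
  by rewrite !inE ffunE (negPf (neq_lift _ _)).
apply/has_contentP/has_contentP => cf i; first by rewrite -cS.
by case: (unliftP ord0 i) => [j|] ->; rewrite ?cS ?c0 ?a0.
Qed.

(** The letter 0 marks exactly the first block, so a permutation matching two shifted words
    preserves the blocks and is a [bperm p s] for a unique pair. The sum over pairs has the shape in
    which [ind_char] uses it. *)
Lemma shift_word_act k (f f' : {ffun 'I_q -> 'I_k}) (g : 'S_(m + q)) :
  ((wact (shift_word f) g == shift_word f') =
  \sum_(p : 'S_m) \sum_(s : 'S_q) ((g == bperm p s) && (wact f s == f')) :> nat)%N.
Proof.
case: (boolP [forall x, (g x < m)%N == (x < m)%N]) => [/forallP gm|ngm].
  have [p [s ->]] := bperm_ex (fun x => eqP (gm x)).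
  rewrite wact_cat cat_word_eq (bigD1 p) //= (bigD1 s) //= eqxx /=.
  rewrite !big1 ?addn0 => [|p' /negPf pp'|s' /negPf ss']; last 2 first.
  - by apply: big1 => s' _; rewrite bperm_eq eq_sym pp'.
  - by rewrite bperm_eq eqxx eq_sym ss'.
  rewrite (_ : wact _ p == _) /=; last by apply/eqP/ffunP => x; rewrite !ffunE.
  congr nat_of_bool; apply/eqP/eqP => [/ffunP e|<-]; apply/ffunP => x.
    by have := e x; rewrite !ffunE => /lift_inj.
  by rewrite !ffunE.
rewrite big1 => [|p _]; last first.
  apply: big1 => s _; case: eqP => //= e; case/negP: ngm; apply/forallP => x.
  by rewrite e; case: (split_ordP x) => i ->; rewrite ?(bperml, bpermr) /= ?ltn_ord //
    !ltnNge !leq_addr.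
apply/eqP; rewrite eqb0; apply: contra ngm => /eqP/ffunP e; apply/forallP => x.
by have := e x; rewrite ffunE -!(shift_word_lt f) => ->; rewrite !shift_word_lt.
Qed.
End Words.

Section Induction.
Variable F : numFieldType.

Definition cfip (n : nat) (u v : 'S_n -> F) : F := n`!%:R^-1 * \sum_g u g * v g.

Lemma fact_neq0 n : n`!%:R != 0 :> F.
Proof. by rewrite pnatr_eq0 -lt0n fact_gt0. Qed.

Lemma sum1_Sn n : \sum_(g : 'S_n) 1 = n`!%:R :> F.
Proof. by rewrite sumr_const card_Sn. Qed.

Lemma cfipC n (u v : 'S_n -> F) : cfip u v = cfip v u.
Proof. by congr (_ * _); apply: eq_bigr => g _; rewrite mulrC. Qed.

Lemma eq_cfip n (u u' v v' : 'S_n -> F) : u =1 u' -> v =1 v' -> cfip u v = cfip u' v'.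
Proof. by move=> uu vv; congr (_ * _); apply: eq_bigr => g _; rewrite uu vv. Qed.

Lemma cfip_suml n (I : finType) (P : pred I) (u : I -> 'S_n -> F) v :
  cfip (fun g => \sum_(i | P i) u i g) v = \sum_(i | P i) cfip (u i) v.
Proof.
rewrite -mulr_sumr exchange_big /=; congr (_ * _).
by apply: eq_bigr => g _; rewrite mulr_suml.
Qed.

Lemma cfipZl n c (u v : 'S_n -> F) : cfip (fun g => c * u g) v = c * cfip u v.
Proof.
rewrite /cfip mulrCA; congr (_ * _); rewrite mulr_sumr.
by apply: eq_bigr => g _; rewrite mulrA.
Qed.

(* The character induced from [S_m x S_q] by [1 x psi]. *)
Definition ind_char (m q : nat) (psi : 'S_q -> F) (g : 'S_(m + q)) : F :=
  (m`!%:R * q`!%:R)^-1 *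
  \sum_(k : 'S_(m + q)) \sum_(p : 'S_m) \sum_(s : 'S_q) ((g ^ k)%g == bperm p s)%:R * psi s.

(** Frobenius reciprocity. The factor [S_m] carries the trivial character, so the restriction of [u]
    is averaged over it. *)
Lemma sum_ind_char m q (psi : 'S_q -> F) (u : 'S_(m + q) -> F) :
  (forall g h, u (g ^ h)%g = u g) ->
  cfip u (@ind_char m q psi) =
  cfip (fun s => m`!%:R^-1 * \sum_(p : 'S_m) u (bperm p s)) psi.
Proof.
move=> uJ; rewrite /cfip /ind_char.
under eq_bigr do rewrite mulrCA.
rewrite -mulr_sumr.
have -> : \sum_g u g * (\sum_(k : 'S_(m + q)) \sum_(p : 'S_m) \sum_(s : 'S_q)
    ((g ^ k)%g == bperm p s)%:R * psi s) =
    (m + q)`!%:R * \sum_(s : 'S_q) (\sum_(p : 'S_m) u (bperm p s)) * psi s.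
  under eq_bigr do rewrite mulr_sumr.
  rewrite exchange_big /=.
  rewrite -sum1_Sn mulr_suml; apply: eq_bigr => k _; rewrite mul1r.
  rewrite (reindex_inj (@conjg_inj _ k^-1%g)) /=.
  under eq_bigr => g _ do rewrite conjgKV mulr_sumr.
  rewrite exchange_big /=.
  under [RHS]eq_bigr => s _ do rewrite mulr_suml.
  rewrite [RHS]exchange_big /=; apply: eq_bigr => p _.
  under eq_bigr => g _ do rewrite mulr_sumr.
  rewrite exchange_big /=; apply: eq_bigr => s _.
  rewrite (bigD1 (bperm p s)) //= eqxx mul1r uJ big1 ?addr0 // => g /negPf ->.
  by rewrite mul0r mulr0.
rewrite mulrCA mulKf ?fact_neq0 // invfM -mulrA mulrCA; congr (_ * _).
rewrite mulr_sumr; apply: eq_bigr => s _; by rewrite mulrA.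
Qed.

(** Transitivity of induction through Young subgroups: each word of content [a] is
    [wact (shift_word m f) h] for exactly [m! q!] pairs of a permutation [h] and a shorter word
    [f]. *)
Lemma perm_char_ind m q k (a : 'I_k.+1 -> nat) (g : 'S_(m + q)) :
  a ord0 = m ->
  perm_char F a g = ind_char (perm_char F (fun i => a (lift ord0 i))) g.
Proof.
move=> a0; pose a' i := a (lift ord0 i).
pose T (f : {ffun 'I_(m + q) -> 'I_k.+1}) : F := (wact f g == f)%:R.
have E : \sum_(h : 'S_(m + q)) \sum_(f | has_content a' f) T (wact (shift_word m f) h)
    = m`!%:R * q`!%:R * \sum_(f | has_content a f) T f.
  case: (eqVneq (\sum_i a' i)%N q) => [sa|sa]; last first.
    rewrite big1 => [|h _]; last first.
      by rewrite big1 // => f /has_content_sum/eqP; rewrite (negPf sa).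
    rewrite big1 ?mulr0 // => f /has_content_sum; rewrite big_ord_recl a0 => /addnI/eqP.
    by rewrite (negPf sa).
  have [f1 cf1] := has_content_ex sa.
  have cs1 : has_content a (shift_word m f1) by rewrite has_content_shift.
  transitivity (\sum_(f | has_content a f) T f *
    \sum_(h : 'S_(m + q)) \sum_(f' | has_content a' f') (wact (shift_word m f') h == f)%:R).
    under [RHS]eq_bigr do rewrite mulr_sumr.
    rewrite [RHS]exchange_big /=; apply: eq_bigr => h _.
    under [RHS]eq_bigr do rewrite mulr_sumr.
    rewrite [RHS]exchange_big /=; apply: eq_bigr => f cf.
    rewrite (bigD1 (wact (shift_word m f) h)) /= ?has_content_wact ?has_content_shift //.
    rewrite eqxx mulr1 big1 ?addr0 // => f' /andP[_ /negPf ff'].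
    by rewrite eq_sym ff' mulr0.
  rewrite mulr_sumr; apply: eq_bigr => f cf; rewrite mulrC; congr (_ * _).
  have [k1 ->] := has_content_trans cf cs1.
  rewrite (reindex_inj (mulgI k1)) /=.
  rewrite -!sum1_Sn mulr_suml.
  transitivity (\sum_(h : 'S_(m + q)) \sum_(f' | has_content a' f') \sum_(p : 'S_m) \sum_(s : 'S_q)
     ((h == bperm p s) && (wact f' s == f1))%:R : F).
    apply: eq_bigr => h _; apply: eq_bigr => f' _.
    rewrite wactM (inj_eq (@wact_inj _ _ _)) shift_word_act natr_sum.
    by apply: eq_bigr => p _; rewrite natr_sum.
  under eq_bigr do rewrite exchange_big /=.
  rewrite exchange_big /=; apply: eq_bigr => p _; rewrite mul1r.
  under eq_bigr do rewrite exchange_big /=.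
  rewrite exchange_big /=; apply: eq_bigr => s _.
  rewrite (bigD1 (bperm p s)) //= eqxx /= (bigD1 (wact f1 s^-1)) ?has_content_wact //=.
  rewrite wactKV eqxx big1 ?addr0 => [|f' /andP[_ /negPf ff']].
    rewrite big1 ?addr0 // => h /negPf ->.
    by rewrite big1.
  by rewrite -(inj_eq (@wact_inj _ _ s^-1%g)) wactK ff'.
rewrite /ind_char.
have -> : \sum_(h : 'S_(m + q)) \sum_(p : 'S_m) \sum_(s : 'S_q)
    ((g ^ h)%g == bperm p s)%:R * perm_char F a' s
    = \sum_(h : 'S_(m + q)) \sum_(f | has_content a' f) T (wact (shift_word m f) h).
  apply: eq_bigr => h _.
  transitivity (\sum_(f | has_content a' f) \sum_(p : 'S_m) \sum_(s : 'S_q)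
     (((g ^ h)%g == bperm p s) && (wact f s == f))%:R : F).
    rewrite [RHS]exchange_big /=; apply: eq_bigr => p _.
    rewrite [RHS]exchange_big /=; apply: eq_bigr => s _.
    by rewrite mulr_sumr; apply: eq_bigr => f _; rewrite -natrM mulnb.
  apply: eq_bigr => f _; rewrite /T -[in RHS](inj_eq (@wact_inj _ _ h^-1%g)) wactK.
  rewrite -!wactM -mulgA -conjgE shift_word_act natr_sum.
  by apply: eq_bigr => p _; rewrite natr_sum.
by rewrite E mulKf // mulf_neq0 ?fact_neq0.
Qed.

Definition count_word n k (f : {ffun 'I_n -> 'I_k}) i := #|[pred x | f x == i]|.

Lemma sum_count_word n k (f : {ffun 'I_n -> 'I_k}) : (\sum_i count_word f i = n)%N.
Proof. by apply: (@has_content_sum _ _ _ f); apply/has_contentP. Qed.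

(** A word is cut after its first [m] letters. Once the last [q] letters are fixed, Burnside's lemma
    gives [m!] for the first block, whatever content is left over; only the bound by [a] remains
    visible. *)
Lemma perm_char_skew m q k (a : 'I_k -> nat) (s : 'S_q) :
  \sum_(p : 'S_m) perm_char F a (bperm p s) =
  m`!%:R * ((\sum_i a i == m + q)%N%:R *
    \sum_(f : {ffun 'I_q -> 'I_k} | [forall i, (count_word f i <= a i)%N]) (wact f s == f)%:R).
Proof.
have [h /= hK Kh] := cat_word_bij m q k.
transitivity (\sum_(f2 : {ffun 'I_q -> 'I_k} | [forall i, (count_word f2 i <= a i)%N])
   (wact f2 s == f2)%:R * \sum_(p : 'S_m) perm_char F (fun i => a i - count_word f2 i)%N p).
  under [RHS]eq_bigr do rewrite mulr_sumr.
  rewrite [RHS]exchange_big /=; apply: eq_bigr => p _.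
  rewrite /perm_char (reindex (fun f => cat_word f.1 f.2)) /=; last first.
    by apply: onW_bij; exists h.
  under [RHS]eq_bigr do rewrite mulr_sumr.
  rewrite big_mkcond -(pair_bigA _ (fun f1 f2 => if has_content a (cat_word f1 f2) then
    (wact (cat_word f1 f2) (bperm p s) == cat_word f1 f2)%:R else 0)) /=.
  rewrite exchange_big /= [RHS]big_mkcond /=; apply: eq_bigr => f2 _.
  case: ifPn => [/forallP le2|/forallPn[i nle]].
    rewrite [RHS]big_mkcond /=; apply: eq_bigr => f1 _.
    rewrite wact_cat cat_word_eq mulrC -natrM mulnb; congr (if _ then _ else _).
    apply: eq_forallb => i; rewrite card_cat_word -/(count_word f2 i).
    by rewrite -[in LHS](subnK (le2 i)) eqn_add2r.
  apply: big1 => f1 _; case: ifP => // /has_contentP/(_ i); rewrite card_cat_word => e.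
  by case/negP: nle; rewrite -e leq_addl.
rewrite mulrA mulr_sumr; apply: eq_bigr => f2 /forallP le2.
rewrite mulrC sum_perm_char; congr (_ * _).
have -> : (\sum_i (a i - count_word f2 i) == m)%N = (\sum_i a i == m + q)%N.
  rewrite -(eqn_add2r (\sum_i count_word f2 i)%N) -big_split sum_count_word /=.
  by congr (_ == _); apply: eq_bigr => i _; rewrite subnK.
by case: ifP => _; rewrite ?mulr1 ?mulr0.
Qed.
End Induction.

(** * Schur class functions *)

Definition staircase (K : nat) (i : 'I_K) : nat := K - i.+1.

Section Schur.
Variable F : numFieldType.

(* For [gam = lam + staircase] this is the Jacobi-Trudi determinant
   [det (h_(lam_i - i + j))], with [h_a] read as the permutation character on words of
   content [a]. *)
Definition schur (n K : nat) (gam : 'I_K -> nat) (g : 'S_n) : F :=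
  \sum_(w : 'S_K) (-1) ^+ w *
    (if [forall i, (staircase (w i) <= gam i)%N]
     then perm_char F (fun i => (gam i - staircase (w i))%N) g else 0).

Lemma eq_schur n K (a b : 'I_K -> nat) : a =1 b -> @schur n K a =1 schur b.
Proof.
move=> ab g; apply: eq_bigr => w _; congr (_ * _).
rewrite (@eq_forallb _ _ (fun i => staircase (w i) <= b i)%N) => [|i]; last by rewrite ab.
by case: ifP => // _; apply: eq_perm_char => i; rewrite ab.
Qed.

Lemma schurJ n K (gam : 'I_K -> nat) (g h : 'S_n) : schur gam (g ^ h)%g = schur gam g.
Proof. by apply: eq_bigr => w _; rewrite perm_charJ. Qed.

Lemma sum_staircase_perm K (w : 'S_K) : (\sum_i staircase (w i) = \sum_i @staircase K i)%N.
Proof. by rewrite [RHS](reindex_inj (@perm_inj _ w)). Qed.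

Lemma schur0 n K (gam : 'I_K -> nat) (g : 'S_n) :
  (\sum_i gam i != n + \sum_i @staircase K i)%N -> schur gam g = 0.
Proof.
move=> sg; apply: big1 => w _; case: ifP => [/forallP lew|_]; last by rewrite mulr0.
rewrite perm_char0 ?mulr0 //; apply: contra sg => /eqP <-.
rewrite -(sum_staircase_perm w) -big_split /=; apply/eqP.
by apply: eq_bigr => i _; rewrite subnK.
Qed.

Lemma schur_perm n K (gam : 'I_K -> nat) (v : 'S_K) (g : 'S_n) :
  schur (fun i => gam (v i)) g = (-1) ^+ v * schur gam g.
Proof.
rewrite /schur (reindex_inj (mulgI v)) /= mulr_sumr; apply: eq_bigr => w _.
rewrite odd_permM signr_addb -mulrA; congr (_ * (_ * _)).
have -> : [forall i, (staircase ((v * w)%g i) <= gam (v i))%N]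
        = [forall i, (staircase (w i) <= gam i)%N].
  apply/forallP/forallP => H i; last by rewrite permM.
  by have := H (v^-1 i)%g; rewrite permM permKV.
case: ifP => // _; rewrite -[RHS](perm_char_perm _ _ v).
by apply: eq_perm_char => i; rewrite permM.
Qed.

Lemma schur_tperm n K (gam : 'I_K -> nat) (i j : 'I_K) (g : 'S_n) : i != j ->
  schur (fun k => gam (tperm i j k)) g = - schur gam g.
Proof. by move=> ij; rewrite schur_perm odd_tperm ij mulN1r. Qed.

Lemma schur_skew m q K N (gam : 'I_K -> nat) (s : 'S_q) :
  (\sum_i gam i = m + q + \sum_i @staircase K i)%N -> (forall i, gam i < N)%N ->
  \sum_(p : 'S_m) schur gam (bperm p s) =
  m`!%:R * \sum_(b : {ffun 'I_K -> 'I_N} | [forall i, (b i <= gam i)%N]) schur (fun i => b i) s.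
Proof.
move=> sg ltN.
pose ok (w : 'S_K) (f : {ffun 'I_q -> 'I_K}) :=
  [forall i, (count_word f i + staircase (w i) <= gam i)%N].
transitivity (m`!%:R * \sum_(w : 'S_K) (-1) ^+ w *
   \sum_(f : {ffun 'I_q -> 'I_K} | ok w f) (wact f s == f)%:R : F).
  rewrite /schur exchange_big /= mulr_sumr; apply: eq_bigr => w _.
  rewrite -[LHS]mulr_sumr [RHS]mulrCA; congr (_ * _).
  case: (boolP [forall i, (staircase (w i) <= gam i)%N]) =>
    [/forallP lew|/forallPn[i nle]]; last first.
    rewrite big1 // big1 ?mulr0 // => f /forallP/(_ i) le; case/negP: nle.
    exact: leq_trans (leq_addl _ _) le.
  rewrite perm_char_skew; congr (_ * _).
  have -> : (\sum_i (gam i - staircase (w i)) == m + q)%N.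
    rewrite -(eqn_add2r (\sum_i @staircase K i)%N) -sg -(sum_staircase_perm w) -big_split /=.
    by apply/eqP; apply: eq_bigr => i _; rewrite subnK.
  rewrite mul1r; apply: eq_bigl => f; apply: eq_forallb => i.
  by rewrite -[in RHS](subnK (lew i)) leq_add2r.
congr (_ * _); rewrite /schur exchange_big /=; apply: eq_bigr => w _.
rewrite -mulr_sumr; congr (_ * _).
transitivity (\sum_(f : {ffun 'I_q -> 'I_K})
  \sum_(b : {ffun 'I_K -> 'I_N} | [forall i, (b i <= gam i)%N])
   ([forall i, b i == count_word f i + staircase (w i) :> nat])%N%:R * (wact f s == f)%:R : F).
  rewrite big_mkcond /=; apply: eq_bigr => f _; rewrite -mulr_suml.
  case: ifPn => [/forallP okf|nok].
    have ltf i : (count_word f i + staircase (w i) < N)%N by apply: leq_ltn_trans (okf i) (ltN i).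
    pose b0 : {ffun 'I_K -> 'I_N} := [ffun i => Ordinal (ltf i)].
    rewrite (bigD1 b0) /=; last by apply/forallP => i; rewrite ffunE /= okf.
    rewrite (_ : [forall i, _]); last by apply/forallP => i; rewrite ffunE.
    rewrite big1 ?addr0 ?mul1r // => b /andP[_ nb].
    case: forallP => // e; case/eqP: nb; apply/ffunP => i.
    by apply/val_inj; rewrite ffunE /=; apply/eqP.
  rewrite big1 ?mul0r // => b /forallP leb; case: forallP => // e; case/negP: nok.
  by apply/forallP => i; rewrite -(eqP (e i)).
rewrite exchange_big /=; apply: eq_bigr => b _.
case: ifPn => [/forallP leb|/forallPn[i nle]]; last first.
  apply: big1 => f _; case: forallP => [/(_ i)/eqP e|_]; last by rewrite mul0r.
  by case/negP: nle; rewrite e leq_addl.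
rewrite /perm_char [RHS]big_mkcond /=; apply: eq_bigr => f _.
have -> : [forall i, b i == (count_word f i + staircase (w i))%N :> nat] =
   has_content (fun i => b i - staircase (w i))%N f.
  by apply: eq_forallb => i; rewrite -[in LHS](subnK (leb i)) eqn_add2r eq_sym.
by case: ifP; rewrite ?mul1r ?mul0r.
Qed.

Lemma schur_ind m q K N (gam : 'I_K -> nat) (psi : 'S_q -> F) :
  (\sum_i gam i = m + q + \sum_i @staircase K i)%N -> (forall i, gam i < N)%N ->
  cfip (schur gam) (@ind_char F m q psi) =
  \sum_(b : {ffun 'I_K -> 'I_N} | [forall i, (b i <= gam i)%N]) cfip (schur (fun i => b i)) psi.
Proof.
move=> sg ltN; rewrite sum_ind_char => [|g h]; last exact: schurJ.
rewrite -cfip_suml; apply: eq_cfip => // s.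
by rewrite (schur_skew _ sg ltN) mulKf ?fact_neq0.
Qed.
End Schur.

(* The terms discarded at each step are cancelled by exchanging two adjacent
   coordinates. *)
Lemma interlacing_sum (F : numDomainType) K N (G : {ffun 'I_K -> 'I_N} -> F) (L : nat -> nat) :
  (forall (b : {ffun 'I_K -> 'I_N}) (i j : 'I_K), i != j ->
     G [ffun k => b (tperm i j k)] = - G b) ->
  (forall i, i.+1 < K -> L i.+1 < L i)%N ->
  \sum_(b : {ffun 'I_K -> 'I_N} | [forall i, (b i <= L i)%N]) G b =
  \sum_(b : {ffun 'I_K -> 'I_N} | [forall i : 'I_K, (b i <= L i)%N &&
     ((i.+1 < K)%N ==> (L i.+1 < b i)%N)]) G b.
Proof.
move=> Ganti Ldec.
pose D r (b : {ffun 'I_K -> 'I_N}) := [forall i : 'I_K, (b i <= L i)%N &&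
     ((i.+1 < K)%N && (i < r)%N ==> (L i.+1 < b i)%N)].
have -> : \sum_(b : {ffun 'I_K -> 'I_N} | [forall i, (b i <= L i)%N]) G b = \sum_(b | D 0%N b) G b.
  by apply: eq_bigl => b; apply: eq_forallb => i; rewrite andbF andbT.
transitivity (\sum_(b | D K b) G b); last first.
  by apply: eq_bigl => b; apply: eq_forallb => i; rewrite ltn_ord andbT.
suff H r : \sum_(b | D 0%N b) G b = \sum_(b | D r b) G b by apply: H.
elim: r => // r ->.
case: (ltnP r.+1 K) => [ltrK|lerK]; last first.
  apply: eq_bigl => b; apply: eq_forallb => i; congr (_ && (_ ==> _)).
  case: (ltnP i.+1 K) => //= ltiK; rewrite [in RHS]ltnS [in RHS]leq_eqVlt (_ : (i == r :> nat) = false) //.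
  by apply/eqP => e; move: (leq_trans ltiK lerK); rewrite e ltnn.
pose i0 := Ordinal (ltnW ltrK); pose i1 := Ordinal ltrK.
have i01 : i0 != i1 by rewrite -val_eqE /= neq_ltn ltnSn.
rewrite (bigID (fun b : {ffun 'I_K -> 'I_N} => (L r.+1 < b i0)%N)) /= [X in _ + X](_ : _ = 0) ?addr0.
  apply: eq_bigl => b; apply/andP/forallP => [[/forallP Db lt] i|Db].
    have /andP[-> /implyP Di] := Db i; apply/implyP => /andP[ltiK]; rewrite ltnS leq_eqVlt.
    case/orP => [/eqP ei|ltir]; last by apply: Di; rewrite ltiK.
    by rewrite ei (_ : i = i0) //; apply/val_inj.
  split; last by have /andP[_ /implyP] := Db i0; apply; rewrite /= ltrK ltnSn.
  apply/forallP => i; have /andP[-> /implyP Di] := Db i; apply/implyP => /andP[ltiK ltir].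
  by apply: Di; rewrite ltiK ltnW.
(* In the discarded terms coordinates [r] and [r+1] are both at most [L r.+1], the first because the
   new inequality fails, the second by its own bound. Neither has a lower bound in [D r], so
   exchanging them preserves this set of terms. *)
set S := \sum_(_ | _) _; suff /eqP: S = - S by rewrite -addr_eq0 -mulr2n mulrn_eq0 => /eqP.
pose sw (b : {ffun 'I_K -> 'I_N}) : {ffun 'I_K -> 'I_N} := [ffun k => b (tperm i0 i1 k)].
have swK : involutive sw by move=> b; apply/ffunP => k; rewrite !ffunE tpermK.
rewrite {1}/S (reindex_inj (inv_inj swK)) /= -sumrN; apply: eq_big => [b|b _]; last exact: Ganti.
suff imp b' : D r b' && ~~ (L r.+1 < b' i0)%N -> D r (sw b') && ~~ (L r.+1 < sw b' i0)%N.
  by apply/idP/idP => [/imp|]; rewrite ?swK //; apply: imp.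
rewrite -!leqNgt => /andP[/forallP Db le0]; have /andP[le1 _] := Db i1.
rewrite ffunE tpermL le1 andbT; apply/forallP => i; rewrite ffunE.
case: tpermP => [->|->|/eqP ni0 /eqP ni1].
- by rewrite (leq_trans le1) ?(ltnW (Ldec _ _)) //= ltnn andbF.
- by rewrite /= le0 (ltnNge r.+1 r) leqnSn andbF.
exact: Db.
Qed.

(** * Pairing Schur functions with permutation characters: unitriangularity *)

Definition exceeds (k : nat) (a : 'I_k -> nat) (mu : nat -> nat) :=
  exists i0 : 'I_k, (forall i : 'I_k, (i < i0)%N -> a i = mu i) /\ (mu i0 < a i0)%N.

Definition stair_shift (K : nat) (mu : nat -> nat) (i : 'I_K) : nat := mu i + staircase i.
Arguments stair_shift : clear implicits.

(** At the first index moved by [w] the image is larger, all smaller values being taken; a smaller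
    staircase entry is then subtracted than was added. *)
Lemma exceeds_perm K (mu : nat -> nat) (w : 'S_K) : w != 1%g ->
  (forall i, staircase (w i) <= stair_shift K mu i)%N ->
  exceeds (fun i => stair_shift K mu i - staircase (w i))%N mu.
Proof.
move=> w1 lew.
have [j wj] : exists j, w j != j.
  apply/existsP; apply: contraR w1 => /existsPn wid; apply/eqP/permP => i.
  by rewrite perm1; apply/eqP; move: (wid i); rewrite negbK.
case: (@arg_minnP _ j (fun i => w i != i) (fun i => i : nat) wj) => i0 wi0 i0min.
have wlt (i : 'I_K) : (i < i0)%N -> w i = i.
  by move=> lti; apply/eqP; apply: contraLR lti => /i0min; rewrite -leqNgt.
have gti : (i0 < w i0)%N.
  rewrite ltn_neqAle eq_sym wi0 leqNgt /=; apply/negP => /wlt/perm_inj e.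
  by rewrite e eqxx in wi0.
exists i0; rewrite /stair_shift /staircase; split=> [i /wlt ->|]; first by rewrite addnK.
by have := ltn_ord (w i0); lia.
Qed.

Section Kostka.
Variable F : numFieldType.

Lemma perm_char_S0 k (a : 'I_k -> nat) (g : 'S_0) : (\sum_i a i = 0)%N -> perm_char F a g = 1.
Proof.
move=> a0; have S1 (h : 'S_0) : h = g by apply/permP; case.
have := sum_perm_char F 0 a; rewrite a0 eqxx (bigD1 g) //= big1 ?addr0 //.
by move=> h; rewrite (S1 h) eqxx.
Qed.

Lemma schur_S0 K (g : 'S_0) : schur F (@staircase K) g = 1.
Proof.
rewrite /schur (bigD1 1%g) //= odd_perm1 mul1r.
rewrite (_ : [forall i, _]); last by apply/forallP => i; rewrite perm1.
rewrite perm_char_S0 ?big1 ?addr0 // => [w w1|i _]; last by rewrite perm1 subnn.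
case: forallP => [lew|_]; last by rewrite mulr0.
have [i0 [_ gt0]] := @exceeds_perm K (fun=> 0%N) w w1 lew.
rewrite perm_char0 ?mulr0 // (bigD1 i0) //=.
by move: gt0; rewrite /stair_shift add0n lt0n addn_eq0 negb_and => ->.
Qed.

Lemma cfip_S0 (u v : 'S_0 -> F) : cfip u v = u 1%g * v 1%g.
Proof.
rewrite /cfip invr1 mul1r (bigD1 1%g) //= big1 ?addr0 // => g.
by rewrite (_ : g = 1%g) ?eqxx //; apply/permP; case.
Qed.

Lemma sum_shift (mu : nat -> nat) K :
  (\sum_(i < K) mu i.+1 + mu 0 = \sum_(i < K) mu i + mu K)%N.
Proof.
have -> : (\sum_(i < K) mu i + mu K = \sum_(i < K.+1) mu i)%N by rewrite big_ord_recr.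
by rewrite big_ord_recl addnC.
Qed.

(* Unitriangularity of the Kostka numbers, for the lexicographic order. *)
Lemma cfip_schur_perm_char k : forall K n (mu : nat -> nat) (a : 'I_k -> nat),
  (\sum_(i < K) mu i = n)%N -> (forall i, mu i.+1 <= mu i)%N ->
  (forall i, K <= i -> mu i = 0)%N ->
  (exceeds a mu -> cfip (@schur F n K (stair_shift K mu)) (perm_char F a) = 0) /\
  ((forall i : 'I_k, a i = mu i) -> (\sum_i a i = n)%N ->
     cfip (@schur F n K (stair_shift K mu)) (perm_char F a) = 1).
Proof.
elim: k => [|k IHk] K n mu a sn mudec mu0.
  split=> [[[]]//|_]; rewrite big_ord0 => n0; subst n.
  move: n0 => n0.
  rewrite -n0 cfip_S0 perm_char_S0 ?big_ord0 // mulr1 -[RHS](schur_S0 K 1).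
  apply: eq_schur => i; rewrite /stair_shift.
  by move/esym/eqP: n0; rewrite sum_nat_eq0 => /forallP/(_ i)/= /eqP ->.
case: (eqVneq (\sum_i a i)%N n) => [sa|sa]; last first.
  split=> [_|_ /eqP]; last by rewrite (negPf sa).
  rewrite (eq_cfip (v' := fun=> 0) (fun=> erefl)) => [|g]; last by rewrite perm_char0.
  by rewrite /cfip big1 ?mulr0 // => g; rewrite mulr0.
pose a' i := a (lift ord0 i).
have [q qE] : {q | q = (\sum_i a' i)%N} by eexists.
have eq_n : n = (a ord0 + q)%N by rewrite -sa big_ord_recl qE.
move: sn sa; rewrite {}eq_n {n} => sn sa.
pose L i := (mu i + (K - i.+1))%N.
pose N := (\sum_i stair_shift K mu i).+1.
have ltN i : (stair_shift K mu i < N)%N by rewrite ltnS (bigD1 i) //= leq_addr.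
have sS : (\sum_i stair_shift K mu i = a ord0 + q + \sum_i @staircase K i)%N.
  by rewrite -sn -big_split.
have -> : cfip (@schur F (a ord0 + q) K (stair_shift K mu)) (perm_char F a) =
  cfip (schur F (stair_shift K mu)) (@ind_char F (a ord0) q (perm_char F a')).
  by apply: eq_cfip => // g; apply: perm_char_ind.
rewrite (schur_ind _ sS ltN).
rewrite (interlacing_sum (L := L)) => [|b i j ij|i ltiK]; last 2 first.
- rewrite /cfip -mulrN -sumrN; congr (_ * _); apply: eq_bigr => g _.
  rewrite -mulNr -(schur_tperm _ _ _ ij); congr (_ * _).
  by apply: eq_schur => l; rewrite ffunE.
- by rewrite /L; have := mudec i; lia.
have leD (b : {ffun 'I_K -> 'I_N}) : [forall i : 'I_K, (b i <= L i)%N &&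
     ((i.+1 < K)%N ==> (L i.+1 < b i)%N)] -> forall i : 'I_K, (mu i.+1 + staircase i <= b i)%N.
  move=> /forallP Db i; have /andP[_ /implyP Di] := Db i; rewrite /staircase.
  case: (ltnP i.+1 K) => [ltiK|leK]; last by rewrite mu0 //; lia.
  by move: (Di ltiK); rewrite /L; lia.
have sb0 (b : {ffun 'I_K -> 'I_N}) : (\sum_i b i != q + \sum_i @staircase K i)%N ->
   cfip (@schur F q K (fun i => b i)) (perm_char F a') = 0.
  move=> sb; rewrite /cfip big1 ?mulr0 // => g _; by rewrite schur0 ?mul0r.
(* An interlacing [b] keeps at least the rows of [mu] below the first, so at most [mu 0] boxes can
   have been removed. *)
have sle (b : {ffun 'I_K -> 'I_N}) : (forall i : 'I_K, mu i.+1 + staircase i <= b i)%N ->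
    (\sum_i b i = q + \sum_i @staircase K i)%N -> (a ord0 <= mu 0)%N.
  move=> leb sb; have : (\sum_(i < K) (mu i.+1 + staircase i) <= \sum_i b i)%N.
    by apply: leq_sum => i _; apply: leb.
  rewrite sb big_split /= leq_add2r.
  have := sum_shift mu K; rewrite (mu0 K) // sn addn0.
  by move: (\sum_(i < K) mu i.+1)%N (mu 0%N) (a ord0) => x y z; clear -q; lia.
case: (ltnP (mu 0%N) (a ord0)) => [lta|lea].
  split=> [_|/(_ ord0) /= e]; last by rewrite e ltnn in lta.
  apply: big1 => b /leD leb; apply: sb0; apply/eqP => /(sle _ leb).
  by rewrite leqNgt lta.
have sq : a ord0 = mu 0%N -> (\sum_(i < K) mu i.+1 = q)%N.
  by have := sum_shift mu K; rewrite (mu0 K) // sn; lia.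
(* When exactly [mu 0] boxes are removed, equality of the sums forces [b] to be [mu] without its
   first row, shifted by the staircase; the induction on the number of letters continues there. *)
suff main : a ord0 = mu 0%N ->
  \sum_(b : {ffun 'I_K -> 'I_N} | [forall i : 'I_K, (b i <= L i)%N &&
     ((i.+1 < K)%N ==> (L i.+1 < b i)%N)]) cfip (@schur F q K (fun i => b i)) (perm_char F a')
  = cfip (@schur F q K (stair_shift K (fun i => mu i.+1))) (perm_char F a').
  split=> [[i0 [eqi lti]]|ea _].
    case: (unliftP ord0 i0) eqi lti => [j|] -> eqi lti; last by rewrite ltnNge lea in lti.
    have a0 : a ord0 = mu 0%N by apply: eqi.
    rewrite main //; have [H _] := IHk K q (fun i => mu i.+1) a' (sq a0)
      (fun i => mudec i.+1) (fun i le => mu0 i.+1 (leqW le)).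
    apply: H; exists j; split=> [i lt|]; last by move: lti; rewrite lift0.
    by rewrite /a' eqi ?lift0.
  have a0 : a ord0 = mu 0%N by apply: ea.
  rewrite main //; have [_ H] := IHk K q (fun i => mu i.+1) a' (sq a0)
      (fun i => mudec i.+1) (fun i le => mu0 i.+1 (leqW le)).
  by apply: H => // i; rewrite /a' ea lift0.
move=> a0.
have ltb (i : 'I_K) : (mu i.+1 + @staircase K i < N)%N.
  by apply: leq_ltn_trans (ltN i); rewrite leq_add2r.
pose b0 : {ffun 'I_K -> 'I_N} := [ffun i => Ordinal (ltb i)].
rewrite (bigD1 b0) /=; last first.
  apply/forallP => i; rewrite ffunE /= /L leq_add2r mudec /=.
  by apply/implyP => lt; rewrite ltn_add2l /staircase; lia.
rewrite big1 ?addr0 => [|b /andP[/leD leb nb]].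
  by apply: eq_cfip => // g; apply: eq_schur => i; rewrite ffunE.
apply: sb0; apply: contra nb => /eqP sb.
have eqs : (\sum_(i < K) (mu i.+1 + staircase i) == \sum_i b i)%N.
  rewrite sb big_split /= eqn_add2r; apply/eqP; exact: sq.
have [_] := @leqif_sum 'I_K xpredT (fun i => mu i.+1 + staircase i == b i)%N
  (fun i => mu i.+1 + staircase i)%N (fun i => b i) (fun i _ => (leb i, erefl)).
rewrite eqs => /esym/forallP eqb; apply/eqP/ffunP => i; apply/val_inj; rewrite ffunE /=.
by apply/esym/eqP; have := eqb i.
Qed.

(** In the Jacobi-Trudi expansion the identity contributes the content [mu] and every other term
    exceeds [mu]. The same criterion is applied to the Schur function itself and to the character of
    the symmetrizer. *)
Lemma cfip_schur1 K n (mu : nat -> nat) (psi : 'S_n -> F) :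
  (forall a : 'I_K -> nat, exceeds a mu -> cfip psi (perm_char F a) = 0) ->
  cfip psi (perm_char F (fun i : 'I_K => mu i)) = 1 ->
  cfip psi (schur F (stair_shift K mu)) = 1.
Proof.
move=> psi0 psi1; rewrite cfipC cfip_suml (bigD1 1%g) //=.
rewrite big1 ?addr0 => [|w w1].
  rewrite cfipZl odd_perm1 mul1r (_ : [forall i, _]); last first.
    by apply/forallP => i; rewrite perm1 leq_addl.
  rewrite cfipC -psi1; apply: eq_cfip => // g; apply: eq_perm_char => i.
  by rewrite perm1 addnK.
rewrite cfipZl; case: (boolP [forall i, _]) => [/forallP lew|_].
  by rewrite cfipC psi0 ?mulr0 //; apply: exceeds_perm.
by rewrite /cfip big1 ?mulr0 // => g _; rewrite mul0r.
Qed.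
End Kostka.

(** * Young symmetrizers *)

Section Tableau.
Variables (n : nat) (row col : 'I_n -> nat).
Hypothesis tab_inj : forall x y, row x = row y -> col x = col y -> x = y.
Hypothesis tab_down : forall x i j, (i <= row x)%N -> (j <= col x)%N ->
  exists y, row y = i /\ col y = j.

Let ncols := (\max_(x < n) col x).+1.

Lemma col_lt x : (col x < ncols)%N.
Proof. by rewrite ltnS; apply: (@leq_bigmax_cond _ xpredT col). Qed.

Lemma sum_cols (P : pred 'I_n) :
  (#|P| = \sum_(y < ncols) #|[pred x | P x && (col x == y)]|)%N.
Proof.
rewrite -sum1_card (partition_big (fun x => Ordinal (col_lt x)) predT) //=.
apply: eq_bigr => y _; rewrite -sum1_card; apply: eq_bigl => x.
by rewrite !inE -val_eqE.
Qed.

Lemma card_lt_sum (h : 'I_n -> nat) r :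
  (#|[pred x | h x < r]| = \sum_(i < r) #|[pred x | h x == i]|)%N.
Proof.
elim: r => [|r IH]; first by rewrite big_ord0 eq_card0.
rewrite big_ord_recr /= -IH -[LHS](cardID [pred x | h x < r]%N) /=.
congr (_ + _)%N; apply: eq_card => x; rewrite !inE; lia.
Qed.

Section ColumnInjective.
Variable f : 'I_n -> nat.
Hypothesis f_inj : forall x y, col x = col y -> f x = f y -> x = y.

(** At most [r] distinct values lie below [r], and a column has the minimum of [r] and its height
    many cells in the first [r] rows. The case split is whether the column reaches row [r - 1]. *)
Lemma column_count r y :
  (#|[pred x | (f x < r) && (col x == y)]| <= #|[pred x | (row x < r) && (col x == y)]|)%N.
Proof.
case: r => [|r]; first by rewrite eq_card0.
case: (boolP [exists z, (row z == r) && (col z == y)]) => [/existsP[z /andP[/eqP rz /eqP cz]]|].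
  apply: (@leq_trans r.+1).
    rewrite cardE -(size_map f) -[leqRHS](size_iota 0).
    apply: uniq_leq_size => [|_ /mapP[x + ->]].
      rewrite map_inj_in_uniq ?enum_uniq // => x x'.
      by rewrite !mem_enum !inE => /andP[_ /eqP cx] /andP[_ /eqP cx']; apply: f_inj; rewrite cx.
    by rewrite mem_enum mem_iota inE => /andP[].
  rewrite [leqRHS]cardE -(size_map row) -[leqLHS](size_iota 0).
  apply: uniq_leq_size => [|i]; first exact: iota_uniq.
  rewrite mem_iota ltnS => /andP[_ ler].
  have ler' : (i <= row z)%N by rewrite rz.
  have [x [rx cx]] := @tab_down z i (col z) ler' (leqnn _).
  by apply/mapP; exists x; rewrite ?rx // mem_enum inE rx cx cz ltnS ler eqxx.
move/existsPn => nz; apply: subset_leq_card; apply/subsetP => x; rewrite !inE.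
case/andP=> _ /eqP cx; rewrite cx eqxx andbT ltnNge; apply/negP => ltr.
have [z [rz cz]] := @tab_down x r (col x) (ltnW ltr) (leqnn _).
by have := nz z; rewrite rz cz cx !eqxx.
Qed.

Lemma dominance_count r : (#|[pred x | f x < r]| <= #|[pred x | row x < r]|)%N.
Proof.
rewrite (sum_cols [pred x | f x < r]%N) (sum_cols [pred x | row x < r]%N).
by apply: leq_sum => y _; apply: column_count.
Qed.

Hypothesis f_count : forall i, #|[pred x | f x == i]| = #|[pred x | row x == i]|.

(* Column by column, [f] has at most as many values below [r] as [row]; equality of the
   totals forces equality in each column, so [(f x, col x)] is always a cell. *)
Lemma column_perm_ex : exists2 q : 'S_n, forall x, col (q x) = col x & forall x, row (q x) = f x.
Proof.
have cell x : [exists z, (row z == f x) && (col z == col x)].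
  apply: contraT => /existsPn nz.
  have rlt x' : col x' = col x -> (row x' < f x)%N.
    move=> cx; rewrite ltnNge; apply/negP => ler.
    have [z [rz cz]] := @tab_down x' (f x) (col x') ler (leqnn _).
    by have := nz z; rewrite rz cz cx !eqxx.
  have tot : (#|[pred x' | f x' < f x]| = #|[pred x' | row x' < f x]|)%N.
    by rewrite !card_lt_sum; apply: eq_bigr => i _; rewrite f_count.
  have [_] := @leqif_sum 'I_ncols xpredT _ _ _ (fun y _ => (column_count (f x) y, erefl)).
  rewrite -(sum_cols [pred x' | f x' < f x]%N) -(sum_cols [pred x' | row x' < f x]%N).
  rewrite tot eqxx => /esym/forallP/(_ (Ordinal (col_lt x)))/= /eqP eqc.
  suff : (#|[pred x' | (f x' < f x) && (col x' == col x)]| <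
          #|[pred x' | (row x' < f x) && (col x' == col x)]|)%N by rewrite eqc ltnn.
  apply: proper_card; apply/properP; split.
    by apply/subsetP => x'; rewrite !inE => /andP[_ /eqP cx]; rewrite rlt // cx /=.
  by exists x; rewrite !inE ?rlt ?ltnn ?eqxx.
pose qf x := xchoose (existsP (cell x)).
have qfP x : row (qf x) = f x /\ col (qf x) = col x.
  by have /andP[/eqP-> /eqP->] := xchooseP (existsP (cell x)).
have qf_inj : injective qf.
  by move=> x y e; apply: f_inj; [rewrite -(qfP x).2 e (qfP y).2 | rewrite -(qfP x).1 e (qfP y).1].
by exists (perm qf_inj) => x; rewrite permE; have [] := qfP x.
Qed.
End ColumnInjective.

Definition row_stab : {set 'S_n} := [set p : 'S_n | [forall k, row (p k) == row k]].
Definition col_stab : {set 'S_n} := [set p : 'S_n | [forall k, col (p k) == col k]].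

Lemma row_stabP (p : 'S_n) : reflect (forall x, row (p x) = row x) (p \in row_stab).
Proof. by rewrite inE; apply: (iffP forallP) => H x; apply/eqP. Qed.

Lemma col_stabP (p : 'S_n) : reflect (forall x, col (p x) = col x) (p \in col_stab).
Proof. by rewrite inE; apply: (iffP forallP) => H x; apply/eqP. Qed.

Lemma row_stab_group : group_set row_stab.
Proof.
apply/group_setP; split; first by apply/row_stabP => x; rewrite perm1.
by move=> p p' /row_stabP Rp /row_stabP Rp'; apply/row_stabP => x; rewrite permM Rp' Rp.
Qed.
Canonical row_stab_Group := Group row_stab_group.

Lemma col_stab_group : group_set col_stab.
Proof.
apply/group_setP; split; first by apply/col_stabP => x; rewrite perm1.
by move=> p p' /col_stabP Rp /col_stabP Rp'; apply/col_stabP => x; rewrite permM Rp' Rp.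
Qed.
Canonical col_stab_Group := Group col_stab_group.

Lemma tperm_row x y : row x = row y -> tperm x y \in row_stab.
Proof. by move=> rxy; apply/row_stabP => z; case: tpermP => [->|->|]. Qed.

Lemma tperm_col x y : col x = col y -> tperm x y \in col_stab.
Proof. by move=> rxy; apply/col_stabP => z; case: tpermP => [->|->|]. Qed.

(** Without a collision [row \o g] is injective on each column, and [column_perm_ex] supplies a
    column permutation [q] with the same rows as [g]; the remaining factor [q^-1 * g] preserves
    rows. *)
Lemma factor_or_collision (g : 'S_n) :
  (exists q p, [/\ q \in col_stab, p \in row_stab & g = q * p]%g) \/
  (exists x y, [/\ x != y, col x = col y & row (g x) = row (g y)]).
Proof.
case: (boolP [exists x, exists y, [&& x != y, col x == col y & row (g x) == row (g y)]]).
  case/existsP => x /existsP[y /and3P[xy /eqP cxy /eqP rxy]].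
  by right; exists x, y.
move=> nbad; left.
have finj x y : col x = col y -> row (g x) = row (g y) -> x = y.
  move=> cxy rxy; apply/eqP; apply: contraNT nbad => xy.
  by apply/existsP; exists x; apply/existsP; exists y; rewrite xy cxy rxy !eqxx.
have [|q Cq rq] := column_perm_ex finj.
  move=> i; rewrite -!sum1_card [RHS](reindex_inj (@perm_inj _ g)) /=.
  by apply: eq_bigl => x; rewrite !inE.
exists q, (q^-1 * g)%g; split; last by rewrite mulKVg.
  exact/col_stabP.
by apply/row_stabP => x; rewrite permM -[in RHS](permKV q x) rq.
Qed.

Section Coefficients.
Variable F : numFieldType.

Definition ycoef (g : 'S_n) : F :=
  \sum_(p in row_stab) \sum_(q in col_stab) (-1) ^+ q * ((q * p)%g == g)%:R.

Lemma sum_ycoef (u : 'S_n -> F) :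
  \sum_g ycoef g * u g = \sum_(p in row_stab) \sum_(q in col_stab) (-1) ^+ q * u (q * p)%g.
Proof.
under eq_bigr do rewrite mulr_suml.
rewrite exchange_big /=; apply: eq_bigr => p _.
under eq_bigr do rewrite mulr_suml.
rewrite exchange_big /=; apply: eq_bigr => q _.
rewrite (bigD1 (q * p)%g) //= eqxx mulr1 big1 ?addr0 // => g /negPf gqp.
by rewrite eq_sym gqp mulr0 mul0r.
Qed.

Lemma ycoefMr g p : p \in row_stab -> ycoef (g * p)%g = ycoef g.
Proof.
move=> Rp; rewrite /ycoef (reindex_inj (mulIg p)) /=.
apply: eq_big => [p'|p' _]; first by rewrite groupMr.
by apply: eq_bigr => q _; rewrite mulgA (inj_eq (mulIg p)).
Qed.

Lemma ycoefMl g q : q \in col_stab -> ycoef (q * g)%g = (-1) ^+ q * ycoef g.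
Proof.
move=> Cq; rewrite /ycoef mulr_sumr; apply: eq_bigr => p _.
rewrite (reindex_inj (mulgI q)) /= mulr_sumr.
apply: eq_big => [q'|q' _]; first by rewrite groupMl.
by rewrite odd_permM signr_addb -mulgA (inj_eq (mulgI q)) mulrA.
Qed.

Lemma ycoef1 : ycoef 1 = 1.
Proof.
rewrite /ycoef (bigD1 1%g) ?group1 //= (bigD1 1%g) ?group1 //= mulg1 eqxx odd_perm1 mul1r.
have triv p q : p \in row_stab -> q \in col_stab -> (q * p == 1)%g -> p = 1%g.
  move=> /row_stabP Rp /col_stabP Cq /eqP qp; apply/permP => x; rewrite perm1.
  have pE : p = (q^-1)%g by apply/esym/eqP; rewrite eq_invg_mul qp.
  by apply: tab_inj; rewrite ?Rp // pE -[in RHS](permKV q x) Cq.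
rewrite big1 => [|q /andP[Cq /negPf q1]]; last by rewrite mulg1 q1 mulr0.
rewrite big1 ?addr0 // => p /andP[Rp /negPf p1]; apply: big1 => q Cq.
case: (boolP (_ == 1%g)) => [/(triv _ _ Rp Cq)/eqP|_]; last by rewrite mulr0.
by rewrite p1.
Qed.

(* von Neumann's lemma: when [factor_or_collision] finds a collision, [t g] is its own
   opposite. *)
Lemma ycoef_unique (t : 'S_n -> F) :
  (forall q g, q \in col_stab -> t (q * g)%g = (-1) ^+ q * t g) ->
  (forall g p, p \in row_stab -> t (g * p)%g = t g) ->
  forall g, t g = ycoef g * t 1%g.
Proof.
move=> tl tr g; have [[q [p [Cq Rp ->]]]|[x [y [xy cxy rxy]]]] := factor_or_collision g.
  by rewrite ycoefMr // tr // -[in LHS](mulg1 q) tl // -(mulg1 q) ycoefMl // ycoef1 mulr1 mulg1.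
have Cu := tperm_col cxy.
have Ru : (tperm x y ^ g)%g \in row_stab by rewrite tpermJ; apply: tperm_row.
have zero (v : 'S_n -> F) : (forall q g, q \in col_stab -> v (q * g)%g = (-1) ^+ q * v g) ->
    (forall g p, p \in row_stab -> v (g * p)%g = v g) -> v g = 0.
  move=> vl vr; have := vl _ g Cu; rewrite conjgC vr // odd_tperm xy mulN1r.
  by move/eqP; rewrite -addr_eq0 -mulr2n mulrn_eq0 => /eqP.
by rewrite !zero ?mul0r // => *; [apply: ycoefMl | apply: ycoefMr].
Qed.

(** The coefficient at 1 of the square of the symmetrizer, hence the scalar by which the symmetrizer
    is quasi-idempotent. It turns out to be [n!] divided by the dimension of the Specht module. *)
Definition yscale : F := \sum_g ycoef g * ycoef g^-1%g.

Lemma ycoef_conv k : \sum_g ycoef g * ycoef (g^-1 * k)%g = ycoef k * yscale.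
Proof.
pose t k := \sum_g ycoef g * ycoef (g^-1 * k)%g.
rewrite -/(t k) (ycoef_unique (t := t)); first by congr (_ * _); apply: eq_bigr => g _; rewrite mulg1.
  move=> q h Cq; rewrite /t (reindex_inj (mulgI q)) /= mulr_sumr; apply: eq_bigr => g _.
  by rewrite ycoefMl // invMg -mulgA mulKg mulrA.
by move=> h p Rp; apply: eq_bigr => g _; rewrite mulgA ycoefMr.
Qed.

(** Symmetrizer times group element times symmetrizer is a multiple of the symmetrizer: as a
    function of [b] the left side satisfies the hypotheses of [ycoef_unique]. Taking [a = k^-1],
    [b = k] and summing over [k] yields the norm of [ychar]. *)
Lemma ycoef_sandwich a b :
  \sum_g ycoef g * ycoef (a * g^-1 * b)%g = ycoef b * (ycoef a * yscale).
Proof.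
pose t b := \sum_g ycoef g * ycoef (a * g^-1 * b)%g.
rewrite -/(t b) (ycoef_unique (t := t)).
- congr (_ * _); rewrite /t -ycoef_conv (reindex_inj invg_inj) (reindex_inj (mulgI a^-1%g)) /=.
  by apply: eq_bigr => g _; rewrite invMg invgK mulg1 invMg invgK mulgA mulgV mul1g mulrC.
- move=> q h Cq; rewrite /t (reindex_inj (mulgI q)) /= mulr_sumr; apply: eq_bigr => g _.
  by rewrite ycoefMl // invMg -!mulgA mulKg mulrA.
by move=> h p Rp; apply: eq_bigr => g _; rewrite mulgA ycoefMr.
Qed.

(** The trace on the ideal generated by the idempotent symmetrizer over [yscale], computed inside
    the regular representation. *)
Definition ychar (g : 'S_n) : F := yscale^-1 * \sum_h ycoef (g ^ h)%g.

(** Inversion turns [q * p] into [p^-1 * q^-1], which is conjugate to [q^-1 * p^-1], again a column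
    element times a row element with the same sign. *)
Lemma sum_ycoefJV g : \sum_h ycoef (g^-1 ^ h)%g = \sum_h ycoef (g ^ h)%g.
Proof.
rewrite exchange_big [RHS]exchange_big /= (reindex_inj invg_inj) /=.
apply: eq_big => [p|p Rp]; first by rewrite groupV.
rewrite exchange_big [RHS]exchange_big /= (reindex_inj invg_inj) /=.
apply: eq_big => [q|q Cq]; first by rewrite groupV.
rewrite [RHS](reindex_inj (mulIg q^-1%g)) /= odd_permV; apply: eq_bigr => h _.
congr (_ * (nat_of_bool _)%:R); rewrite -(inj_eq invg_inj) invMg !invgK conjVg invgK.
by rewrite -[LHS](inj_eq (@conjg_inj _ q^-1%g)) -conjgM conjgE invgK mulgK.
Qed.

Lemma ycharV g : ychar g^-1%g = ychar g.
Proof. by rewrite /ychar sum_ycoefJV. Qed.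

Hypothesis yscale_neq0 : yscale != 0.

Lemma cfip_ychar : cfip ychar ychar = 1.
Proof.
rewrite /cfip; have -> : \sum_g ychar g * ychar g =
   yscale^-1 * yscale^-1 * (n`!%:R * \sum_k \sum_g ycoef g * ycoef (g^-1 ^ k)%g).
  under eq_bigr => g _ do rewrite -{2}(ycharV g) mulrACA.
  rewrite -mulr_sumr; congr (_ * _).
  under eq_bigr do rewrite mulr_suml.
  rewrite exchange_big /= -sum1_Sn mulr_suml; apply: eq_bigr => h _; rewrite mul1r.
  rewrite (reindex_inj (@conjg_inj _ h^-1%g)) /= [RHS]exchange_big /=.
  apply: eq_bigr => g _; rewrite conjgKV mulr_sumr (reindex_inj (mulgI h)) /=.
  by apply: eq_bigr => k _; rewrite -conjVg -conjgM mulKg.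
have -> : \sum_k \sum_g ycoef g * ycoef (g^-1 ^ k)%g = yscale * yscale.
  rewrite {1}/yscale mulr_suml; apply: eq_bigr => k _.
  by rewrite -mulrA -ycoef_sandwich; apply: eq_bigr => g _; rewrite conjgE mulgA.
by rewrite mulrCA mulKf ?fact_neq0 // -mulrA mulKf // mulVf.
Qed.

Lemma cfip_ychar_perm_char k (a : 'I_k -> nat) :
  cfip ychar (perm_char F a) = yscale^-1 * \sum_(f : {ffun 'I_n -> 'I_k} | has_content a f)
    \sum_g ycoef g * (wact f g == f)%:R.
Proof.
rewrite /cfip; have -> : \sum_g ychar g * perm_char F a g =
    n`!%:R * (yscale^-1 * \sum_g ycoef g * perm_char F a g).
  under eq_bigr do rewrite -mulrA.
  rewrite -mulr_sumr mulrCA; congr (_ * _).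
  under eq_bigr do rewrite mulr_suml.
  rewrite exchange_big /= -sum1_Sn mulr_suml; apply: eq_bigr => h _; rewrite mul1r.
  rewrite (reindex_inj (@conjg_inj _ h^-1%g)) /=.
  by apply: eq_bigr => g _; rewrite conjgKV perm_charJ.
rewrite mulKf ?fact_neq0 //; congr (_ * _); rewrite exchange_big /=.
by apply: eq_bigr => g _; rewrite mulr_sumr.
Qed.

(** The transposition of [x] and [y] fixes the word and changes the sign of [ycoef]. *)
Lemma ycoef_word0 k (f : {ffun 'I_n -> 'I_k}) x y : x != y -> col x = col y -> f x = f y ->
  \sum_g ycoef g * (wact f g == f)%:R = 0.
Proof.
move=> xy cxy fxy; have Cu := tperm_col cxy.
set S := LHS; suff /eqP: S = - S by rewrite -addr_eq0 -mulr2n mulrn_eq0 => /eqP.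
rewrite {1}/S (reindex_inj (mulgI (tperm x y))) /= -sumrN; apply: eq_bigr => g _.
rewrite ycoefMl // odd_tperm xy mulN1r mulNr; congr (- (_ * (nat_of_bool _)%:R)).
have fu : wact f (tperm x y) = f.
  by apply/ffunP => z; rewrite ffunE; case: tpermP => [->|->|].
by rewrite -[in RHS](inj_eq (@wact_inj _ _ (tperm x y))) -wactM fu.
Qed.

(** A word with a repeated letter in a column contributes zero. A column-injective word obeys
    [dominance_count], which the excess at [i0] contradicts for the letters up to [i0]. *)
Lemma cfip_ychar_exceeds k (a : 'I_k -> nat) :
  exceeds a (fun i => #|[pred x | row x == i]|) -> cfip ychar (perm_char F a) = 0.
Proof.
move=> [i0 [eqa lta]]; rewrite cfip_ychar_perm_char big1 ?mulr0 // => f /has_contentP cf.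
case: (boolP [exists x, exists y, [&& x != y, col x == col y & f x == f y]]).
  case/existsP => x /existsP[y /and3P[xy /eqP cxy /eqP fxy]].
  exact: ycoef_word0 xy cxy fxy.
move=> nbad; have finj x y : col x = col y -> f x = f y :> nat -> x = y.
  move=> cxy /val_inj fxy; apply/eqP; apply: contraNT nbad => xy.
  by apply/existsP; exists x; apply/existsP; exists y; rewrite xy cxy fxy !eqxx.
have := dominance_count finj i0.+1; rewrite !card_lt_sum !big_ord_recr /=.
have cfE (i : 'I_k) : #|[pred x | f x == i :> nat]| = a i.
  by rewrite -cf; apply: eq_card => x; rewrite !inE val_eqE.
rewrite leqNgt cfE => /negP[]; rewrite -addnS leq_add //.
rewrite leq_eqVlt; apply/orP; left; apply/eqP/eq_bigr => i _.
by rewrite -(eqa (widen_ord (ltnW (ltn_ord i0)) i)) //= -cfE.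
Qed.

(** The words that survive are [row \o q] with [q] in the column group, distinct for distinct [q].
    The permutations fixing such a word form a conjugate of the row group, and the resulting double
    sum is [yscale] expanded by [sum_ycoef]. *)
Lemma cfip_ychar1 k : (forall x, row x < k)%N ->
  cfip ychar (perm_char F (fun i : 'I_k => #|[pred x | row x == i]|)) = 1.
Proof.
move=> ltk; rewrite cfip_ychar_perm_char.
pose Z (f : {ffun 'I_n -> 'I_k}) : F := \sum_g ycoef g * (wact f g == f)%:R.
pose rw (q : 'S_n) : {ffun 'I_n -> 'I_k} := [ffun x => Ordinal (ltk (q x))].
have rw_content q : has_content (fun i => #|[pred x | row x == i]|) (rw q).
  apply/has_contentP => i; rewrite -!sum1_card [RHS](reindex_inj (@perm_inj _ q)) /=.
  by apply: eq_bigl => x; rewrite !inE ffunE.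
have rw_inj : {in col_stab &, injective rw}.
  move=> q q' /col_stabP Cq /col_stabP Cq' /ffunP e; apply/permP => x; apply: tab_inj.
    by have := e x; rewrite !ffunE => /(congr1 val).
  by rewrite Cq Cq'.
have -> : \sum_(f : {ffun 'I_n -> 'I_k} | has_content (fun i => #|[pred x | row x == i]|) f) Z f
   = \sum_(q in col_stab) Z (rw q).
  rewrite -(big_imset Z rw_inj) /= [LHS](bigID (mem (rw @: col_stab))) /=.
  rewrite [X in _ + X]big1 ?addr0 => [|f /andP[/has_contentP cf nf]].
    apply: eq_bigl => f; apply/andP/idP => [[]//|fi]; split=> //.
    by case/imsetP: fi => q _ ->.
  case: (boolP [exists x, exists y, [&& x != y, col x == col y & f x == f y]]).
    case/existsP => x /existsP[y /and3P[xy /eqP cxy /eqP fxy]].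
    exact: ycoef_word0 xy cxy fxy.
  move=> nbad; have finj x y : col x = col y -> f x = f y :> nat -> x = y.
    move=> cxy /val_inj fxy; apply/eqP; apply: contraNT nbad => xy.
    by apply/existsP; exists x; apply/existsP; exists y; rewrite xy cxy fxy !eqxx.
  case/negP: nf; have [i|q Cq rq] := column_perm_ex finj.
    case: (ltnP i k) => [lti|lei].
      by rewrite -(cf (Ordinal lti)); apply: eq_card => x; rewrite !inE.
    by rewrite !eq_card0 // => x; rewrite !inE; apply/eqP => e; move: lei; rewrite -e leqNgt ?ltn_ord ?ltk.
  apply/imsetP; exists q; first exact/col_stabP.
  by apply/ffunP => x; apply/val_inj; rewrite ffunE /= rq.
suff -> : \sum_(q in col_stab) Z (rw q) = yscale by rewrite mulVf.
rewrite /yscale sum_ycoef [RHS]exchange_big /=; apply: eq_bigr => q Cq.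
rewrite (reindex_inj invg_inj) /= -mulr_sumr.
rewrite (eq_bigl (mem row_stab)) => [|p]; last by rewrite /= groupV.
rewrite /Z (reindex_inj (@conjg_inj _ q^-1%g)) /= [in RHS]big_mkcond mulr_sumr /=.
apply: eq_bigr => g _; have -> : wact (rw q) (g ^ q^-1)%g == rw q = (g \in row_stab).
  rewrite conjgE invgK; apply/eqP/row_stabP => [/ffunP e x|Rg].
    by have := e (q^-1 x)%g; rewrite !ffunE !permM !permKV => /(congr1 val).
  by apply/ffunP => x; apply/val_inj; rewrite !ffunE /= !permM permKV Rg.
case: ifP => _; last by rewrite !mulr0.
by rewrite mulr1 conjgE invgK ycoefMl // invMg invgK.
Qed.

End Coefficients.
End Tableau.

(** * Tableau characters: reality, positive definiteness, action of the transpositions *)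

Section RealClassFunctions.
Variable F : numFieldType.

Lemma perm_char_real n k (a : 'I_k -> nat) (g : 'S_n) : perm_char F a g \is Num.real.
Proof. by apply: rpred_sum => f _; apply: rpred_nat. Qed.

Lemma schur_real n K gam (g : 'S_n) : @schur F n K gam g \is Num.real.
Proof.
apply: rpred_sum => w _; rewrite rpredMsign.
by case: ifP => _; [apply: perm_char_real | apply: rpred0].
Qed.

(** [cfip] is bilinear, without conjugation; on real-valued functions it is a sum of squares. This
    is why reality is recorded for every class function that enters a difference. *)
Lemma cfip_real_eq0 n (u : 'S_n -> F) :
  (forall g, u g \is Num.real) -> cfip u u = 0 -> u =1 fun=> 0.
Proof.
move=> ur /eqP; rewrite mulf_eq0 invr_eq0 (negPf (fact_neq0 F n)) /= => /eqP u0 g.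
have sq0 h : true -> 0 <= u h * u h by move=> _; rewrite -expr2 real_exprn_even_ge0.
have := @psumr_eq0P _ _ _ _ sq0 u0 g isT => /eqP.
by rewrite mulf_eq0 orbb => /eqP.
Qed.
End RealClassFunctions.

Section TableauChar.
Variables (n : nat) (row col : 'I_n -> nat).
Hypothesis tab_inj : forall x y, row x = row y -> col x = col y -> x = y.
Hypothesis tab_down : forall x i j, (i <= row x)%N -> (j <= col x)%N ->
  exists y, row y = i /\ col y = j.
Variable F : numFieldType.
Local Notation ycoef := (@ycoef n row col F).
Local Notation chi := (@ychar n row col F).
Local Notation yscale := (@yscale n row col F).

Lemma ycoef_real g : ycoef g \is Num.real.
Proof.
apply: rpred_sum => p _; apply: rpred_sum => q _.
by rewrite rpredMsign rpred_nat.
Qed.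

Lemma yscale_real : yscale \is Num.real.
Proof. by apply: rpred_sum => g _; apply: rpredM; apply: ycoef_real. Qed.

Lemma ychar_real g : chi g \is Num.real.
Proof.
apply: rpredM; first by rewrite rpredV yscale_real.
by apply: rpred_sum => h _; apply: ycoef_real.
Qed.

Hypothesis yscale_neq0 : yscale != 0.

(* Both sides have norm one, and so has their inner product. *)
Lemma ychar_schur K (mu : nat -> nat) : (forall i, #|[pred x | row x == i]| = mu i) ->
  (forall x, row x < K)%N -> (forall i, mu i.+1 <= mu i)%N ->
  chi =1 @schur F n K (stair_shift K mu).
Proof.
move=> muE ltK mudec.
have mu0 i : (K <= i)%N -> mu i = 0%N.
  move=> leKi; rewrite -muE eq_card0 // => x; rewrite !inE.
  by apply/eqP => e; move: (ltK x); rewrite e ltnNge leKi.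
have smu : (\sum_(i < K) mu i = n)%N.
  rewrite -(eq_bigr _ (fun (i : 'I_K) _ => muE i)) -(card_lt_sum row).
  by rewrite (@eq_card _ _ 'I_n) ?card_ord // => x; rewrite !inE ltK.
set s := @schur F n K (stair_shift K mu).
have s1 : cfip s s = 1.
  apply: cfip_schur1 => [a ea|].
    by have [-> ] := cfip_schur_perm_char F a smu mudec mu0.
  by have [_ ->] := cfip_schur_perm_char F (fun i : 'I_K => mu i) smu mudec mu0.
have ps : cfip chi s = 1.
  apply: cfip_schur1 => [a [i0 [ea lt]]|].
    apply: cfip_ychar_exceeds => //; exists i0; rewrite muE; split=> // i lti.
    by rewrite muE ea.
  rewrite -[RHS](cfip_ychar1 tab_inj tab_down yscale_neq0 ltK).
  by apply: eq_cfip => // g; apply: eq_perm_char => i; rewrite muE.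
have pp : cfip chi chi = 1 by apply: cfip_ychar.
have d0 : cfip (fun g => chi g - s g) (fun g => chi g - s g) = 0.
  transitivity (cfip chi chi - cfip chi s *+ 2 + cfip s s); last first.
    by rewrite s1 ps pp; ring.
  rewrite /cfip -mulrnAr -mulrBr -mulrDr -sumrMnl -sumrB -big_split /=; congr (_ * _).
  by apply: eq_bigr => g _; ring.
move=> g; apply/eqP; rewrite -subr_eq0; apply/eqP.
apply: (cfip_real_eq0 _ d0) => h.
by rewrite rpredB ?ychar_real ?schur_real.
Qed.

(** Exhibits [chi] as a positive definite function. Expanding one factor by [sum_ycoef], column
    elements leave through the square of their sign and row elements through the average over
    conjugates, which accounts for the two group orders. *)
Lemma ychar_posdef g :
  \sum_h \sum_v ycoef (v * (g ^ h)^-1)%g * ycoef v =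
  #|row_stab row|%:R * #|col_stab col|%:R * (yscale * chi g).
Proof.
rewrite /ychar mulVKf // -sum_ycoefJV.
transitivity (\sum_h \sum_(p in row_stab row) \sum_(q in col_stab col)
   ycoef (p * (g ^ h)^-1)%g : F).
  apply: eq_bigr => h _; under eq_bigr => v _ do rewrite mulrC.
  rewrite sum_ycoef; apply: eq_bigr => p _; apply: eq_bigr => q Cq.
  by rewrite -mulgA (ycoefMl row F _ Cq) mulrA -signr_addb addbb mul1r.
transitivity (\sum_(p in row_stab row) \sum_(q in col_stab col) \sum_h ycoef (g^-1 ^ h)%g : F).
  rewrite exchange_big /=; apply: eq_bigr => p Rp.
  rewrite exchange_big /=; apply: eq_bigr => q Cq.
  rewrite [RHS](reindex_inj (mulIg p^-1%g)) /=; apply: eq_bigr => h _.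
  by rewrite conjgM [(_ ^ p^-1)%g]conjgE invgK conjVg mulgA [RHS]ycoefMr // groupV.
under eq_bigr do rewrite sumr_const.
by rewrite sumr_const -mulrnA mulnC -[LHS]mulr_natl natrM.
Qed.

(** The sum over ordered pairs, diagonal included, is [n] plus twice the class sum of
    transpositions. It is central, so multiplying by it preserves the covariance required by
    [ycoef_unique]. *)
Lemma ycoef_casimir g :
  \sum_i \sum_j ycoef (g * tperm i j)%g = ycoef g * \sum_i \sum_j ycoef (tperm i j).
Proof.
pose t g := \sum_i \sum_j ycoef (g * tperm i j)%g.
rewrite -/(t g) (ycoef_unique tab_inj tab_down (t := t)).
- by congr (_ * _); apply: eq_bigr => i _; apply: eq_bigr => j _; rewrite mul1g.
- move=> q h Cq; rewrite /t mulr_sumr; apply: eq_bigr => i _.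
  by rewrite mulr_sumr; apply: eq_bigr => j _; rewrite -mulgA ycoefMl.
move=> h p Rp; rewrite [RHS](reindex_inj (@perm_inj _ p^-1%g)) /=; apply: eq_bigr => i _.
rewrite [RHS](reindex_inj (@perm_inj _ p^-1%g)) /=; apply: eq_bigr => j _.
by rewrite -mulgA (conjgCV p) tpermJ mulgA ycoefMr.
Qed.

Lemma ychar_casimir g :
  \sum_i \sum_j chi (g * tperm i j)%g = (\sum_i \sum_j ycoef (tperm i j)) * chi g.
Proof.
rewrite mulrC /ychar -mulrA mulr_suml.
under [in RHS]eq_bigr do rewrite -ycoef_casimir.
under [LHS]eq_bigr do rewrite -mulr_sumr.
rewrite -mulr_sumr; congr (_ * _).
under [LHS]eq_bigr do rewrite exchange_big /=.
rewrite [LHS]exchange_big /=; apply: eq_bigr => h _.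
rewrite [RHS](reindex_inj (@perm_inj _ h)) /=; apply: eq_bigr => i _.
rewrite [RHS](reindex_inj (@perm_inj _ h)) /=; apply: eq_bigr => j _.
by rewrite conjMg tpermJ.
Qed.

Lemma ycoef_tperm i j :
  ycoef (tperm i j) = (row i == row j)%:R - (col i == col j)%:R + (i == j)%:R.
Proof.
case: (eqVneq i j) => [->|ij]; first by rewrite tperm1 ycoef1 // !eqxx subrr add0r.
rewrite addr0; case: (eqVneq (row i) (row j)) => [rij|rij].
  rewrite -[tperm i j]mul1g ycoefMr ?tperm_row // ycoef1 //.
  case: eqP => [/(tab_inj rij)/eqP|_]; last by rewrite subr0.
  by rewrite (negPf ij).
case: (eqVneq (col i) (col j)) => [cij|cij].
  by rewrite -[tperm i j]mulg1 ycoefMl ?tperm_col // ycoef1 // odd_tperm ij mulr1 sub0r.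
rewrite subrr.
(* With [z] in the row of [i] and the column of [j], the column transposition [(z j)] is
   conjugate under [(i j)] to the row transposition [(z i)]. *)
wlog ltij : i j ij rij cij / (row i < row j)%N => [H|].
  case: (ltngtP (row i) (row j)) => [lt|lt|/eqP]; last by rewrite (negPf rij).
    exact: H.
  by rewrite tpermC; apply: H; rewrite // eq_sym.
have [z [rz cz]] := tab_down (ltnW ltij) (leqnn (col j)).
have zj : z != j by apply: contraNneq rij => <-; rewrite rz.
have zi : z != i by apply: contraNneq cij => <-; rewrite cz.
have Cu := tperm_col cz.
have := ycoefMl row F (tperm i j) Cu; rewrite conjgC tpermJ tpermR (tpermD _ _ ); first last.
- by rewrite eq_sym.
- by rewrite eq_sym.
rewrite ycoefMr ?tperm_row // odd_tperm zj mulN1r => /eqP.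
by rewrite -addr_eq0 -mulr2n mulrn_eq0 => /eqP.
Qed.
End TableauChar.

(** * Specht characters *)

Lemma submod_trace (F : fieldType) (gT : finGroupType) (G : {group gT}) (n : nat)
    (rG : mx_representation F G n) (U E : 'M[F]_n) (Umod : mxmodule rG U) x :
  x \in G -> (E <= U)%MS -> (forall m (W : 'M_(m, n)), (W <= U)%MS -> W *m E = W) ->
  \tr (submod_repr Umod x) = \tr (E *m rG x).
Proof.
move=> Gx EU fixE; rewrite /= /submod_mx.
set B := val_submod 1%:M.
have BU : (B *m rG x <= U)%MS by rewrite mxmodule_trans // val_submod1.
rewrite -[in RHS](in_submodK EU) val_submodE -mulmxA [RHS]mxtrace_mulC.
by rewrite (in_submodE _ E) mulmxA fixE // -in_submodE.
Qed.

Lemma nilpotent_trace (F : fieldType) n (M : 'M[F]_n) : M *m M = 0 -> \tr M = 0.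
Proof.
rewrite -{1 2 3}(mulmx_base M) => M0; rewrite mxtrace_mulC.
suff -> : row_base M *m col_base M = 0 by rewrite linear0.
apply: (row_full_inj (col_base_full M)); apply: (row_free_inj (row_base_free M)).
by rewrite mulmx0 mul0mx -M0 !mulmxA.
Qed.

Section SpechtTrace.
Variables (F : numFieldType) (n : nat) (s : seq nat).
Let brow (k : 'I_n) := (box s k).1.
Let bcol (k : 'I_n) := (box s k).2.
Hypothesis tab_inj : forall x y, brow x = brow y -> bcol x = bcol y -> x = y.
Hypothesis tab_down : forall x i j, (i <= brow x)%N -> (j <= bcol x)%N ->
  exists y, brow y = i /\ bcol y = j.

Local Notation G := [set: 'S_n]%G.
Local Notation aG := (regular_repr F G).
Local Notation c := (@ycoef n brow bcol F).
Local Notation kappa := (@yscale n brow bcol F).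

Lemma sum_enum_val (R : nmodType) (u : 'S_n -> R) :
  \sum_(i < gcard G) u (enum_val i) = \sum_g u g.
Proof.
by rewrite -(big_enum_val u) /=; apply: eq_bigl => g; rewrite inE.
Qed.

Lemma regularE x (i j : 'I_(gcard G)) : aG x i j = ((enum_val i * x)%g == enum_val j)%:R.
Proof.
rewrite /= /regular_mx !mxE eqxx /= -(inj_eq enum_val_inj) gring_indexK ?inE //.
by rewrite eq_sym.
Qed.

Lemma young_symmetrizerE j : young_symmetrizer F n s 0 j = c (enum_val j).
Proof.
rewrite /young_symmetrizer /gring_row !mxE summxE; apply: eq_bigr => p _.
rewrite summxE; apply: eq_bigr => q _; rewrite mxE regularE gring_indexK ?inE //.
by rewrite mul1g.
Qed.

(** Multiplication by the symmetrizer on the side opposite to the action: it commutes with every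
    [aG x], its rows span translates of the symmetrizer, and divided by [kappa] it projects onto the
    Specht module. *)
Let M : 'M[F]_(gcard G) := \matrix_(i, j) c (enum_val j * (enum_val i)^-1)%g.

Lemma mul_row_ymx (v : 'rV_(gcard G)) (u : 'S_n -> F) j :
  (forall i, v 0 i = u (enum_val i)) -> (v *m M) 0 j = \sum_g u g * c (enum_val j * g^-1)%g.
Proof.
by move=> vE; rewrite mxE -sum_enum_val; apply: eq_bigr => i _; rewrite mxE vE.
Qed.

Lemma ymx_comm x : M *m aG x = aG x *m M.
Proof.
apply/matrixP => i j; rewrite !mxE.
transitivity (c (enum_val j * x^-1 * (enum_val i)^-1)%g).
  transitivity (\sum_g c (g * (enum_val i)^-1)%g * ((g * x)%g == enum_val j)%:R).
    by rewrite -sum_enum_val; apply: eq_bigr => k _; rewrite mxE regularE.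
  rewrite (bigD1 (enum_val j * x^-1)%g) //= mulgKV eqxx mulr1 big1 ?addr0 // => g.
  by rewrite (can2_eq (mulgK x) (mulgKV x)) => /negPf ->; rewrite mulr0.
rewrite -mulgA -invMg; symmetry.
transitivity (\sum_g ((enum_val i * x)%g == g)%:R * c (enum_val j * g^-1)%g).
  by rewrite -sum_enum_val; apply: eq_bigr => k _; rewrite regularE mxE.
rewrite (bigD1 (enum_val i * x)%g) //= eqxx mul1r big1 ?addr0 // => g /negPf gx.
by rewrite eq_sym gx mul0r.
Qed.

Lemma ycoef_convr k : \sum_g c g * c (k * g^-1)%g = kappa * c k.
Proof.
rewrite mulrC -(ycoef_conv tab_inj tab_down).
rewrite [RHS](reindex_inj (inj_comp (mulgI k) invg_inj)) /=.
by apply: eq_bigr => g _; rewrite invMg invgK mulgKV mulrC.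
Qed.

Lemma mul_symmetrizer_ymx : young_symmetrizer F n s *m M = kappa *: young_symmetrizer F n s.
Proof.
apply/rowP => j; rewrite (mul_row_ymx _ young_symmetrizerE) mxE young_symmetrizerE.
exact: ycoef_convr.
Qed.

Lemma row_ymx i : row i M = young_symmetrizer F n s *m aG (enum_val i).
Proof.
apply/rowP => j; rewrite !mxE.
transitivity (\sum_g c g * ((g * enum_val i)%g == enum_val j)%:R); last first.
  by rewrite -sum_enum_val; apply: eq_bigr => k _; rewrite young_symmetrizerE regularE.
rewrite (bigD1 (enum_val j * (enum_val i)^-1)%g) //= mulgKV eqxx mulr1 big1 ?addr0 // => g.
by rewrite (can2_eq (mulgK _) (mulgKV _)) => /negPf ->; rewrite mulr0.
Qed.

Lemma ymx_sqr : M *m M = kappa *: M.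
Proof.
apply/row_matrixP => i; rewrite row_mul linearZ /= row_ymx -mulmxA -ymx_comm mulmxA.
by rewrite mul_symmetrizer_ymx scalemxAl.
Qed.

Lemma trace_ymx_regular x : \tr (M *m aG x) = \sum_h c (x^-1 ^ h)%g.
Proof.
rewrite (reindex_inj invg_inj) /= -sum_enum_val; apply: eq_bigr => i _.
rewrite mxE; transitivity (\sum_g c (g * (enum_val i)^-1)%g * ((g * x)%g == enum_val i)%:R).
  by rewrite -sum_enum_val; apply: eq_bigr => k _; rewrite mxE regularE.
rewrite (bigD1 (enum_val i * x^-1)%g) //= mulgKV eqxx mulr1 big1 ?addr0 => [|g].
  by rewrite conjgE invgK mulgA.
by rewrite (can2_eq (mulgK x) (mulgKV x)) => /negPf ->; rewrite mulr0.
Qed.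

(** If the scalar vanished, [M] would square to zero and have trace zero; but each diagonal entry of
    [M] is [ycoef 1 = 1], so the trace is [n!]. *)
Lemma yscale_neq0 : kappa != 0.
Proof.
apply/eqP => k0; have := nilpotent_trace (_ : M *m M = 0).
rewrite ymx_sqr k0 scale0r => /(_ erefl) /eqP; have := trace_ymx_regular 1.
rewrite repr_mx1 mulmx1 => ->; rewrite (eq_bigr (fun=> 1)) => [|h _].
  by rewrite sum1_Sn (negPf (fact_neq0 F n)).
by rewrite invg1 conj1g ycoef1.
Qed.

Lemma specht_char_ychar x : specht_char F s x = @ychar n brow bcol F x.
Proof.
rewrite /specht_char /specht_repr (submod_trace (E := kappa^-1 *: M)) ?inE //.
- by rewrite -scalemxAl mxtraceZ trace_ymx_regular /ychar sum_ycoefJV.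
- apply/row_subP => i; rewrite linearZ /= row_ymx scalemx_sub //.
  by apply: mxmodule_trans (cyclic_mx_module _ _) _ _; rewrite ?inE // cyclic_mx_id.
(* [E] fixes the generator and commutes with the action, hence it fixes the whole cyclic module. *)
move=> m W WU; set E := kappa^-1 *: M.
have : (cyclic_mx aG (young_symmetrizer F n s) <= kermx (E - 1%:M))%MS.
  apply: cyclic_mx_sub.
    apply/mxmoduleP => g Gg; apply/sub_kermxP; rewrite -mulmxA.
    have -> : aG g *m (E - 1%:M) = (E - 1%:M) *m aG g.
      by rewrite mulmxBr mulmxBl mulmx1 mul1mx /E -scalemxAr -scalemxAl ymx_comm.
    by rewrite mulmxA mulmx_ker mul0mx.
  apply/sub_kermxP; rewrite mulmxBr mulmx1 /E -scalemxAr mul_symmetrizer_ymx scalerA.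
  by rewrite mulVf ?yscale_neq0 // scale1r subrr.
move/(submx_trans WU)/sub_kermxP/eqP.
by rewrite mulmxBr mulmx1 subr_eq0 => /eqP.
Qed.

Lemma specht_dim_yscale : specht_dim F n s * kappa = n`!%:R.
Proof.
rewrite /specht_dim specht_char_ychar /ychar mulrC mulVKf ?yscale_neq0 //.
rewrite (eq_bigr (fun=> 1)) ?sum1_Sn // => h _.
by rewrite conj1g ycoef1.
Qed.

Lemma specht_dim_gt0 : 0 < specht_dim F n s.
Proof.
rewrite lt_neqAle; apply/andP; split.
  rewrite eq_sym; apply: contraNneq (fact_neq0 F n) => d0.
  by rewrite -specht_dim_yscale d0 mul0r.
by rewrite /specht_dim /specht_char repr_mx1 mxtrace1 ler0n.
Qed.

Lemma yscale_gt0 : 0 < kappa.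
Proof. by rewrite -(pmulr_rgt0 _ specht_dim_gt0) specht_dim_yscale ltr0n fact_gt0. Qed.
End SpechtTrace.

Lemma count_left (n : nat) (row col : 'I_n -> nat)
    (tab_inj : forall x y, row x = row y -> col x = col y -> x = y)
    (tab_down : forall x i j, (i <= row x)%N -> (j <= col x)%N ->
       exists y, row y = i /\ col y = j) x :
  #|[pred y | (row y == row x) && (col y < col x)%N]| = col x.
Proof.
apply/eqP; rewrite eqn_leq; apply/andP; split.
  rewrite cardE -(size_map col) -[leqRHS](size_iota 0).
  apply: uniq_leq_size => [|_ /mapP[y + ->]].
    rewrite map_inj_in_uniq ?enum_uniq // => y z; rewrite !mem_enum !inE.
    by move=> /andP[/eqP ry _] /andP[/eqP rz _]; apply: tab_inj; rewrite ry.
  by rewrite mem_enum mem_iota inE => /andP[].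
rewrite [leqRHS]cardE -(size_map col) -[leqLHS](size_iota 0).
apply: uniq_leq_size => [|j]; first exact: iota_uniq.
rewrite mem_iota => /andP[_ ltj].
have [y [ry cy]] := tab_down x _ _ (leqnn _) (ltnW ltj).
by apply/mapP; exists y; rewrite ?cy // mem_enum inE ry cy ltj eqxx.
Qed.

(** The diagonal gives [n], and each remaining unordered pair is counted at its right-hand cell,
    which has [col] cells to its left. For a general pair of coordinate functions the statement also
    covers columns, by exchanging the two. *)
Lemma sum_same_row (R : pzRingType) (n : nat) (row col : 'I_n -> nat)
    (tab_inj : forall x y, row x = row y -> col x = col y -> x = y)
    (tab_down : forall x i j, (i <= row x)%N -> (j <= col x)%N ->
       exists y, row y = i /\ col y = j) :
  \sum_i \sum_j (row i == row j)%:R = n%:R + (\sum_i (col i)%:R) *+ 2 :> R.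
Proof.
have split3 i j : (row i == row j)%:R = (i == j)%:R +
   ((row j == row i) && (col j < col i)%N)%:R + ((row i == row j) && (col i < col j)%N)%:R :> R.
  case: (eqVneq i j) => [->|ij]; first by rewrite eqxx ltnn !addr0.
  rewrite add0r [row j == row i]eq_sym; case: (eqVneq (row i) (row j)) => [rij|_] /=; last by rewrite addr0.
  case: ltngtP => [_|_|cij]; rewrite ?addr0 ?add0r //.
  by move: ij; rewrite (tab_inj _ _ rij (esym cij)) eqxx.
have cl i : \sum_j ((row j == row i) && (col j < col i)%N)%:R = (col i)%:R :> R.
  rewrite -[in RHS](count_left tab_inj tab_down) -sum1_card natr_sum [RHS]big_mkcond /=.
  by apply: eq_bigr => j _; rewrite inE; case: ifP.
under eq_bigr => i _ do rewrite (eq_bigr _ (fun j _ => split3 i j)) !big_split /= cl.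
rewrite !big_split /= mulr2n addrA; congr (_ + _ + _); last first.
  by rewrite exchange_big /=; apply: eq_bigr => i _; rewrite cl.
rewrite -[in RHS](card_ord n) -sum1_card natr_sum; apply: eq_bigr => i _.
by rewrite (bigD1 i) //= eqxx big1 ?addr0 // => j /negPf; rewrite eq_sym => ->.
Qed.

Section Partition.
Implicit Types (s : seq nat) (n : nat).

Lemma part_nth_ge s i : is_part s -> (nth 0 s i.+1 <= nth 0 s i)%N.
Proof.
move=> /andP[/(sortedP 0%N) srt _]; case: (ltnP i.+1 (size s)) => [/srt //|le].
by rewrite nth_default.
Qed.

Lemma part_nth_homo s i j : is_part s -> (i <= j)%N -> (nth 0 s j <= nth 0 s i)%N.
Proof.
move=> ps; elim: j => [|j IH]; first by rewrite leqn0 => /eqP ->.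
rewrite leq_eqVlt => /orP[/eqP -> //|/IH le].
by apply: leq_trans le; apply: part_nth_ge.
Qed.

Lemma part_nth_gt0 s i : is_part s -> (0 < nth 0 s i)%N = (i < size s)%N.
Proof.
move=> /andP[_ s0]; case: (ltnP i (size s)) => [lt|le]; last by rewrite nth_default.
by rewrite lt0n; apply: contraNneq s0 => <-; apply: mem_nth.
Qed.

Lemma size_diagram s : size (diagram s) = sumn s.
Proof.
rewrite /diagram size_allpairs_dep !sumnE big_map [RHS](big_nth 0) /index_iota subn0.
by apply: eq_bigr => i _; rewrite size_iota.
Qed.

Lemma uniq_diagram s : uniq (diagram s).
Proof.
apply: allpairs_uniq_dep => [|i _|[i j] [i' j'] _ _ /= [-> ->] //]; exact: iota_uniq.
Qed.

Lemma sumn_nth s K : (size s <= K)%N -> sumn s = (\sum_(i < K) nth 0 s i)%N.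
Proof.
move=> le; rewrite sumnE (big_nth 0) big_mkord (big_ord_widen _ _ le) big_mkcond /=.
by apply: eq_bigr => i _; case: ltnP => // lei; rewrite nth_default.
Qed.

Section Box.
Variables (n : nat) (s : seq nat).
Hypothesis ps : is_part_of n s.

Lemma part_of_part : is_part s. Proof. by case/andP: ps. Qed.
Lemma part_of_sum : sumn s = n. Proof. by case/andP: ps => _ /eqP. Qed.

Lemma box_mem (k : 'I_n) : box s k \in diagram s.
Proof. by apply: mem_nth; rewrite size_diagram part_of_sum. Qed.

Lemma box_inj (x y : 'I_n) : (box s x).1 = (box s y).1 -> (box s x).2 = (box s y).2 -> x = y.
Proof.
move=> e1 e2; apply/val_inj/eqP; rewrite /=.
rewrite -(nth_uniq (0, 0)%N _ _ (uniq_diagram s)) ?size_diagram ?part_of_sum //.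
by rewrite -/(box s x) -/(box s y) [box s x]surjective_pairing e1 e2 -surjective_pairing.
Qed.

Lemma box_surj b : b \in diagram s -> exists k : 'I_n, box s k = b.
Proof.
move=> bs; have lt : (index b (diagram s) < n)%N by rewrite -part_of_sum -size_diagram index_mem.
by exists (Ordinal lt); rewrite /box /= nth_index.
Qed.

Lemma box_down (x : 'I_n) i j : (i <= (box s x).1)%N -> (j <= (box s x).2)%N ->
  exists y : 'I_n, (box s y).1 = i /\ (box s y).2 = j.
Proof.
move=> lei lej; have := box_mem x; rewrite [box s x]surjective_pairing mem_diagram.
case/andP=> lt1 lt2; have : (i, j) \in diagram s.
  rewrite mem_diagram (leq_ltn_trans lei lt1) /= (leq_ltn_trans lej) //.
  by apply: leq_trans lt2 _; apply: part_nth_homo lei; apply: part_of_part.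
by case/box_surj => y yE; exists y; rewrite yE.
Qed.

Lemma card_box_row i : #|[pred x : 'I_n | (box s x).1 == i]| = nth 0 s i.
Proof.
rewrite cardE -(size_map (fun x : 'I_n => (box s x).2)) -[RHS](size_iota 0).
apply/perm_size/uniq_perm; last 1 first.
- move=> j; rewrite mem_iota /= add0n; apply/mapP/idP => [[x + ->]|ltj].
    rewrite mem_enum inE => /eqP <-; have := box_mem x.
    by rewrite [X in X \in _]surjective_pairing mem_diagram => /andP[].
  have : (i, j) \in diagram s.
    by rewrite mem_diagram ltj -(part_nth_gt0 _ part_of_part) (leq_ltn_trans _ ltj).
  by case/box_surj => x xE; exists x; rewrite ?xE // mem_enum inE xE.
- rewrite map_inj_in_uniq ?enum_uniq // => x y; rewrite !mem_enum !inE.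
  by move=> /eqP rx /eqP ry; apply: box_inj; rewrite rx.
exact: iota_uniq.
Qed.

Lemma box_row_lt (x : 'I_n) : ((box s x).1 < size s)%N.
Proof. by have := box_mem x; rewrite [X in X \in _]surjective_pairing mem_diagram => /andP[]. Qed.

Lemma sum_box (R : nmodType) (u : nat * nat -> R) :
  \sum_(x < n) u (box s x) = \sum_(b <- diagram s) u b.
Proof. by rewrite (big_nth (0, 0)%N) size_diagram part_of_sum big_mkord. Qed.
End Box.
End Partition.

Definition content_sum s : int := \sum_(b <- diagram s) content b.

Section SpechtChar.
Variables (F : numFieldType) (n : nat) (s : seq nat).
Hypothesis ps : is_part_of n s.
Local Notation chi := (@specht_char F n s).
Local Notation row := (fun x : 'I_n => (box s x).1).
Local Notation col := (fun x : 'I_n => (box s x).2).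

Lemma specht_ychar g : chi g = @ychar n row col F g.
Proof. exact: specht_char_ychar (box_inj ps) (box_down ps) g. Qed.

Lemma specht_scale_gt0 : 0 < @yscale n row col F.
Proof. exact: yscale_gt0 (box_inj ps) (box_down ps). Qed.

Lemma specht_gt0 : 0 < specht_dim F n s.
Proof. exact: specht_dim_gt0 (box_inj ps) (box_down ps). Qed.

Lemma specht_schur K g : (size s <= K)%N -> chi g = schur F (stair_shift K (nth 0%N s)) g.
Proof.
move=> leK; rewrite specht_ychar.
have neq0 : @yscale n row col F != 0 by rewrite gt_eqF ?specht_scale_gt0.
apply: (ychar_schur (box_inj ps) (box_down ps) neq0); first exact: (card_box_row ps).
  by move=> x; apply: leq_trans leK; apply: box_row_lt.
by move=> i; apply: part_nth_ge (part_of_part ps).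
Qed.

Lemma specht_real g : chi g \is Num.real.
Proof. by rewrite specht_ychar ychar_real. Qed.

(** By [ycoef_tperm] the eigenvalue is the number of ordered pairs in a common row, minus those in a
    common column, plus the diagonal: [(n + 2 \sum col) - (n + 2 \sum row) + n]. *)
Lemma specht_casimir g :
  \sum_i \sum_j chi (g * tperm i j)%g = (content_sum s *+ 2 + n%:Z)%:~R * chi g.
Proof.
under eq_bigr => i _ do under eq_bigr => j _ do rewrite specht_ychar.
rewrite specht_ychar (ychar_casimir (box_inj ps) (box_down ps)); congr (_ * _).
under eq_bigr => i _ do
  under eq_bigr => j _ do rewrite (ycoef_tperm (box_inj ps) (box_down ps)).
under eq_bigr => i _ do rewrite !big_split /= sumrN.
rewrite !big_split /= sumrN (sum_same_row _ (box_inj ps) (box_down ps)).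
have inj' (x y : 'I_n) : col x = col y -> row x = row y -> x = y.
  by move=> e1 e2; apply: (box_inj ps).
have down' (x : 'I_n) i j : (i <= col x)%N -> (j <= row x)%N ->
    exists y : 'I_n, col y = i /\ row y = j.
  by move=> l1 l2; have [y [e1 e2]] := box_down ps l2 l1; exists y.
rewrite (sum_same_row _ inj' down').
have -> : \sum_(i < n) \sum_(j < n) (i == j)%:R = n%:R :> F.
  rewrite -[in RHS](card_ord n) -sum1_card natr_sum; apply: eq_bigr => i _.
  by rewrite (bigD1 i) //= eqxx big1 ?addr0 // => j /negPf; rewrite eq_sym => ->.
rewrite rmorphD rmorphMn /=.
have -> : (content_sum s)%:~R = \sum_(i < n) (col i)%:R - \sum_(i < n) (row i)%:R :> F.
  rewrite -sumrB /content_sum -(sum_box ps) rmorph_sum /=.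
  by apply: eq_bigr => i _; rewrite rmorphB /=.
ring.
Qed.

Lemma specht_posdef : exists2 k : F, 0 <= k & exists2 c : 'S_n -> F,
  (forall g, c g \is Num.real) &
  forall g, chi g = k * \sum_h \sum_v c (v * (g ^ h)^-1)%g * c v.
Proof.
set N : F := #|row_stab row|%:R * #|col_stab col|%:R * @yscale n row col F.
have N0 : 0 < N.
  rewrite mulr_gt0 ?specht_scale_gt0 // mulr_gt0 // ltr0n.
    by rewrite (cardG_gt0 (row_stab_Group row)).
  by rewrite (cardG_gt0 (col_stab_Group col)).
exists N^-1; first by rewrite invr_ge0 ltW.
exists (@ycoef n row col F) => g; first exact: ycoef_real.
have neq0 : @yscale n row col F != 0 by rewrite gt_eqF ?specht_scale_gt0.
rewrite (ychar_posdef neq0) specht_ychar; set X := ychar _ _ _ _.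
by rewrite (_ : _ * (_ * X) = N * X) ?mulKf ?gt_eqF // mulrA.
Qed.
End SpechtChar.

(** * Horizontal strips *)

Section Interlacing.
Implicit Types (s t rho tau : seq nat).

Lemma eq_part s t : is_part s -> is_part t -> (forall i, nth 0 s i = nth 0 t i)%N -> s = t.
Proof.
move=> ps pt e.
have szle a b : is_part a -> (forall i, nth 0%N a i = nth 0%N b i) -> (size a <= size b)%N.
  move=> pa eab; rewrite leqNgt; apply/negP => lt.
  by have := part_nth_gt0 (size b) pa; rewrite lt eab nth_default.
have szE : size s = size t.
  by apply/eqP; rewrite eqn_leq (szle s t) // (szle t s) // => i; rewrite e.
by apply: (eq_from_nth (x0 := 0%N)) => // i _; apply: e.
Qed.

Lemma part_of_fun (f : nat -> nat) K : (forall i, f i.+1 <= f i)%N -> f K = 0%N ->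
  exists s, [/\ is_part s, (size s <= K)%N & forall i, nth 0%N s i = f i].
Proof.
move=> fdec fK; have ex0 : exists i, f i == 0%N by exists K; rewrite fK.
case: (ex_minnP ex0) => l /eqP fl lmin.
have fhomo i j : (i <= j)%N -> (f j <= f i)%N.
  elim: j => [|j IH]; first by rewrite leqn0 => /eqP ->.
  rewrite leq_eqVlt => /orP[/eqP -> //|/IH le]; exact: leq_trans le.
exists (mkseq f l); split; last 1 first.
- move=> i; case: (ltnP i l) => [lt|le]; first by rewrite nth_mkseq.
  by rewrite nth_default ?size_mkseq //; have := fhomo _ _ le; rewrite fl leqn0 => /eqP.
- apply/andP; split.
    apply/(sortedP 0%N) => i; rewrite size_mkseq => lt.
    by rewrite !nth_mkseq ?(ltnW lt) //=.
  apply/negP => /(nthP 0%N)[k]; rewrite size_mkseq => lt; rewrite nth_mkseq // => /eqP/lmin.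
  by rewrite leqNgt lt.
by rewrite size_mkseq lmin // fK.
Qed.

Lemma sub_partP s t : is_part t ->
  reflect (forall i, nth 0 t i <= nth 0 s i)%N (sub_part t s).
Proof.
move=> pt; apply: (iffP allP) => [sub i|le [i j]].
  case: (posnP (nth 0%N t i)) => [->//|gt0].
  have : (i, (nth 0 t i).-1) \in diagram t.
    by rewrite mem_diagram prednK // leqnn andbT -(part_nth_gt0 i pt).
  by move/sub; rewrite mem_diagram prednK // => /andP[].
rewrite !mem_diagram => /andP[_ ltj].
have lt : (j < nth 0 s i)%N := leq_trans ltj (le i).
rewrite lt andbT ltnNge; apply/negP => les; move: lt; rewrite nth_default //.
Qed.

Lemma mem_skew_boxes s t i j : is_part s -> is_part t ->
  ((i, j) \in skew_boxes s t) = (nth 0 t i <= j < nth 0 s i)%N.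
Proof.
move=> ps pt; rewrite mem_filter !mem_diagram -!part_nth_gt0 //.
case: (ltnP j (nth 0 s i)) => lts; last by rewrite !andbF.
case: (ltnP j (nth 0 t i)) => ltt; first by rewrite (leq_ltn_trans _ ltt).
by rewrite !andbF (leq_ltn_trans _ lts).
Qed.

Lemma size_skew_boxes s t : is_part s -> is_part t -> sub_part t s ->
  (sumn t + size (skew_boxes s t) = sumn s)%N.
Proof.
move=> ps pt sub; rewrite -!size_diagram -size_cat; apply/perm_size/uniq_perm.
- rewrite cat_uniq uniq_diagram filter_uniq ?uniq_diagram // andbT /=.
  by apply/hasPn => b; rewrite mem_filter => /andP[].
- exact: uniq_diagram.
move=> b; rewrite mem_cat mem_filter; case: (boolP (b \in diagram t)) => //= bt.
by rewrite (allP sub _ bt).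
Qed.

Definition interlaced s t := forall i, (nth 0 s i.+1 <= nth 0 t i <= nth 0 s i)%N.

(** If row [i.+1] of [s] reaches beyond row [i] of [t], the boxes of rows [i] and [i.+1] in column
    [nth 0 t i] both lie in the skew shape. *)
Lemma horizontal_stripP s t : is_part s -> is_part t -> sub_part t s ->
  horizontal_strip (skew_boxes s t) <-> (forall i, nth 0 s i.+1 <= nth 0 t i)%N.
Proof.
move=> ps pt /(sub_partP s pt) sub; split.
  move=> us i; rewrite leqNgt; apply/negP => lt.
  set j := nth 0%N t i in lt.
  have b1 : (i, j) \in skew_boxes s t.
    by rewrite mem_skew_boxes // leqnn (leq_trans lt) ?part_nth_ge.
  have b2 : (i.+1, j) \in skew_boxes s t by rewrite mem_skew_boxes // lt part_nth_ge.
  have := inj_in_map; move: us; rewrite /horizontal_strip => us _.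
  have : index (i, j) (skew_boxes s t) = index (i.+1, j) (skew_boxes s t).
    apply/eqP; rewrite -(nth_uniq 0%N _ _ us) ?size_map ?index_mem //.
    by rewrite !(nth_map (0, 0)%N) ?index_mem // !nth_index.
  move=> /(congr1 (nth (0, 0)%N (skew_boxes s t))); rewrite !nth_index // => -[].
  by move/eqP; rewrite -[X in X == _]addn0 -addn1 eqn_add2l.
move=> inter; rewrite /horizontal_strip map_inj_in_uniq ?filter_uniq ?uniq_diagram //.
move=> [i j] [i' j']; rewrite !mem_skew_boxes //= => /andP[l1 l2] /andP[l3 l4] e; subst j'.
congr (_, _); apply/eqP; rewrite eqn_leq.
have H a b : (nth 0 t a <= j)%N -> (j < nth 0 s b)%N -> (b <= a)%N.
  move=> la lb; rewrite leqNgt; apply/negP => ltab.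
  have := leq_trans lb (part_nth_homo ps ltab); rewrite ltnNge.
  by rewrite (leq_trans (inter a) la).
by rewrite (H _ _ l3 l2) (H _ _ l1 l4).
Qed.

Lemma is_tailP s t : is_part s ->
  reflect [/\ is_part t, interlaced s t & t <> s] (is_tail s t).
Proof.
move=> ps; apply: (iffP and4P) => [[pt sub sz hs]|[pt inter ts]].
  split=> // [i|e].
    by rewrite ((horizontal_stripP ps pt sub).1 hs) (sub_partP s pt sub).
  move: sz; rewrite lt0n => /eqP; apply; rewrite -e in sub *.
  by have := size_skew_boxes pt pt sub; lia.
have sub : sub_part t s by apply/sub_partP => // i; have /andP[] := inter i.
split=> //; last by apply/horizontal_stripP => // i; have /andP[] := inter i.
rewrite lt0n; apply/eqP => sz0; apply: ts; apply: eq_part => // i.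
apply/eqP; rewrite eqn_leq (sub_partP s pt sub) leqNgt; apply/negP => lt.
have : (i, nth 0 t i)%N \in skew_boxes s t by rewrite mem_skew_boxes // leqnn.
by rewrite (size0nil sz0).
Qed.

Definition pieri_part (m : nat) rho t := (m + size (skew_boxes rho t))%N :: t.

Lemma skew_boxes_self s : skew_boxes s s = [::].
Proof. by apply/eqP; rewrite -(negbK (_ == _)) -has_filter; apply/hasPn => b bs; rewrite negbK. Qed.

Lemma pieri_part_self m rho : pieri_part m rho rho = m :: rho.
Proof. by rewrite /pieri_part skew_boxes_self addn0. Qed.

Section Pieri.
Variables (m q : nat) (rho : seq nat).
Hypothesis prho : is_part_of q rho.
Hypothesis le_m : (head 0 rho <= m)%N.
Let ps : is_part rho := part_of_part prho.

Lemma tail_interlaced t : t \in rho :: tails rho -> is_part t /\ interlaced rho t.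
Proof.
rewrite inE => /orP[/eqP -> |]; last by rewrite mem_tails => /(is_tailP _ ps)[].
by split=> // i; rewrite part_nth_ge // leqnn.
Qed.

Lemma tail_sum t : t \in rho :: tails rho -> (sumn t + size (skew_boxes rho t) = q)%N.
Proof.
move=> /tail_interlaced[pt inter]; rewrite size_skew_boxes ?(part_of_sum prho) //.
by apply/sub_partP => // i; have /andP[] := inter i.
Qed.

Lemma size_tail t : t \in rho :: tails rho -> (size t <= size rho)%N.
Proof.
move=> /tail_interlaced[pt inter]; rewrite leqNgt -(part_nth_gt0 _ pt); apply/negP => gt0.
have /andP[_] := inter (size rho); rewrite [leqRHS]nth_default // leqNgt.
by rewrite gt0.
Qed.

Lemma uniq_rho_tails : uniq (rho :: tails rho).
Proof.
by rewrite /= uniq_tails mem_tails andbT; apply/negP => /(is_tailP _ ps)[_ _].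
Qed.

Lemma pieri_part_of t : rho <> [::] -> t \in rho :: tails rho ->
  is_part_of (m + q) (pieri_part m rho t).
Proof.
move=> r0 ti; have [pt inter] := tail_interlaced ti; have := tail_sum ti.
rewrite /is_part_of /= => qE; apply/andP; split; last by rewrite -qE -addnA [(sumn t + _)%N]addnC.
have m0 : (0 < m)%N.
  apply: leq_trans le_m; rewrite -nth0 (part_nth_gt0 _ ps) lt0n.
  by apply: contra_not_neq r0 => /eqP/nilP.
have le_t : (head 0 t <= m)%N.
  by have /andP[_] := inter 0%N; rewrite !nth0 => /leq_trans; apply.
case/andP: pt => srt t0; apply/andP; split.
  case: t srt le_t {ti inter t0 qE} => //= x t -> le_x.
  by rewrite /geq /= (leq_trans le_x) // leq_addr.
by rewrite inE negb_or t0 andbT neq_ltn addn_gt0 m0.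
Qed.

(** Removing a strip of [j] boxes from [rho] and putting a row [m + j] on top amounts to adding a
    horizontal strip of [m] boxes to [rho]. The bound of the first part of [rho] by [m] enters in
    row 0. *)
Lemma pieri_part_interlaced t mu : t \in rho :: tails rho ->
  (forall i, nth 0 (pieri_part m rho t) i = mu i)%N ->
  forall i, (mu i.+1 <= nth 0 rho i <= mu i)%N.
Proof.
move=> ti e; have [pt inter] := tail_interlaced ti.
move=> i; rewrite -!e /=; have /andP[_ ->] := inter i.
case: i => [|i] /=; last by have /andP[] := inter i.
by rewrite nth0 (leq_trans le_m) // leq_addr.
Qed.

Lemma pieri_part_ex (mu : nat -> nat) : (forall i, mu i.+1 <= nth 0 rho i <= mu i)%N ->
  (\sum_(i < (size rho).+1) mu i = m + q)%N ->
  exists2 t, t \in rho :: tails rho & forall i, nth 0%N (pieri_part m rho t) i = mu i.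
Proof.
move=> inter smu; have mudec i : (mu i.+2 <= mu i.+1)%N.
  have /andP[_ l1] := inter i.+1; have /andP[l2 _] := inter i.+1.
  exact: leq_trans l2 l1.
have mu0 : mu (size rho).+1 = 0%N.
  by have /andP[+ _] := inter (size rho); rewrite nth_default // leqn0 => /eqP.
have [t [pt szt tE]] := part_of_fun mudec mu0.
have ti : t \in rho :: tails rho.
  rewrite inE; case: eqP => //= tr; rewrite mem_tails; apply/is_tailP => //.
  split=> // i; rewrite tE; have /andP[-> _] := inter i; rewrite andbT.
  by have /andP[_] := inter i.+1.
exists t => // -[|i] /=; last exact: tE.
have := tail_sum ti; move: smu; rewrite big_ord_recl /=.
rewrite (sumn_nth szt) (eq_bigr (fun i : 'I_(size rho) => mu i.+1)) => [|i _ //].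
rewrite [in X in _ -> X](eq_bigr (fun i : 'I_(size rho) => mu i.+1)) => [|i _ //].
move=> e1 e2; apply/eqP; rewrite -(eqn_add2r (\sum_(i < size rho) mu i.+1)) e1 -e2.
by apply/eqP; rewrite -addnA; congr addn; rewrite addnC.
Qed.
End Pieri.
End Interlacing.

(** * Pieri's rule *)

Section SchurBasis.
Variable F : numFieldType.

Lemma cfip_schur K n (mu : nat -> nat) : (\sum_(i < K) mu i = n)%N ->
  (forall i, mu i.+1 <= mu i)%N -> (forall i, K <= i -> mu i = 0)%N ->
  cfip (@schur F n K (stair_shift K mu)) (schur F (stair_shift K mu)) = 1.
Proof.
move=> sn mudec mu0; apply: cfip_schur1 => [a ea|].
  by have [-> ] := cfip_schur_perm_char F a sn mudec mu0.
by have [_ ->] := cfip_schur_perm_char F (fun i : 'I_K => mu i) sn mudec mu0.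
Qed.

(** By [exceeds_perm], no content in the expansion of the second factor is lexicographically below
    [nu], so all of them exceed [mu]. *)
Lemma cfip_schur_lex K n (mu nu : nat -> nat) (i0 : 'I_K) : (\sum_(i < K) mu i = n)%N ->
  (forall i, mu i.+1 <= mu i)%N -> (forall i, K <= i -> mu i = 0)%N ->
  (forall i : 'I_K, (i < i0)%N -> nu i = mu i) -> (mu i0 < nu i0)%N ->
  cfip (@schur F n K (stair_shift K mu)) (schur F (stair_shift K nu)) = 0.
Proof.
move=> sn mudec mu0 eqmn ltmn; rewrite cfipC cfip_suml big1 // => w _; rewrite cfipZl.
case: (boolP [forall i, _]) => [/forallP lew|_]; last first.
  by rewrite /cfip big1 ?mulr0 // => g _; rewrite mul0r.
pose a (i : 'I_K) := (stair_shift K nu i - staircase (w i))%N; have ea : exceeds a mu.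
  case: (eqVneq w 1%g) => [w1|/exceeds_perm/(_ lew)[i1 [eqi lti]]].
    by exists i0; split=> [i lti|]; rewrite /a w1 perm1 /stair_shift addnK // eqmn.
  case: (ltnP i1 i0) => [lt|le].
    exists i1; split=> [i li|]; last by rewrite /a -(eqmn i1).
    by rewrite /a eqi // eqmn // (ltn_trans li).
  exists i0; split=> [i li|]; first by rewrite /a eqi ?eqmn // (leq_trans li).
  apply: leq_trans ltmn _; rewrite /a.
  move: le; rewrite leq_eqVlt => /orP[/eqP/val_inj ->|/eqi ->//].
  exact: ltnW.
by have [E _] := cfip_schur_perm_char F a sn mudec mu0; rewrite cfipC (E ea) mulr0.
Qed.

Lemma cfip_schur_orth K n (mu nu : nat -> nat) :
  (\sum_(i < K) mu i = n)%N -> (\sum_(i < K) nu i = n)%N ->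
  (forall i, mu i.+1 <= mu i)%N -> (forall i, nu i.+1 <= nu i)%N ->
  (forall i, K <= i -> mu i = 0)%N -> (forall i, K <= i -> nu i = 0)%N ->
  cfip (@schur F n K (stair_shift K mu)) (schur F (stair_shift K nu)) =
  [forall i : 'I_K, mu i == nu i]%:R.
Proof.
move=> smu snu mudec nudec mu0 nu0; case: (boolP [forall i, _]) => [/forallP e|].
  rewrite -[RHS](cfip_schur smu mudec mu0); apply: eq_cfip => // g.
  by apply: eq_schur => i; rewrite /stair_shift (eqP (e i)).
move=> /forallPn[j nej].
case: (@arg_minnP _ j (fun i : 'I_K => mu i != nu i) (fun i => i : nat) nej) => i0 ne0 min0.
have eq_lt (i : 'I_K) : (i < i0)%N -> mu i = nu i.
  by move=> lti; apply/eqP; apply: contraLR lti => /min0; rewrite -leqNgt.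
move: ne0; rewrite neq_ltn => /orP[lt|lt].
  by rewrite (cfip_schur_lex smu mudec mu0 _ lt) // => i /eq_lt.
by rewrite cfipC (cfip_schur_lex snu nudec nu0 _ lt).
Qed.

(** Inverts the Jacobi-Trudi expansion. At [a + staircase] the identity term is [perm_char a]; every
    other admissible content has larger [wt], since [\sum_i staircase i * staircase (w i)] is
    maximal only at [w = 1]. As [wt] is at most [K * n] for contents of [n], a downward induction
    applies. *)
Lemma cfip_perm_char_eq0 K n (u : 'S_n -> F) :
  (forall gam : 'I_K -> nat, cfip u (schur F gam) = 0) ->
  forall a : 'I_K -> nat, cfip u (perm_char F a) = 0.
Proof.
move=> u0; pose wt (a : 'I_K -> nat) := (\sum_i staircase i * a i)%N.
suff H d a : (K * n - wt a < d)%N -> cfip u (perm_char F a) = 0 by move=> a; apply: (H _ a (ltnSn _)).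
elim: d a => // d IH a; rewrite ltnS => led.
case: (eqVneq (\sum_i a i)%N n) => [sa|sa]; last first.
  by rewrite /cfip big1 ?mulr0 // => g _; rewrite perm_char0 ?mulr0.
pose gam i := (a i + staircase i)%N.
have := u0 gam; rewrite cfipC cfip_suml (bigD1 1%g) //= big1 ?addr0 => [|w w1].
  rewrite cfipZl odd_perm1 mul1r (_ : [forall i, _]); last first.
    by apply/forallP => i; rewrite perm1 leq_addl.
  rewrite cfipC => <-; apply: eq_cfip => // g; apply: eq_perm_char => i.
  by rewrite perm1 addnK.
rewrite cfipZl; case: (boolP [forall i, _]) => [/forallP lew|_]; last first.
  by rewrite /cfip big1 ?mulr0 // => g _; rewrite mul0r.
rewrite cfipC IH ?mulr0 //.
have sb : (\sum_i (gam i - staircase (w i)) = n)%N.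
  apply/eqP; rewrite -(eqn_add2r (\sum_i staircase (w i))%N) -big_split /=.
  rewrite (eq_bigr gam) => [|i _]; last by rewrite subnK ?lew.
  by rewrite big_split /= sa sum_staircase_perm.
have lt_sq : (\sum_i staircase i * staircase (w i) < \sum_(i < K) staircase i ^ 2)%N.
  rewrite -(ltn_pmul2l (isT : 0 < 2)%N).
  have sq : (\sum_i staircase (w i) ^ 2 = \sum_(i < K) staircase i ^ 2)%N.
    by rewrite [RHS](reindex_inj (@perm_inj _ w)).
  rewrite [X in (_ < X)%N]mul2n -addnn -{2}sq -big_split /= big_distrr /=.
  have := @leqif_sum 'I_K xpredT _ _ _ (fun i _ => nat_Cauchy (staircase i) (staircase (w i))).
  rewrite ltn_neqAle => -[-> ->]; rewrite andbT.
  apply: contraNN w1 => /forallP e; apply/eqP/permP => i; rewrite perm1.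
  apply/val_inj; have := e i; rewrite /staircase /= => /eqP.
  by have := ltn_ord i; have := ltn_ord (w i); lia.
have lt_wt : (wt a < wt (fun i => gam i - staircase (w i)))%N.
  rewrite -(ltn_add2r (\sum_i staircase i * staircase (w i))%N) -[X in (_ < X)%N]big_split /=.
  rewrite [X in (_ < X)%N](eq_bigr (fun i : 'I_K => staircase i * a i + staircase i ^ 2)%N) => [|i _].
    by rewrite big_split /= ltn_add2l.
  by rewrite -mulnDr subnK ?lew // /gam mulnDr mulnn.
have bnd : (wt (fun i => gam i - staircase (w i)) <= K * n)%N.
  rewrite -sb big_distrr /=; apply: leq_sum => i _; rewrite leq_mul2r.
  by rewrite leq_subr orbT.
by apply: leq_trans led; lia.
Qed.

(** Straightening: two equal entries of [gam] make the Schur function its own opposite, and distinct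
    entries can be sorted at the cost of a sign, after which removing the staircase leaves a
    partition. *)
Lemma cfip_schur_eq0 K n (u : 'S_n -> F) :
  (forall mu : nat -> nat, (\sum_(i < K) mu i = n)%N -> (forall i, mu i.+1 <= mu i)%N ->
     (forall i, K <= i -> mu i = 0)%N -> cfip u (schur F (stair_shift K mu)) = 0) ->
  forall gam : 'I_K -> nat, cfip u (schur F gam) = 0.
Proof.
move=> u0 gam.
case: (eqVneq (\sum_i gam i)%N (n + \sum_i @staircase K i)%N) => [sg|sg]; last first.
  by rewrite /cfip big1 ?mulr0 // => g _; rewrite schur0 ?mulr0.
case: (boolP [exists i, exists j, (i != j) && (gam i == gam j)]).
  case/existsP => i /existsP[j /andP[ij /eqP gij]].
  rewrite /cfip big1 ?mulr0 // => g _.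
  have := schur_tperm F gam g ij; rewrite (@eq_schur _ _ _ _ gam) => [/eqP|k].
    by rewrite -addr_eq0 -mulr2n mulrn_eq0 => /eqP ->; rewrite mulr0.
  by case: tpermP => [->|->|].
move=> ninj; have ginj : injective gam.
  move=> i j gij; apply/eqP; apply: contraNT ninj => ij.
  by apply/existsP; exists i; apply/existsP; exists j; rewrite ij gij eqxx.
pose st := sort geq [tuple gam i | i < K].
have pst : perm_eq st [tuple gam i | i < K] by rewrite perm_sort.
have szst : size st = K by rewrite (perm_size pst) size_tuple.
have [v stE] := tuple_permP pst.
have nthE (i : 'I_K) : nth 0%N st i = gam (v i).
  by rewrite stE -tnth_nth !tnth_mktuple.
have srt : sorted gtn st.
  have : sorted geq st by apply: sort_sorted => x y; rewrite /geq /= leq_total.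
  move/sortedP => H; apply/(sortedP 0%N) => i lti.
  rewrite /= ltn_neqAle [X in _ && X](H 0%N) // andbT.
  have lti0 : (i < K)%N by rewrite -szst ltnW.
  have lti1 : (i.+1 < K)%N by rewrite -szst.
  rewrite (nthE (Ordinal lti0)) (nthE (Ordinal lti1)) (inj_eq ginj) (inj_eq perm_inj).
  by rewrite -val_eqE /= neq_ltn ltnSn orbT.
have stdec i : (i.+1 < K)%N -> (nth 0 st i.+1 < nth 0 st i)%N.
  by rewrite -szst; move/(sortedP 0%N): srt; apply.
(* Strict decrease makes every entry at least its staircase entry, so the subtraction defining [mu]
   below does not truncate. *)
have stge d i : (i + d.+1 = K)%N -> (d <= nth 0 st i)%N.
  elim: d i => // d IH i e; apply: leq_ltn_trans (IH i.+1 _) (stdec _ _); lia.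
pose mu i := (nth 0 st i - (K - i.+1))%N.
have muE (i : 'I_K) : stair_shift K mu i = gam (v i).
  rewrite /stair_shift /mu /staircase subnK ?nthE // -nthE; apply: stge.
  by have := ltn_ord i; lia.
have : cfip u (schur F (stair_shift K mu)) = 0.
  apply: u0 => [|i|i lei]; last by rewrite /mu nth_default ?szst.
    apply/eqP; rewrite -(eqn_add2r (\sum_i @staircase K i)%N) -sg -big_split /=.
    by rewrite (eq_bigr _ (fun i _ => muE i)) [X in _ == X](reindex_inj (@perm_inj _ v)).
  case: (ltnP i.+1 K) => [lt|le]; last by rewrite /mu nth_default ?szst.
  by rewrite /mu; have := stdec i lt; have := stge (K - i.+2)%N i.+1; lia.
rewrite (eq_cfip (v' := fun g => (-1) ^+ v * schur F gam g) (fun=> erefl)) => [|g].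
  by rewrite cfipC cfipZl cfipC => /eqP; rewrite mulf_eq0 signr_eq0 => /eqP.
by rewrite -schur_perm; apply: eq_schur.
Qed.
End SchurBasis.

Section PieriRule.
Variable F : numFieldType.

Lemma eq_ind_char m q (u v : 'S_q -> F) : u =1 v -> @ind_char F m q u =1 ind_char v.
Proof.
move=> uv g; congr (_ * _); apply: eq_bigr => k _; apply: eq_bigr => p _.
by apply: eq_bigr => s _; rewrite uv.
Qed.

Lemma ind_char_sum m q (I : finType) (c : I -> F) (u : I -> 'S_q -> F) (g : 'S_(m + q)) :
  ind_char (fun s => \sum_i c i * u i s) g = \sum_i c i * ind_char (u i) g.
Proof.
rewrite /ind_char; under [RHS]eq_bigr do rewrite mulrCA.
rewrite -mulr_sumr; congr (_ * _).
under [RHS]eq_bigr do rewrite mulr_sumr.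
rewrite [RHS]exchange_big /=; apply: eq_bigr => k _.
under [RHS]eq_bigr do rewrite mulr_sumr.
rewrite [RHS]exchange_big /=; apply: eq_bigr => p _.
under [RHS]eq_bigr do rewrite mulr_sumr.
rewrite [RHS]exchange_big /=; apply: eq_bigr => s _.
by rewrite mulr_sumr; apply: eq_bigr => i _; rewrite mulrCA.
Qed.

Lemma ind_char_real m q (u : 'S_q -> F) (g : 'S_(m + q)) :
  (forall s, u s \is Num.real) -> ind_char u g \is Num.real.
Proof.
move=> ur; apply: rpredM; first by rewrite rpredV rpredM ?rpred_nat.
apply: rpred_sum => k _; apply: rpred_sum => p _; apply: rpred_sum => s _.
by rewrite rpredM ?rpred_nat.
Qed.

Lemma cfip_ind_perm m q k (al : 'I_k -> nat) (u : 'S_(m + q) -> F) :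
  (forall a : 'I_k.+1 -> nat, cfip u (perm_char F a) = 0) ->
  cfip u (@ind_char F m q (perm_char F al)) = 0.
Proof.
move=> u0; pose a (i : 'I_k.+1) := if unlift ord0 i is Some j then al j else m.
rewrite -[RHS](u0 a); apply: eq_cfip => // g.
rewrite (@perm_char_ind F m q) /a ?unlift_none //; apply: eq_ind_char => s.
by apply: eq_perm_char => i; rewrite liftK.
Qed.

Variables (m q : nat) (rho : seq nat).
Hypothesis prho : is_part_of q rho.
Hypothesis rho_neq0 : rho <> [::].
Hypothesis le_m : (head 0 rho <= m)%N.
Let ps : is_part rho := part_of_part prho.
(** Adding a horizontal strip creates at most one new row. *)
Let K := (size rho).+1.

(** Reciprocity and cancellation leave the vectors [b] that interlace with [mu] plus staircase. Each
    one of the right size is itself a partition [ka] plus staircase, and orthonormality keeps only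
    [ka = rho]. *)
Lemma cfip_schur_ind_specht (mu : nat -> nat) :
  (\sum_(i < K) mu i = m + q)%N -> (forall i, mu i.+1 <= mu i)%N ->
  (forall i, K <= i -> mu i = 0)%N ->
  cfip (schur F (stair_shift K mu)) (@ind_char F m q (specht_char F rho)) =
  [forall i : 'I_K, (mu i.+1 <= nth 0 rho i <= mu i)%N]%:R.
Proof.
move=> smu mudec mu0.
pose rh (i : 'I_K) := stair_shift K (nth 0%N rho) i.
pose N := (\sum_i stair_shift K mu i + \sum_i rh i).+1.
have ltN i : (stair_shift K mu i < N)%N.
  by rewrite ltnS; apply: leq_trans (leq_addr _ _); rewrite (bigD1 i) //= leq_addr.
have ltr i : (rh i < N)%N.
  by rewrite ltnS; apply: leq_trans (leq_addl _ _); rewrite (bigD1 i) //= leq_addr.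
have sS : (\sum_i stair_shift K mu i = m + q + \sum_i @staircase K i)%N.
  by rewrite -smu -big_split.
pose L i := (mu i + (K - i.+1))%N.
rewrite (schur_ind _ sS ltN).
rewrite (interlacing_sum (L := L)) => [|b i j ij|i ltiK]; last 2 first.
- rewrite /cfip -mulrN -sumrN; congr (_ * _); apply: eq_bigr => g _.
  rewrite -mulNr -(schur_tperm _ _ _ ij); congr (_ * _).
  by apply: eq_schur => l; rewrite ffunE.
- by rewrite /L; have := mudec i; lia.
pose b0 : {ffun 'I_K -> 'I_N} := [ffun i => Ordinal (ltr i)].
have termE (b : {ffun 'I_K -> 'I_N}) : [forall i : 'I_K, (b i <= L i)%N &&
     ((i.+1 < K)%N ==> (L i.+1 < b i)%N)] ->
     cfip (schur F (fun i => b i)) (@specht_char F q rho) = (b == b0)%:R.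
  move=> /forallP Db.
  have srho : (\sum_(i < K) nth 0%N rho i = q)%N.
    by rewrite -sumn_nth ?leqnSn // (part_of_sum prho).
  case: (eqVneq (\sum_i b i)%N (q + \sum_i @staircase K i)%N) => [sb|sb]; last first.
    case: eqP => [eb|_]; last first.
      by rewrite /cfip big1 ?mulr0 // => g _; rewrite schur0 ?mul0r.
    case/eqP: sb; rewrite eb -[in RHS]srho -big_split /=.
    by apply: eq_bigr => i _; rewrite ffunE.
  pose bn i := oapp (fun j : 'I_K => b j : nat) 0%N (insub i).
  have bnE (i : 'I_K) : bn i = b i by rewrite /bn valK.
  have bn0 i : (K <= i)%N -> bn i = 0%N by move=> le; rewrite /bn insubF // ltnNge le.
  have bge (i : 'I_K) : (staircase i <= b i)%N.
    have /andP[_ /implyP Di] := Db i; rewrite /staircase.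
    case: (ltnP i.+1 K) => [lt|]; last by lia.
    by move: (Di lt); rewrite /L; lia.
  have bdec i : (i.+1 < K)%N -> (bn i.+1 < bn i)%N.
    move=> lt; have /andP[le1 _] := Db (Ordinal lt).
    have /andP[_ /implyP/(_ lt) l2] := Db (Ordinal (ltnW lt)).
    by rewrite (bnE (Ordinal lt)) (bnE (Ordinal (ltnW lt))); apply: leq_ltn_trans l2.
  pose ka i := (bn i - (K - i.+1))%N.
  have kaE (i : 'I_K) : stair_shift K ka i = b i.
    by rewrite /stair_shift /ka bnE subnK // bge.
  rewrite (eq_cfip (u' := schur F (stair_shift K ka))
     (v' := schur F (stair_shift K (nth 0%N rho)))); last 2 first.
  - by move=> g; apply: eq_schur.
  - by move=> g; apply: specht_schur.
  rewrite cfip_schur_orth //.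
  - congr (nat_of_bool _)%:R; apply/forallP/eqP => [e|eb i].
      apply/ffunP => i; apply/val_inj; rewrite ffunE /= -kaE /rh /stair_shift.
      by rewrite (eqP (e i)).
    apply/eqP/(@addIn (staircase i)); rewrite -[LHS]/(stair_shift K ka i) kaE eb ffunE //.
  - apply/eqP; rewrite -(eqn_add2r (\sum_i @staircase K i)%N) -sb -big_split /=.
    by apply/eqP; apply: eq_bigr => i _; rewrite -kaE.
  - move=> i; case: (ltnP i.+1 K) => [lt|le]; last by rewrite /ka bn0.
    by rewrite /ka; have := bdec i lt; lia.
  - by move=> i; apply: part_nth_ge.
  - by move=> i le; rewrite /ka bn0.
  by move=> i le; rewrite nth_default // ltnW.
case: (boolP [forall i, _]) => [/forallP int|nint]; last first.
  rewrite big1 // => b Db; rewrite (termE b Db); case: eqP => // eb.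
  case/negP: nint; apply/forallP => i; move/forallP: Db => /(_ i)/andP[l1 /implyP l2].
  move: l1 l2; rewrite eb ffunE /= /rh /stair_shift /L leq_add2r => -> l2; rewrite andbT.
  case: (ltnP i.+1 K) => [lt|le]; last by rewrite mu0.
  by move: (l2 lt); rewrite /staircase; lia.
have Db0 : [forall i : 'I_K, (b0 i <= L i)%N && ((i.+1 < K)%N ==> (L i.+1 < b0 i)%N)].
  apply/forallP => i; rewrite ffunE /= /rh /stair_shift /L leq_add2r.
  have /andP[l1 ->] := int i; apply/implyP => lt; move: l1; rewrite /staircase; lia.
rewrite (bigD1 b0) //= termE // eqxx big1 ?addr0 // => b /andP[Db /negPf nb].
by rewrite termE // nb.
Qed.

Let part_of t (ti : t \in rho :: tails rho) := pieri_part_of prho le_m rho_neq0 ti.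

Lemma size_pieri_part t : t \in rho :: tails rho -> (size (pieri_part m rho t) <= K)%N.
Proof. by move=> ti; rewrite /= ltnS (size_tail prho). Qed.

Lemma sum_specht_interlaced (mu : nat -> nat) :
  (\sum_(i < K) mu i = m + q)%N -> (forall i, mu i.+1 <= mu i)%N ->
  (forall i, K <= i -> mu i = 0)%N ->
  \sum_(t <- rho :: tails rho)
     cfip (schur F (stair_shift K mu)) (@specht_char F (m + q) (pieri_part m rho t)) =
  [forall i : 'I_K, (mu i.+1 <= nth 0 rho i <= mu i)%N]%:R.
Proof.
move=> smu mudec mu0.
pose P t := [forall i : 'I_K, mu i == nth 0 (pieri_part m rho t) i]%N.
have nth0K t i : t \in rho :: tails rho -> (K <= i)%N -> nth 0%N (pieri_part m rho t) i = 0%N.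
  by move=> ti le; rewrite nth_default // (leq_trans (size_pieri_part ti)).
have PP t : t \in rho :: tails rho -> P t -> forall i, nth 0%N (pieri_part m rho t) i = mu i.
  move=> ti /forallP e i; case: (ltnP i K) => [lt|le]; first by rewrite (eqP (e (Ordinal lt))).
  by rewrite nth0K // mu0.
rewrite big_seq (eq_bigr (fun t => (P t)%:R)) => [|t ti]; last first.
  rewrite (eq_cfip (u' := schur F (stair_shift K mu))
     (v' := schur F (stair_shift K (nth 0%N (pieri_part m rho t))))) //; last first.
    by move=> g; rewrite (specht_schur _ (part_of ti) _ (size_pieri_part ti)).
  rewrite cfip_schur_orth //.
  - by rewrite -sumn_nth ?size_pieri_part // (part_of_sum (part_of ti)).
  - by move=> i; apply: part_nth_ge; apply: part_of_part (part_of ti).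
  by move=> i; apply: nth0K.
rewrite -big_seq; case: (boolP [forall i, _]) => [/forallP int|nint]; last first.
  rewrite big_seq big1 // => t ti; case: (boolP (P t)) => // /(PP t ti) e.
  case/negP: nint; apply/forallP => i.
  exact: (pieri_part_interlaced prho le_m ti e).
have inter i : (mu i.+1 <= nth 0 rho i <= mu i)%N.
  case: (ltnP i K) => [lt|le]; first exact: (int (Ordinal lt)).
  by rewrite mu0 ?(leqW le) // nth_default // ltnW.
have [t ti tE] := pieri_part_ex prho inter smu.
rewrite (bigD1_seq t) ?(uniq_rho_tails prho) //= big1_seq ?addr0 => [|t' /andP[nt ti']].
  by rewrite (_ : P t) //; apply/forallP => i; rewrite tE.
case: (boolP (P t')) => // /(PP t' ti') e; case/eqP: nt.
apply: eq_part => [||i]; first by have [] := tail_interlaced prho ti'.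
  by have [] := tail_interlaced prho ti.
by have := tE i.+1; rewrite -(e i.+1) /= => ->.
Qed.

(* The difference of both sides is orthogonal to every Schur class function, hence to
   every permutation character, of which it is a combination. *)
Theorem specht_pieri (g : 'S_(m + q)) :
  ind_char (specht_char F rho) g =
  \sum_(t <- rho :: tails rho) specht_char F (pieri_part m rho t) g.
Proof.
pose S g := \sum_(t <- rho :: tails rho) @specht_char F (m + q) (pieri_part m rho t) g.
pose x g := @ind_char F m q (specht_char F rho) g - S g.
have cfipxr u : cfip u x = cfip u (@ind_char F m q (specht_char F rho)) -
    \sum_(t <- rho :: tails rho) cfip u (@specht_char F (m + q) (pieri_part m rho t)).
  rewrite /cfip -mulr_sumr -mulrBr; congr (_ * _).
  rewrite exchange_big -sumrB /=; apply: eq_bigr => h _.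
  by rewrite mulrBr mulr_sumr.
have xs (gam : 'I_K -> nat) : cfip x (schur F gam) = 0.
  apply: cfip_schur_eq0 => mu smu mudec mu0; rewrite cfipC cfipxr.
  by rewrite cfip_schur_ind_specht // sum_specht_interlaced // subrr.
have xh (a : 'I_K -> nat) : cfip x (perm_char F a) = 0 by apply: cfip_perm_char_eq0.
have xx : cfip x x = 0.
  rewrite cfipxr big_seq big1 ?subr0 => [|t ti].
    (* Here [rho] is expanded with [size rho] rows rather than [K]: induction adds one letter, and
       the resulting permutation characters then have exactly the [K] letters covered by [xh]. *)
    pose al (w : 'S_(size rho)) i := (stair_shift _ (nth 0%N rho) i - staircase (w i))%N.
    pose ok (w : 'S_(size rho)) :=
      [forall i, (staircase (w i) <= stair_shift _ (nth 0%N rho) i)%N].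
    pose U w (s : 'S_q) := if ok w then perm_char F (al w) s else 0.
    have -> : cfip x (@ind_char F m q (specht_char F rho)) =
      cfip x (fun g => \sum_w (-1) ^+ odd_perm w * @ind_char F m q (U w) g).
      apply: eq_cfip => // h; rewrite -ind_char_sum; apply: eq_ind_char => s.
      exact: specht_schur.
    rewrite cfipC cfip_suml big1 // => w _; rewrite cfipZl cfipC.
    case: (boolP (ok w)) => okw.
      rewrite (eq_cfip (u' := x) (v' := @ind_char F m q (perm_char F (al w)))) //.
        by rewrite cfip_ind_perm ?mulr0.
      by apply: eq_ind_char => s; rewrite /U okw.
    rewrite /cfip big1 ?mulr0 // => h _; rewrite /ind_char.
    rewrite big1 ?mulr0 // => k _; rewrite big1 // => p _; rewrite big1 // => s _.
    by rewrite /U (negPf okw) mulr0.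
  rewrite -[RHS](xs (stair_shift K (nth 0%N (pieri_part m rho t)))); apply: eq_cfip => // h.
  by rewrite (specht_schur _ (part_of ti) _ (size_pieri_part ti)).
apply/eqP; rewrite -subr_eq0; apply/eqP; apply: (cfip_real_eq0 _ xx) => h.
rewrite rpredB //; first by apply: ind_char_real => s; apply: specht_real prho s.
by rewrite /S big_seq rpred_sum // => t ti; apply: specht_real (part_of ti) h.
Qed.
End PieriRule.

(** * Positivity of the crossing transpositions *)

Lemma big_distr4 (R : comPzRingType) (I J K L : finType)
    (a : I -> R) (b : J -> R) (c : K -> R) (d : L -> R) :
  \sum_k \sum_i \sum_l \sum_j a i * b j * (c k * d l) =
  (\sum_i a i) * (\sum_j b j) * ((\sum_k c k) * (\sum_l d l)).
Proof.
rewrite [RHS](_ : _ = (\sum_k c k) * ((\sum_i a i) * ((\sum_l d l) * (\sum_j b j)))); last by ring.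
rewrite mulr_suml; apply: eq_bigr => k _.
rewrite mulr_suml mulr_sumr; apply: eq_bigr => i _.
rewrite mulr_suml !mulr_sumr; apply: eq_bigr => l _.
by rewrite !mulr_sumr; apply: eq_bigr => j _; ring.
Qed.

Section CrossPositivity.
Variables (C : numClosedFieldType) (m q : nat).
Local Notation n := (m + q)%N.
Variables (v : 'I_n -> 'I_n -> C) (d : 'S_q -> C).
Hypothesis d_real : forall s, d s \is Num.real.
Variables (i0 : 'I_m) (j0 : 'I_q).
Let a : 'I_n := lshift q i0.
Let b : 'I_n := rshift m j0.
Let t := tperm a b.
Local Notation word := {ffun 'I_n -> 'I_n}.

(** [Y1] and [Y2] are the coordinates at [f] of the symmetrised tensor of the first [m] vectors and
    of the [d]-weighted tensor of the last [q]; each depends on the letters of its own block. *)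
Let Y1 (f : word) := \sum_(p : 'S_m) \prod_(i < m) v (lshift q (p i)) (f (lshift q i)).
Let Y2 (f : word) := \sum_(s : 'S_q) d s * \prod_(j < q) v (rshift m (s j)) (f (rshift m j)).
Let upd (f : word) (x y : 'I_n) : word :=
  [ffun z => if z == a then x else if z == b then y else f z].

Let ab : b == a = false.
Proof. by apply/negbTE; rewrite eq_rlshift. Qed.

(** Separates the letters at positions [a] and [b] from the others. Words agreeing elsewhere are
    represented by the one with the letter [a], an arbitrary placeholder, in both positions. *)
Lemma sum_upd (R : nmodType) (Phi : word -> R) :
  \sum_f Phi f = \sum_(f : word | (f a == a) && (f b == a)) \sum_x \sum_y Phi (upd f x y).
Proof.
rewrite (partition_big (fun f => upd f a a) (fun f : word => (f a == a) && (f b == a))) /=; last first.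
  by move=> f _; rewrite !ffunE !eqxx ab eqxx.
apply: eq_bigr => f /andP[/eqP fa /eqP fb]; rewrite pair_bigA /=.
rewrite (reindex_onto (fun z => upd f z.1 z.2) (fun g : word => (g a, g b))) /=; last first.
  move=> g /eqP e; apply/ffunP => z; rewrite !ffunE /=.
  case: eqP => [->//|/eqP za]; case: eqP => [->//|/eqP zb].
  by rewrite -e !ffunE (negPf za) (negPf zb).
apply: eq_bigl => -[x y] /=; rewrite !ffunE !eqxx ab eqxx andbT.
apply/eqP/ffunP => z; rewrite !ffunE.
by case: eqP => [->//|_]; case: eqP => [->//|_].
Qed.

(* For tensors [f] and [g], exchanging a factor of [f] with a factor of [g] in [f (x) g] has
   expectation the squared norm of a contraction of [f] with the conjugate of [g]. *)
Lemma cross_ge0 :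
  0 <= \sum_(p1 : 'S_m) \sum_(p2 : 'S_m) \sum_(s1 : 'S_q) \sum_(s2 : 'S_q) d s1 * d s2 *
    \prod_z (\sum_e v (bperm p2 s2 z) e * (v (bperm p1 s1 (t z)) e)^*).
Proof.
pose ft (f : word) : word := [ffun z => f (t z)].
have -> : \sum_(p1 : 'S_m) \sum_(p2 : 'S_m) \sum_(s1 : 'S_q) \sum_(s2 : 'S_q) d s1 * d s2 *
    \prod_z (\sum_e v (bperm p2 s2 z) e * (v (bperm p1 s1 (t z)) e)^*) =
    \sum_f Y1 f * Y2 f * ((Y1 (ft f))^* * (Y2 (ft f))^*).
  have E p1 p2 s1 s2 : d s1 * d s2 *
      \prod_z (\sum_e v (bperm p2 s2 z) e * (v (bperm p1 s1 (t z)) e)^*) =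
      \sum_(f : word) (\prod_(i < m) v (lshift q (p2 i)) (f (lshift q i))) *
         (d s2 * \prod_(j < q) v (rshift m (s2 j)) (f (rshift m j))) *
        ((\prod_(i < m) v (lshift q (p1 i)) (ft f (lshift q i)))^* *
         (d s1 * \prod_(j < q) v (rshift m (s1 j)) (ft f (rshift m j)))^*).
    rewrite bigA_distr_bigA mulr_sumr /=; apply: eq_bigr => f _.
    rewrite big_split /= [X in _ * (_ * X) = _](reindex_inj (@perm_inj _ t)) /=.
    under [X in _ * (_ * X) = _]eq_bigr => z _ do rewrite tpermK.
    rewrite -rmorph_prod !big_split_ord /=.
    under eq_bigr => i _ do rewrite bperml.
    under [X in _ * (_ * X * _)]eq_bigr => i _ do rewrite bpermr.
    under [X in _ * (_ * (X * _)^*)]eq_bigr => i _ do rewrite bperml.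
    under [X in _ * (_ * (_ * X)^*)]eq_bigr => i _ do rewrite bpermr.
    have -> : \prod_(i < m) v (lshift q (p1 i)) (ft f (lshift q i)) =
      \prod_(i < m) v (lshift q (p1 i)) (f (t (lshift q i))).
      by apply: eq_bigr => i _; rewrite ffunE.
    have -> : \prod_(j < q) v (rshift m (s1 j)) (ft f (rshift m j)) =
      \prod_(j < q) v (rshift m (s1 j)) (f (t (rshift m j))).
      by apply: eq_bigr => i _; rewrite ffunE.
    rewrite !rmorphM /= (CrealP (d_real s1)); ring.
  under eq_bigr => p1 _ do under eq_bigr => p2 _ do under eq_bigr => s1 _ do
    rewrite (eq_bigr _ (fun s2 _ => E p1 p2 s1 s2)).
  under eq_bigr => p1 _ do under eq_bigr => p2 _ do under eq_bigr => s1 _ do rewrite exchange_big /=.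
  under eq_bigr => p1 _ do under eq_bigr => p2 _ do rewrite exchange_big /=.
  under eq_bigr => p1 _ do rewrite exchange_big /=.
  rewrite exchange_big /=; apply: eq_bigr => f _.
  by rewrite big_distr4 /Y1 /Y2 !rmorph_sum.
rewrite sum_upd; apply: sumr_ge0 => f _.
(* With the other letters fixed, the first tensor sees the letter at [a] alone, the second the
   letter at [b] alone, and the transposition swaps them; the double sum becomes a number times its
   conjugate. *)
pose G x := Y1 (upd f x x); pose H x := Y2 (upd f x x).
have GE x y : Y1 (upd f x y) = G x.
  apply: eq_bigr => p _; apply: eq_bigr => i _; congr (v _ _); rewrite !ffunE.
  by rewrite (_ : lshift q i == b = false) ?if_same //; apply/negbTE; rewrite eq_lrshift.
have HE x y : Y2 (upd f x y) = H y.
  apply: eq_bigr => p _; congr (_ * _); apply: eq_bigr => i _; congr (v _ _); rewrite !ffunE.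
  by rewrite (_ : rshift m i == a = false) //; apply/negbTE; rewrite eq_rlshift.
have ftE x y : ft (upd f x y) = upd f y x.
  apply/ffunP => z; rewrite !ffunE; case: tpermP => [->|->|/eqP za /eqP zb].
  - by rewrite ab eqxx eqxx.
  - by rewrite !eqxx ab.
  by rewrite (negPf za) (negPf zb).
have -> : \sum_x \sum_y Y1 (upd f x y) * Y2 (upd f x y) *
    ((Y1 (ft (upd f x y)))^* * (Y2 (ft (upd f x y)))^*) =
    (\sum_x G x * (H x)^*) * (\sum_x G x * (H x)^*)^*.
  rewrite rmorph_sum mulr_suml /=; apply: eq_bigr => x _.
  rewrite mulr_sumr; apply: eq_bigr => y _.
  by rewrite ftE !GE !HE rmorphM /= conjCK; ring.
exact: mul_conjC_ge0.
Qed.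
End CrossPositivity.

(** * Contents and the weight of a tail *)

Section Content.
Implicit Types s t rho : seq nat.

Lemma bin2D m j : 'C(m + j, 2) = ('C(m, 2) + 'C(j, 2) + j * m)%N.
Proof.
elim: j => [|j IH]; first by rewrite addn0 /= !addn0.
by rewrite addnS !binS IH !bin1 mulSn; lia.
Qed.

Lemma bin2_double m : ('C(m, 2) * 2 + m = m ^ 2)%N.
Proof. by elim: m => // m IH; rewrite binS bin1; nia. Qed.

Lemma content_sum_cons a t : content_sum (a :: t) = 'C(a, 2)%:Z + content_sum t - (sumn t)%:Z.
Proof.
have cE s : content_sum s =
    \sum_(0 <= i < size s) \sum_(0 <= j < nth 0%N s i) (j%:Z - i%:Z).
  rewrite /content_sum /diagram big_allpairs_dep /= /index_iota subn0.
  by apply: eq_bigr => i _; rewrite subn0.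
rewrite !cE /= big_nat_recl //= -addrA; congr (_ + _).
  rewrite -bin2_sum -[RHS]natz natr_sum; apply: eq_bigr => i _.
  by rewrite subr0 natz.
have -> : (sumn t)%:Z = \sum_(0 <= i < size t) (nth 0%N t i)%:Z.
  by rewrite sumnE (big_nth 0%N) -natz natr_sum; apply: eq_bigr => i _; rewrite natz.
rewrite -sumrB; apply: eq_bigr => i _.
have -> : (nth 0%N t i)%:Z = \sum_(0 <= j < nth 0%N t i) 1 :> int.
  by rewrite sumr_const_nat subn0 natz.
by rewrite -sumrB; apply: eq_bigr => j _; rewrite -addn1 PoszD opprD addrA.
Qed.

Lemma content_sum_skew rho t : is_part rho -> is_part t -> sub_part t rho ->
  content_sum rho = content_sum t + \sum_(b <- skew_boxes rho t) content b.
Proof.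
move=> pr pt sub; rewrite /content_sum -big_cat /=; apply/perm_big/uniq_perm.
- exact: uniq_diagram.
- rewrite cat_uniq uniq_diagram filter_uniq ?uniq_diagram // andbT /=.
  by apply/hasPn => b; rewrite mem_filter => /andP[].
move=> b; rewrite mem_cat mem_filter; case: (boolP (b \in diagram t)) => //= bt.
by rewrite (allP sub _ bt).
Qed.

(** Doubled to match sums over ordered pairs, diagonal included: a partition [s] of [n] has
    eigenvalue [2 content_sum s + n] there, which for the trivial character of [S_m] is [m ^ 2]. *)
Lemma tail_weight_content (m : nat) rho t : is_part rho -> is_part t -> sub_part t rho ->
  (tail_weight m rho t) *+ 2 =
  content_sum (pieri_part m rho t) *+ 2 + (m + sumn rho)%N%:Z
  - ((m ^ 2)%N%:Z + (content_sum rho *+ 2 + (sumn rho)%:Z)).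
Proof.
move=> pr pt sub; rewrite /tail_weight /pieri_part content_sum_cons bin2D.
rewrite (content_sum_skew pr pt sub).
have := size_skew_boxes pr pt sub; set j := size _; set X := \sum_(b <- _) _.
have := bin2_double m; move: (content_sum t) X (sumn rho) (sumn t) => ct X r st e1 e2.
rewrite -e1 -e2 !PoszD !PoszM; ring.
Qed.
End Content.

(** * The transposition class sum on an induced character *)

Section CrossTerm.
Variables (F : numFieldType) (m q : nat).

Definition block_val (psi : 'S_q -> F) (h : 'S_(m + q)) : F :=
  \sum_(p : 'S_m) \sum_(s : 'S_q) (h == bperm p s)%:R * psi s.

Definition cross (psi : 'S_q -> F) (g : 'S_(m + q)) : F :=
  (m`!%:R * q`!%:R)^-1 * \sum_k \sum_(i : 'I_m) \sum_(j : 'I_q)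
    block_val psi (g ^ k * tperm (lshift q i) (rshift m j))%g.

Lemma block_val_bperm psi h p0 s0 :
  block_val psi (h * bperm p0 s0)%g = block_val (fun s => psi (s * s0)%g) h.
Proof.
rewrite /block_val (reindex_inj (mulIg p0)) /=; apply: eq_bigr => p _.
rewrite (reindex_inj (mulIg s0)) /=; apply: eq_bigr => s _.
by rewrite -bpermM (inj_eq (mulIg _)).
Qed.

(** Ordered pairs split by blocks: the [m ^ 2] pairs of the first block act trivially, those of the
    second through [w], and mixed pairs occur in both orders, whence the factor 2. *)
Lemma ind_char_casimir psi w (g : 'S_(m + q)) :
  (forall s, \sum_i \sum_j psi (s * tperm i j)%g = w * psi s) ->
  \sum_i \sum_j ind_char psi (g * tperm i j)%g =
  ((m ^ 2)%N%:R + w) * ind_char psi g + cross psi g *+ 2.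
Proof.
move=> psiw; pose B h := \sum_i \sum_j block_val psi (h * tperm i j)%g.
have BE h : B h = ((m ^ 2)%N%:R + w) * block_val psi h +
    (\sum_(i : 'I_m) \sum_(j : 'I_q)
       block_val psi (h * tperm (lshift q i) (rshift m j))%g) *+ 2.
  rewrite /B big_split_ord /=.
  under eq_bigr do rewrite big_split_ord /=.
  under [X in _ + X]eq_bigr do rewrite big_split_ord /=.
  rewrite !big_split /=.
  have -> : \sum_(i < m) \sum_(j < m) block_val psi (h * tperm (lshift q i) (lshift q j))%g
     = (m ^ 2)%N%:R * block_val psi h.
    have E i j : block_val psi (h * tperm (lshift q i) (lshift q j))%g = block_val psi h.
      have -> : tperm (lshift q i) (lshift q j) = bperm (tperm i j) 1.
        apply/permP => x; case: (split_ordP x) => y ->; rewrite ?bperml ?bpermr ?perm1.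
          by rewrite (inj_tperm _ _ _ (@lshift_inj m q)).
        by rewrite tpermD // eq_lrshift.
      rewrite block_val_bperm; apply: eq_bigr => p _; apply: eq_bigr => s _.
      by rewrite mulg1.
    under eq_bigr => i _ do rewrite (eq_bigr _ (fun j _ => E i j)) sumr_const card_ord.
    by rewrite sumr_const card_ord -mulrnA mulnn mulr_natl.
  have -> : \sum_(i < q) \sum_(j < q) block_val psi (h * tperm (rshift m i) (rshift m j))%g
     = w * block_val psi h.
    have E i j : block_val psi (h * tperm (rshift m i) (rshift m j))%g =
        block_val (fun s => psi (s * tperm i j)%g) h.
      have -> : tperm (rshift m i) (rshift m j) = bperm 1 (tperm i j).
        apply/permP => x; case: (split_ordP x) => y ->; rewrite ?bperml ?bpermr ?perm1.
          by rewrite tpermD // eq_rlshift.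
        by rewrite (inj_tperm _ _ _ (@rshift_inj m q)).
      by rewrite block_val_bperm.
    under eq_bigr => i _ do rewrite (eq_bigr _ (fun j _ => E i j)).
    rewrite /block_val mulr_sumr.
    under eq_bigr do rewrite exchange_big /=.
    rewrite exchange_big /=; apply: eq_bigr => p _.
    under eq_bigr do rewrite exchange_big /=.
    rewrite exchange_big /= mulr_sumr; apply: eq_bigr => s _.
    rewrite mulrCA -psiw mulr_sumr; apply: eq_bigr => i _.
    by rewrite mulr_sumr.
  have -> : \sum_(i < q) \sum_(j < m) block_val psi (h * tperm (rshift m i) (lshift q j))%g =
     \sum_(i : 'I_m) \sum_(j : 'I_q) block_val psi (h * tperm (lshift q i) (rshift m j))%g.
    rewrite exchange_big /=; apply: eq_bigr => i _; apply: eq_bigr => j _.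
    by rewrite tpermC.
  ring.
rewrite /ind_char -/(block_val psi).
under eq_bigr do rewrite -mulr_sumr.
rewrite -mulr_sumr.
have -> : \sum_i \sum_j \sum_(k : 'S_(m + q)) block_val psi ((g * tperm i j) ^ k)%g =
   \sum_(k : 'S_(m + q)) B (g ^ k)%g.
  under eq_bigr do rewrite exchange_big /=.
  rewrite exchange_big /=; apply: eq_bigr => k _.
  rewrite /B [RHS](reindex_inj (@perm_inj _ k)) /=; apply: eq_bigr => i _.
  rewrite [RHS](reindex_inj (@perm_inj _ k)) /=; apply: eq_bigr => j _.
  by rewrite conjMg tpermJ.
under eq_bigr do rewrite BE.
rewrite big_split /= -mulr_sumr mulrDr mulrCA -/(block_val psi); congr (_ + _).
by rewrite -mulrnAr -sumrMnl.
Qed.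

Lemma cross1 psi : cross psi 1 = 0.
Proof.
rewrite /cross big1 ?mulr0 // => k _; rewrite big1 // => i _; rewrite big1 // => j _.
rewrite /block_val big1 // => p _; rewrite big1 // => s _.
rewrite conj1g mul1g; case: eqP => [e|_]; last by rewrite mul0r.
have := congr1 (fun h : 'S_(m + q) => h (lshift q i)) e; rewrite tpermL bperml => /eqP.
by rewrite eq_rlshift.
Qed.

Lemma specht_cross rho : is_part_of q rho -> rho <> [::] -> (head 0 rho <= m)%N ->
  forall g, \sum_(t <- rho :: tails rho)
    (tail_weight m rho t)%:~R * specht_char F (pieri_part m rho t) g =
    cross (specht_char F rho) g.
Proof.
move=> pr r0 lem g.
have := ind_char_casimir g (specht_casimir F pr).
under eq_bigr do under eq_bigr do rewrite specht_pieri //.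
under eq_bigr do rewrite exchange_big /=.
rewrite exchange_big specht_pieri //= => H.
apply: (mulIf (_ : 2%:R != 0)); first by rewrite pnatr_eq0.
rewrite [RHS]mulr_natr; move/eqP: H; rewrite addrC -subr_eq => /eqP <-.
rewrite mulr_suml mulr_sumr -sumrB big_seq [RHS]big_seq; apply: eq_bigr => t ti.
have [pt inter] := tail_interlaced pr ti.
have sub : sub_part t rho by apply/sub_partP => // i; have /andP[] := inter i.
rewrite (specht_casimir F (pieri_part_of pr lem r0 ti)) -mulrBl mulrAC; congr (_ * _).
rewrite mulr_natr -rmorphMn /= tail_weight_content ?(part_of_part pr) // (part_of_sum pr).
by rewrite rmorphB !rmorphD /=.
Qed.
End CrossTerm.

(** * Gram vectors and the immanant of the crossing term *)

Section Immanant.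
Variable C : numClosedFieldType.

Lemma psd_gram n (A : 'M[C]_n) : psdmx A ->
  exists v : 'I_n -> 'I_n -> C, forall x y, A x y = \sum_e v x e * (v y e)^*.
Proof.
move=> [hermA posA]; have /orthomx_spectralP := hermitian_normalmx hermA.
set P := spectralmx A; set sp := spectral_diag A => AE.
have Pu : P \is unitarymx := spectral_unitarymx A.
have PPt : P *m map_mx Num.conj P^T = 1%:M by apply/unitarymxP.
have invP : invmx P = map_mx Num.conj P^T by rewrite invmx_unitary.
have PA : P *m A = diag_mx sp *m P.
  by rewrite AE !mulmxA mulmxV ?mul1mx // unitarymx_unit.
have sp_ge0 e : 0 <= sp 0 e.
  suff -> : sp 0 e = (row e P *m A *m map_mx Num.conj (row e P)^T) 0 0 by apply: posA.
  have PPe : \sum_j P e j * (P e j)^* = 1.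
    have := congr1 (fun M : 'M_n => M e e) PPt; rewrite !mxE eqxx mulr1n => <-.
    by apply: eq_bigr => j _; rewrite !mxE.
  rewrite -row_mul PA mxE -[LHS]mulr1 -PPe mulr_sumr; apply: eq_bigr => j _.
  by rewrite [row e _ 0 j]mxE mul_diag_mx !mxE mulrA.
exists (fun x e => (P e x)^* * sqrtC (sp 0 e)) => x y.
rewrite {1}AE invP mul_mx_diag mxE; apply: eq_bigr => e _.
rewrite !mxE rmorphM /= conjCK.
have -> : (sqrtC (sp 0 e))^* = sqrtC (sp 0 e).
  by apply/CrealP/ger0_real; rewrite sqrtC_ge0.
by rewrite mulrACA -expr2 sqrtCK mulrAC.
Qed.

Variables (m q : nat).
Local Notation n := (m + q)%N.

Lemma cross_immanant_ge0 (rho : seq nat) (A : 'M[C]_n) : is_part_of q rho -> psdmx A ->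
  0 <= \sum_(g : 'S_n) cross (specht_char C rho) g * \prod_x A x (g x).
Proof.
move=> pr /psd_gram[v vE].
have [k0 k0_ge0 [c c_real chiE]] := specht_posdef C pr.
set chi := specht_char C rho in chiE *.
(* Moving the average over conjugates from [cross] to the matrix product makes [Phi] a class
   function, so block permutations can be carried around the transposition. *)
pose P (k h : 'S_n) := \prod_z A (k^-1 z)%g (k^-1 (h z))%g.
pose Phi h := \sum_k P k h.
have PhiJ h r : Phi (h ^ r)%g = Phi h.
  rewrite /Phi (reindex_inj (mulIg r)) /=; apply: eq_bigr => k _.
  rewrite /P (reindex_inj (@perm_inj _ r)) /=; apply: eq_bigr => z _.
  by rewrite conjgE !invMg !permM !permK.
pose t i j : 'S_n := tperm (lshift q i) (rshift m j).
have -> : \sum_(g : 'S_n) cross chi g * \prod_x A x (g x) =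
  (m`!%:R * q`!%:R)^-1 * \sum_(i : 'I_m) \sum_(j : 'I_q)
    \sum_(p : 'S_m) \sum_(s : 'S_q) chi s * Phi (bperm p s * t i j)%g.
  under eq_bigr do rewrite /cross -mulrA.
  rewrite -mulr_sumr; congr (_ * _).
  under eq_bigr do rewrite mulr_suml.
  rewrite exchange_big /=.
  transitivity (\sum_(k : 'S_n) \sum_(h : 'S_n) (\sum_(i : 'I_m) \sum_(j : 'I_q)
     block_val chi (h * t i j)%g) * P k h).
    apply: eq_bigr => k _; rewrite (reindex_inj (@conjg_inj _ k^-1%g)) /=.
    apply: eq_bigr => h _; rewrite conjgKV; congr (_ * _).
    rewrite (reindex_inj (@perm_inj _ k^-1%g)) /=; apply: eq_bigr => z _.
    by rewrite conjgE invgK !permM permKV.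
  rewrite exchange_big /=.
  under eq_bigr do rewrite -mulr_sumr mulr_suml.
  rewrite exchange_big /=; apply: eq_bigr => i _.
  under eq_bigr do rewrite mulr_suml.
  rewrite exchange_big /=; apply: eq_bigr => j _.
  rewrite (reindex_inj (mulIg (t i j))) /=.
  under eq_bigr => h _ do rewrite -mulgA tperm2 mulg1 mulr_suml.
  rewrite exchange_big /=; apply: eq_bigr => p _.
  under eq_bigr => h _ do rewrite mulr_suml.
  rewrite exchange_big /=; apply: eq_bigr => s _.
  rewrite (bigD1 (bperm p s)) //= eqxx mul1r [X in _ + X]big1 ?addr0 // => h /negPf ->.
  by rewrite !mul0r.
apply: mulr_ge0; first by rewrite invr_ge0 mulr_ge0 ?ler0n.
apply: sumr_ge0 => i _; apply: sumr_ge0 => j _.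
have -> : \sum_(p : 'S_m) \sum_(s : 'S_q) chi s * Phi (bperm p s * t i j)%g =
  k0 * \sum_(h : 'S_q) \sum_(p : 'S_m) \sum_(s : 'S_q) \sum_w
    c (w * (s ^ h)^-1)%g * c w * Phi (bperm p s * t i j)%g.
  rewrite mulr_sumr exchange_big /=.
  under [RHS]eq_bigr do rewrite exchange_big /= mulr_sumr.
  rewrite [RHS]exchange_big /=; apply: eq_bigr => s _.
  rewrite chiE; under [RHS]eq_bigr do rewrite mulr_sumr.
  rewrite [RHS]exchange_big /=; apply: eq_bigr => p _.
  rewrite -mulrA mulr_suml mulr_sumr; apply: eq_bigr => h _.
  by rewrite mulr_suml.
apply: mulr_ge0 => //; apply: sumr_ge0 => h _.
(* Substituting [w = s2^-1 ^ h] and [s = s1 * s2^-1] turns the two values of [c] into [d s1] and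
   [d s2]. *)
pose d x := c ((x^-1)%g ^ h)%g.
have -> : \sum_(p : 'S_m) \sum_(s : 'S_q) \sum_w
    c (w * (s ^ h)^-1)%g * c w * Phi (bperm p s * t i j)%g =
  \sum_(p : 'S_m) \sum_(s1 : 'S_q) \sum_(s2 : 'S_q)
    d s1 * d s2 * Phi (bperm p (s1 * s2^-1) * t i j)%g.
  apply: eq_bigr => p _; rewrite exchange_big [RHS]exchange_big /=.
  rewrite (reindex_inj (@conjg_inj _ h)) (reindex_inj invg_inj) /=.
  apply: eq_bigr => w _; rewrite (reindex_inj (mulIg w^-1%g)) /=.
  by apply: eq_bigr => s _; rewrite /d -conjVg -conjMg invMg invgK mulKg.
(* The trivial character of [S_m] is split in the same way, [p = p1 * p2^-1] at the cost of a factor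
   [m!]; conjugating by [bperm p1 s1] then puts one block permutation on each side of the
   transposition. *)
rewrite -(pmulr_rge0 _ (_ : 0 < m`!%:R)) ?ltr0n ?fact_gt0 //.
have -> : m`!%:R * (\sum_(p : 'S_m) \sum_(s1 : 'S_q) \sum_(s2 : 'S_q)
    d s1 * d s2 * Phi (bperm p (s1 * s2^-1) * t i j)%g) =
  \sum_(p1 : 'S_m) \sum_(p2 : 'S_m) \sum_(s1 : 'S_q) \sum_(s2 : 'S_q)
    d s1 * d s2 * Phi ((bperm p2 s2)^-1 * t i j * bperm p1 s1)%g.
  rewrite [RHS]exchange_big -sum1_Sn mulr_suml; apply: eq_bigr => p2 _; rewrite mul1r.
  rewrite (reindex_inj (mulIg p2^-1%g)) /=; apply: eq_bigr => p1 _.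
  apply: eq_bigr => s1 _; apply: eq_bigr => s2 _; congr (_ * _).
  by rewrite -[LHS](PhiJ _ (bperm p1 s1)) conjgE (bpermV p2 s2) -!bpermM !mulgA mulVg mul1g.
have -> : \sum_(p1 : 'S_m) \sum_(p2 : 'S_m) \sum_(s1 : 'S_q) \sum_(s2 : 'S_q)
    d s1 * d s2 * Phi ((bperm p2 s2)^-1 * t i j * bperm p1 s1)%g =
  \sum_(k : 'S_n) \sum_(p1 : 'S_m) \sum_(p2 : 'S_m) \sum_(s1 : 'S_q) \sum_(s2 : 'S_q)
    d s1 * d s2 * \prod_z (\sum_e v (k (bperm p2 s2 z)) e * (v (k (bperm p1 s1 (t i j z))) e)^*).
  rewrite [RHS]exchange_big /=; apply: eq_bigr => p1 _.
  rewrite [RHS]exchange_big /=; apply: eq_bigr => p2 _.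
  rewrite [RHS]exchange_big /=; apply: eq_bigr => s1 _.
  rewrite [RHS]exchange_big /=; apply: eq_bigr => s2 _.
  rewrite mulr_sumr (reindex_inj invg_inj) /=; apply: eq_bigr => k _; congr (_ * _).
  rewrite /P invgK (reindex_inj (@perm_inj _ (bperm p2 s2))) /=; apply: eq_bigr => z _.
  by rewrite vE !permM permK.
apply: sumr_ge0 => k _; apply: (@cross_ge0 C m q (fun x e => v (k x) e) d) => s.
exact: c_real.
Qed.
End Immanant.

(** * Dominance *)

Section Criterion.
Implicit Types s rho tau : seq nat.

Lemma corner_contentsP s c : reflect
  (exists i, [/\ (i < size s)%N, (nth 0 s i.+1 < nth 0 s i)%N & c = (nth 0%N s i)%:Z - i.+1%:Z])
  (c \in corner_contents s).
Proof.
apply: (iffP mapP) => [[i + ->]|[i [lt co ->]]].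
  by rewrite mem_filter mem_iota add0n => /and3P[co _ lt]; exists i.
by exists i; rewrite // mem_filter co mem_iota.
Qed.

Lemma le_max_corner s c : c \in corner_contents s -> c <= max_corner s.
Proof. by move=> cs; apply: (le_bigmax_seq _ c xpredT). Qed.

Lemma max_corner_le s x : is_part s -> s <> [::] ->
  (forall c, c \in corner_contents s -> c <= x) -> max_corner s <= x.
Proof.
move=> ps s0 le; rewrite /max_corner big_seq; apply: bigmax_le => //.
(* The initial value of the maximum is the head of a nonempty list, the last row of a nonempty
   partition being a corner; so it is itself a corner content. *)
apply: le; case: s ps s0 => // a s ps _.
have : (nth 0%N (a :: s) (size s))%:Z - (size s).+1%:Z \in corner_contents (a :: s).
  apply/corner_contentsP; exists (size s); split=> //=.
  by rewrite [X in (X < _)%N]nth_default // (part_nth_gt0 _ ps).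
by case: corner_contents => //= c cs _; rewrite inE eqxx.
Qed.

Section Tail.
Variables (m : nat) (rho tau : seq nat).
Hypotheses (pr : is_part rho) (tl : is_tail rho tau).
Hypothesis crit : (sumn rho)%:Z + max_corner rho - 1 <= m%:Z.
Let j := size (skew_boxes rho tau).

Lemma tail_size_gt0 : (0 < j)%N.
Proof. by case/and4P: tl. Qed.

Lemma tail_sumn : (sumn tau + j = sumn rho)%N.
Proof. by case/and4P: tl => pt sub _ _; apply: size_skew_boxes. Qed.

(** In a row meeting the strip, [nth 0 rho i.+1 <= nth 0 tau i < nth 0 rho i], so the row ends in a
    corner, whose content bounds those of all boxes in the row. *)
Lemma tail_weight_ge0 : 0 <= tail_weight m rho tau.
Proof.
have [pt inter _] := is_tailP _ pr tl.
have leC b : b \in skew_boxes rho tau -> content b <= max_corner rho.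
  case: b => i y; rewrite mem_skew_boxes // => /andP[le1 lt2].
  have /andP[le3 _] := inter i.
  have lti : (i < size rho)%N by rewrite -(part_nth_gt0 _ pr) (leq_ltn_trans _ lt2).
  have /le_max_corner : (nth 0%N rho i)%:Z - i.+1%:Z \in corner_contents rho.
    apply/corner_contentsP; exists i; split=> //.
    exact: leq_ltn_trans (leq_trans le3 le1) lt2.
  by apply: le_trans; rewrite /content /=; lia.
have le_sum : \sum_(b <- skew_boxes rho tau) content b <= j%:Z * max_corner rho.
  rewrite /j; elim: (skew_boxes rho tau) leC => [|b D IH] leD.
    by rewrite big_nil mul0r.
  rewrite big_cons /= -addn1 PoszD addrC mulrDl mul1r lerD ?leD ?inE ?eqxx //.
  by apply: IH => b' b'D; apply: leD; rewrite inE b'D orbT.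
have := tail_size_gt0; move: le_sum crit; rewrite /tail_weight -/j.
move: (\sum_(b <- _) _) (max_corner rho) (sumn rho) j => X c r k l1 l2 k0.
have := leq0n 'C(k, 2); move: 'C(k, 2) => b2 _.
(* This is [j m - j C - q + j] regrouped: [j - 1] copies of [m - C + 1], and one copy from which [q]
   is paid. *)
have : (0 : int) <= (k%:Z - 1) * (m%:Z - c + 1) + (m%:Z - c + 1 - r%:Z).
  have h1 : (0 : int) <= m%:Z - c + 1 - r%:Z by lia.
  have h2 : (0 : int) <= m%:Z - c + 1 by lia.
  have h3 : (0 : int) <= k%:Z - 1 by lia.
  by rewrite addr_ge0 // mulr_ge0.
move=> h; apply: le_trans h _; rewrite -subr_ge0.
have -> : k%:Z * m%:Z + b2%:Z - X - r%:Z + k%:Z -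
  ((k%:Z - 1) * (m%:Z - c + 1) + (m%:Z - c + 1 - r%:Z)) = b2%:Z + (k%:Z * c - X) by ring.
by rewrite addr_ge0 // subr_ge0.
Qed.

(** A corner of [tau] in row [i] is compared with row [i] of [rho] if that row ends in a corner.
    Otherwise rows [i] and [i.+1] of [rho] have equal length, row [i.+1] ends in a corner, and being
    one row lower costs the extra 1. *)
Lemma tail_corner : tau <> [::] -> max_corner tau <= max_corner rho + 1.
Proof.
have [pt inter _] := is_tailP _ pr tl => t0.
apply: max_corner_le => // c /corner_contentsP[i [lti co ->]].
have /andP[le1 le2] := inter i; have /andP[le3 _] := inter i.+1.
case: (ltnP (nth 0%N rho i.+1) (nth 0%N rho i)) => [co'|noco].
  have /le_max_corner : (nth 0%N rho i)%:Z - i.+1%:Z \in corner_contents rho.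
    by apply/corner_contentsP; exists i; rewrite -(part_nth_gt0 _ pr) (leq_ltn_trans _ co').
  by move: le2; lia.
have lt2 : (nth 0 rho i.+2 < nth 0 rho i.+1)%N.
  by apply: leq_ltn_trans le3 _; apply: leq_trans co _; apply: leq_trans le2 noco.
have /le_max_corner : (nth 0%N rho i.+1)%:Z - i.+2%:Z \in corner_contents rho.
  by apply/corner_contentsP; exists i.+1; rewrite -(part_nth_gt0 _ pr) (leq_ltn_trans _ lt2).
by move: (leq_trans le2 noco); lia.
Qed.

(** The unit lost in [tail_corner] is paid by the [j >= 1] boxes that leave the tail. *)
Lemma tail_criterion : tau <> [::] ->
  (sumn tau)%:Z + max_corner tau - 1 <= (m + j)%N%:Z.
Proof.
move=> t0; have := tail_corner t0; have := tail_sumn; have := tail_size_gt0; move: crit.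
by move: (max_corner _) (max_corner _) => x y; lia.
Qed.

Lemma tail_head : (head 0 rho <= m)%N -> (head 0 tau <= m + j)%N.
Proof.
have [_ inter _] := is_tailP _ pr tl => lem; have /andP[_] := inter 0%N; rewrite !nth0 => le0.
by apply: leq_trans le0 _; apply: leq_trans lem _; apply: leq_addr.
Qed.
End Tail.
End Criterion.

(** * The inequality and the induction on the tail *)

Lemma specht_dim_trivial (F : numFieldType) n : (0 < n)%N -> specht_dim F n [:: n] = 1.
Proof.
move=> n0; have pn : is_part_of n [:: n].
  by rewrite /is_part_of /is_part /= inE addn0 eqxx andbT eq_sym -lt0n.
rewrite /specht_dim (specht_schur F pn (K := 1)) // /schur (bigD1 1%g) //=.
rewrite big1 ?addr0 => [|w]; last first.
  by case/eqP; apply/permP => i; rewrite !ord1.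
rewrite odd_perm1 mul1r (_ : [forall i, _]); last by apply/forallP => i; rewrite perm1 leq_addl.
rewrite /perm_char (bigD1 [ffun=> ord0]) /=; last first.
  apply/has_contentP => i; have -> : i = ord0 by rewrite ord1.
  rewrite perm1 addnK /= -[RHS]card_ord.
  by apply: eq_card => x; rewrite !inE ffunE eqxx.
rewrite big1 ?addr0 => [|f /andP[_ /eqP[]]]; last by apply/ffunP => x; rewrite !ord1.
by rewrite (_ : _ == _) //; apply/eqP/ffunP => x; rewrite !ffunE.
Qed.

Section Bound.
Variables (C : numClosedFieldType) (m : nat) (rho : seq nat).
Hypothesis pr : is_part rho.
Hypothesis rho_neq0 : rho <> [::].
Hypothesis le_m : (head 0 rho <= m)%N.
Local Notation q := (sumn rho).
Let pq : is_part_of q rho. Proof. by rewrite /is_part_of pr eqxx. Qed.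

Lemma sumn_gt0 : (0 < q)%N.
Proof.
rewrite (sumn_nth (leqnn _)); case: rho pr rho_neq0 => // a s ps _.
by rewrite big_ord_recl /= addn_gt0 (part_nth_gt0 0 ps).
Qed.

Lemma tail_weight_self : tail_weight m rho rho = - q%:Z.
Proof. by rewrite /tail_weight skew_boxes_self big_nil bin_small ?mul0r ?subr0 ?addr0 ?sub0r. Qed.

Lemma tail_part_of t : t \in tails rho -> is_part_of (m + q) (pieri_part m rho t).
Proof. by move=> ti; apply: pieri_part_of => //; rewrite inE ti orbT. Qed.

Let dim_gt0 : 0 < specht_dim C (m + q) (m :: rho).
Proof.
have := pieri_part_of pq le_m rho_neq0 (mem_head _ _).
by rewrite pieri_part_self => /specht_gt0; apply.
Qed.

Let q_neq0 : q%:R != 0 :> C.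
Proof. by rewrite pnatr_eq0 -lt0n sumn_gt0. Qed.

Lemma tail_coef_ge0 t : q%:Z + max_corner rho - 1 <= m%:Z -> is_tail rho t ->
  0 <= tail_coef C m rho t.
Proof.
move=> crit tl; rewrite /tail_coef mulr_ge0 ?invr_ge0 //; last first.
  by rewrite mulr_ge0 ?ler0n // ltW.
rewrite mulr_ge0 ?ler0z ?tail_weight_ge0 // ltW //.
by apply: specht_gt0; apply: tail_part_of; rewrite mem_tails.
Qed.

Lemma sum_tail_coef : \sum_(t <- tails rho) tail_coef C m rho t = 1.
Proof.
rewrite /tail_coef -mulr_suml.
have := specht_cross C pq rho_neq0 le_m 1; rewrite cross1 big_cons tail_weight_self.
rewrite pieri_part_self rmorphN mulNr => /eqP; rewrite addrC subr_eq0 => /eqP.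
rewrite /specht_dim => ->; rewrite divff // mulf_neq0 ?q_neq0 //.
by rewrite gt_eqF // dim_gt0.
Qed.

Lemma immanant_tails (A : 'M[C]_(m + q)) : psdmx A ->
  normalized_immanant (m :: rho) A <=
  \sum_(t <- tails rho) tail_coef C m rho t * normalized_immanant (pieri_part m rho t) A.
Proof.
move=> psdA; set d := specht_dim C (m + q) (m :: rho).
have -> : \sum_(t <- tails rho) tail_coef C m rho t * normalized_immanant (pieri_part m rho t) A
  = (q%:R * d)^-1 *
    \sum_(t <- tails rho) (tail_weight m rho t)%:~R * immanant (pieri_part m rho t) A.
  rewrite mulr_sumr big_seq [RHS]big_seq; apply: eq_bigr => t ti.
  rewrite /tail_coef /normalized_immanant -/d.
  have dt : specht_dim C (m + q) (pieri_part m rho t) != 0.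
    by rewrite gt_eqF // (specht_gt0 _ (tail_part_of ti)).
  rewrite -/(pieri_part m rho t); move: dt; set e := specht_dim _ _ _ => dt.
  rewrite -[RHS]mulr1 -(mulfV dt); set y := (q%:R * d)^-1; set z := e^-1; ring.
have := cross_immanant_ge0 pq psdA.
have -> : \sum_(g : 'S_(m + q)) cross (specht_char C rho) g * \prod_x A x (g x) =
   - (q%:R * immanant (m :: rho) A) +
   \sum_(t <- tails rho) (tail_weight m rho t)%:~R * immanant (pieri_part m rho t) A.
  under eq_bigr do rewrite -(specht_cross C pq rho_neq0 le_m) mulr_suml.
  rewrite exchange_big big_cons tail_weight_self pieri_part_self /=; congr (_ + _).
    by rewrite /immanant mulr_sumr -sumrN; apply: eq_bigr => g _; rewrite rmorphN !mulNr mulrA.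
  apply: eq_bigr => t _; rewrite /immanant mulr_sumr.
  by apply: eq_bigr => g _; rewrite mulrA.
rewrite addrC subr_ge0 => le; rewrite /normalized_immanant -/d invfM [X in _ <= X * _]mulrC.
rewrite -mulrA mulrC ler_pM2l ?invr_gt0 ?dim_gt0 //.
by rewrite ler_pdivlMl // ltr0n sumn_gt0.
Qed.
End Bound.

(** Induction on the size of the tail, with the coefficients as convex weights. The order [n] is a
    variable of its own because [m + j + sumn tau] and [m + sumn rho] are equal only
    propositionally. *)
Lemma permanent_dominates (C : numClosedFieldType) (k : nat) : forall n m rho, (sumn rho < k)%N ->
  is_part rho -> rho <> [::] -> (head 0 rho <= m)%N -> (m + sumn rho = n)%N ->
  (sumn rho)%:Z + max_corner rho - 1 <= m%:Z ->
  forall A : 'M[C]_n, psdmx A -> normalized_immanant (m :: rho) A <= permanent A.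
Proof.
elim: k => // k IH n m rho ltk pr r0 lem <- crit A psdA.
apply: le_trans (immanant_tails pr r0 lem psdA) _.
rewrite -[permanent A]mul1r -(sum_tail_coef C pr r0 lem) mulr_suml.
rewrite big_seq [leRHS]big_seq; apply: ler_sum => t; rewrite mem_tails => tl.
apply: ler_wpM2l; first exact: tail_coef_ge0.
have [pt _ _] := is_tailP _ pr tl.
have st := tail_sumn pr tl; have j0 := tail_size_gt0 tl.
(* The empty tail gives the one-row partition, of dimension one, so its normalized immanant is the
   permanent itself. *)
case: (t =P [::]) => [t0|t0].
  move: st; rewrite t0 /= add0n => st.
  rewrite /pieri_part st /normalized_immanant specht_dim_trivial ?divr1 //.
  by rewrite addn_gt0 (sumn_gt0 pr r0) orbT.
apply: IH => //; first by lia.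
- exact: tail_head tl lem.
- by rewrite -addnA [(size _ + _)%N]addnC st.
exact: tail_criterion.
Qed.

Theorem theorem1p3 (R : realType) (q m : nat) (rho : seq nat)
  (hrho : is_part_of q rho) (rho_neq0 : rho <> [::])
  (hm1 : (head 0 rho <= m)%N)
  (hm2 : q%:Z + max_corner rho - 1 <= m%:Z) :
  [/\ (forall A : 'M[R[i]]_(m + q), psdmx A ->
         normalized_immanant (m :: rho) A <= permanent A),
      (forall tau : seq nat, is_tail rho tau -> 0 <= tail_weight m rho tau),
      (forall A : 'M[R[i]]_(m + q), psdmx A ->
         normalized_immanant (m :: rho) A <=
           \sum_(tau <- tails rho)
              tail_coef R[i] m rho tau *
              normalized_immanant ((m + size (skew_boxes rho tau))%N :: tau) A),
      \sum_(tau <- tails rho) tail_coef R[i] m rho tau = 1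
    & (forall tau : seq nat, is_tail rho tau ->
         (sumn tau < sumn rho)%N /\
         (tau <> [::] ->
            (head 0 tau <= m + size (skew_boxes rho tau))%N /\
            (sumn tau)%:Z + max_corner tau - 1
              <= (m + size (skew_boxes rho tau))%:Z))].
Proof.
have [pr qE] : is_part rho /\ sumn rho = q by case/andP: hrho => pr /eqP.
subst q; split.
- move=> A; exact: (permanent_dominates (ltnSn _) pr rho_neq0 hm1 erefl hm2).
- by move=> tau tl; apply: tail_weight_ge0.
- by move=> A; apply: immanant_tails.
- exact: sum_tail_coef.
move=> tau tl; have := tail_sumn pr tl; have := tail_size_gt0 tl => j0 st; split; first by lia.
by move=> t0; split; [apply: tail_head | apply: tail_criterion].
Qed.
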